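(* Let $M$ be an arbitrary constant $n\times n$ matrix with complex entries. Then every analytic solution $(f,g)$ of the equation $\nabla f = M\nabla g$, where $f,g$ are scalar-valued functions on an open convex domain of an $n$-dimensional complex vector space, is $*$-analytic.
   Context: ''Analytic'' means complex analytic (holomorphic); $\nabla$ is the column vector of partial derivatives with respect to linear coordinates; $\mathbb{N}=\{0,1,2,\dots\}$. $U_k$ denotes the $(k+1)\times(k+1)$ nilpotent Jordan block with ones on the first superdiagonal and zeros elsewhere. Reduction. A linear change of variables $\tilde{\mathbf x}=A\mathbf x$ transforms $\nabla f=M\nabla g$ into $\nabla f=A^{-T}MA^{T}\nabla g$. Choose $A$ such that $A^{-T}MA^T=\mathrm{diag}(M^1,\dots,M^p)$, where $M^k$ corresponds to the $k$-th distinct eigenvalue $\lambda_k$ and $M^k-\lambda_k I=U^k:=\mathrm{diag}(U_{n_1},\dots,U_{n_m})$ with $n_1\ge\cdots\ge n_m\ge 0$ (the numbers $m,n_1,\dots,n_m$ depend on $k$). Let $\mathbf x^1,\dots,\mathbf x^m$, $\mathbf x^s=(x^s_0,\dots,x^s_{n_s})$, be the coordinates belonging to the Jordan blocks of $M^k$. $*$-multiplication. For $1\le s\le m$, the $s$-th (extended) subsystem belonging to $\lambda_k$ is $$\left(-\mathrm{diag}(U_{n_s},\dots,U_{n_m})+\mu I\right)\nabla V_\mu\equiv 0 \pmod{\mu^{n_s+1}},\qquad V_\mu=\sum_{i=0}^{n_s}V_i\mu^i ,$$ where the $V_i$ are functions of $\mathbf x^s,\dots,\mathbf x^m$ (a polynomial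 in $\mu$ with vector coefficients is $\equiv 0$ if it is divisible by $\mu^{n_s+1}$). The $*$-product of two solutions is the remainder of their ordinary product modulo $\mu^{n_s+1}$. A solution is simple if its coefficients $V_i$ are linear in the independent variables, and constant (trivial) if its coefficients are constants. $*$-powers. Given simple solutions $y^s_\mu$ of the $s$-th subsystem, $s=1,\dots,r$ ($1\le r\le m$), and $I=(i_1,\dots,i_r)\in\mathbb N^r$, define $P_r$ as the remainder of $(y^r_\mu)^{i_r}$ modulo $\mu^{n_r+1}$ and, for $s=r-1,\dots,1$, define $P_s$ as the remainder of $(y^s_\mu)^{i_s}\,\mu^{n_s-n_{s+1}}P_{s+1}$ modulo $\mu^{n_s+1}$ (multiplication by $\mu^{n_s-n_{s+1}}$ embeds solutions of the $(s+1)$-th subsystem into the solution space of the $s$-th one). Put $(\mathbf y_\mu)^I_*:=P_1$, a solution of the first subsystem. Definition of $*$-analytic. A solution $(f,g)$ of $\nabla f=M\nabla g$ is $*$-analytic if, around every point of its domain (taken as origin after a translation of coordinates), there are, for each $k=1,\dots,p$, a function $V^k_\mu$ which is a finite sum of convergent series of the form $\sum_{I\in\mathbb N^r}(b_I)_\mu*(\mathbf y_\mu)^I_*$ (with $1\le r\le m$, where the $(b_I)_\mu$ are constant solutions of the first subsystem belonging to $\lambda_k$, $y^s_\mu$ is a simple solution of the $s$-th subsystem belonging to $\lambda_k$ for $s=1,\dots,r$, and $*$ between $(b_I)_\mu$ and $(\mathbf y_\mu)^I_*$ is the multiplication of the first subsystem, i.e. modulo $\mu^{n_1+1}$), and a constant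 $c$, such that in a neighborhood of the point $$g=\sum_{k=1}^p g^k,\qquad f=\sum_{k=1}^p(\lambda_k g^k+h^k)+c,$$ where $g^k$ is the coefficient of $\mu^{n_1}$ in $V^k_\mu$, and $h^k$ is the coefficient of $\mu^{n_1-1}$ in $V^k_\mu$ (with $h^k:=0$ if $n_1=0$), $n_1=n_1(k)$ being the largest Jordan index for $\lambda_k$. *)

(* Defs.v *)
From HB Require Import structures.
From mathcomp Require Import all_boot all_order all_algebra.
From mathcomp Require Import complex.
From mathcomp Require Import boolp classical_sets reals topology normedtype.
From mathcomp Require Import derive convex.
From mathcomp.analysis.showcase Require Import summability.

Set Implicit Arguments.
Unset Strict Implicit.
Unset Printing Implicit Defensive.

Import Order.TTheory GRing.Theory Num.Theory numFieldNormedType.Exports.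
Local Open Scope classical_set_scope.
Local Open Scope ring_scope.

(* R[i] as a numClosedFieldType.  Written plainly, R[i] is also a module over *)
(* R; under this name it only gets the topology and the normed module         *)
(* structure over itself that every numClosedFieldType has.                   *)
Definition Cplx (R : realType) : numClosedFieldType := complex R.

Section StarAnalytic.
Variable C : numClosedFieldType.

Definition grad n (f : 'cV[C]_n -> C) (x : 'cV[C]_n) : 'cV[C]_n :=
  \col_i 'D_(delta_mx i 0) f x.

Definition holomorphic_on n (D : set 'cV[C]_n) (f : 'cV[C]_n -> C) : Prop :=
  forall x, D x -> differentiable f x.

Definition is_solution n (M : 'M[C]_n) (D : set 'cV[C]_n)
    (f g : 'cV[C]_n -> C) : Prop :=
  forall x, D x -> grad f x = M *m grad g x.

(* The list ns = [:: n_1; ...; n_m] holds the Jordan indices of one           *)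
(* eigenvalue: the block U_(n_t) has size n_t + 1.  Blocks and subsystems are *)
(* numbered from 0, so that the subsystem of index s has n_(s+1) = ns`_s.     *)
Notation jidx ns t := (nth 0%N ns t).
Notation jdim ns := (\sum_(t < size ns) (jidx ns t).+1)%N.

Definition nilU k : 'M[C]_k.+1 :=
  \matrix_(i, j) ((j : nat) == i.+1)%:R.

Definition nilblocks (ns : seq nat) : 'M[C]_(jdim ns) :=
  \mxdiag_(t < size ns) nilU (jidx ns t).

(* The new coordinates Ax are indexed by eigenvalue, then block, then         *)
(* position in the block.  Their number equals n only propositionally, hence  *)
(* the rectangular type of A and the explicit two-sided inverse B = A^-1.     *)
Record jordan_reduction n (M : 'M[C]_n) := JordanReduction {
  jr_p : nat;
  jr_lam : 'I_jr_p -> C;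
  jr_ns : 'I_jr_p -> seq nat;
  jr_A : 'M[C]_(\sum_(k < jr_p) jdim (jr_ns k), n);
  jr_B : 'M[C]_(n, \sum_(k < jr_p) jdim (jr_ns k));
  jr_lam_inj : injective jr_lam;
  jr_ns_gt0 : forall k, (0 < size (jr_ns k))%N;
  jr_ns_sorted : forall k, sorted geq (jr_ns k);
  jr_AB : jr_A *m jr_B = 1%:M;
  jr_BA : jr_B *m jr_A = 1%:M;
  jr_jordan : jr_B^T *m M *m jr_A^T =
    \mxdiag_(k < jr_p) ((jr_lam k)%:M + nilblocks (jr_ns k))
}.

Arguments jr_lam {n M} _ _.
Arguments jr_ns {n M} _ _.

Section OneEigenvalue.
Variable ns : seq nat.

(* 'X plays the role of mu.                                                   *)
Definition mugrad d (V : 'cV[C]_(jdim ns) -> {poly C}) (x : 'cV[C]_(jdim ns)) :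
    'cV[{poly C}]_(jdim ns) :=
  \col_i \poly_(j < d.+1) 'D_(delta_mx i 0) (fun z => (V z)`_j) x.

(* Functions of the coordinates of the blocks t >= s are represented as       *)
(* functions of all the coordinates that do not depend on the blocks t < s;   *)
(* as nilblocks is block diagonal, its rows in the blocks t >= s act through  *)
(* diag(U_(ns`_s), U_(ns`_s.+1), ...) on the blocks t >= s of the gradient.   *)
Definition subsystem (s : nat) (V : 'cV[C]_(jdim ns) -> {poly C}) : Prop :=
  [/\ forall x, (size (V x) <= (jidx ns s).+1)%N,
      forall x y : 'cV[C]_(jdim ns),
        (forall t : 'I_(size ns), (s <= t)%N -> submxcol x t = submxcol y t) ->
        V x = V y,
      forall j x, differentiable (fun z => (V z)`_j) x
    & forall x (t : 'I_(size ns)) i, (s <= t)%N ->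
        'X^((jidx ns s).+1) %|
          submxcol ((map_mx polyC (- nilblocks ns) + 'X%:M)
                      *m mugrad (jidx ns s) V x) t i 0].

Definition simple_solution s (V : 'cV[C]_(jdim ns) -> {poly C}) : Prop :=
  subsystem s V /\ forall j, scalar (fun x => (V x)`_j).

Definition constant_solution s (b : {poly C}) : Prop := subsystem s (fun=> b).

Definition starmul d (p q : {poly C}) : {poly C} := (p * q) %% 'X^(d.+1).

(* starpow_from y I s l is P_s in the recursion over the l + 1 subsystems     *)
(* s, s + 1, ..., s + l; here y is the list of values of the simple solutions *)
(* at a point.                                                                *)
Fixpoint starpow_from (y : nat -> {poly C}) (I : seq nat) (s l : nat) :
    {poly C} :=
  if l is l'.+1 then
    (y s ^+ jidx I s * 'X^(jidx ns s - jidx ns s.+1)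
       * starpow_from y I s.+1 l') %% 'X^((jidx ns s).+1)
  else y s ^+ jidx I s %% 'X^((jidx ns s).+1).

Definition starpow (y : nat -> {poly C}) r (I : r.-tuple nat) : {poly C} :=
  starpow_from y I 0 r.-1.

(* V is, near the origin, the sum of a convergent series of *-powers.  A      *)
(* series indexed by N^r has no preferred order of summation: convergence is  *)
(* that of the net of finite partial sums, coefficient by coefficient in mu.  *)
Definition star_series (V : 'cV[C]_(jdim ns) -> {poly C}) : Prop :=
  exists r (y : nat -> 'cV[C]_(jdim ns) -> {poly C})
         (b : r.-tuple nat -> {poly C}),
  [/\ (0 < r <= size ns)%N,
      forall s, (s < r)%N -> simple_solution s (y s),
      forall I, constant_solution 0 (b I)
    & \forall x \near (0 : 'cV[C]_(jdim ns)), forall j,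
        partial_sum
          (fun I => (starmul (jidx ns 0) (b I) (starpow (y^~ x) I))`_j)
          @ totally --> (V x)`_j].

Definition sum_of_star_series (V : 'cV[C]_(jdim ns) -> {poly C}) : Prop :=
  exists Q (W : 'I_Q -> 'cV[C]_(jdim ns) -> {poly C}),
    (forall q, star_series (W q)) /\ forall x, V x = \sum_(q < Q) W q x.

Definition top_coef (p : {poly C}) : C := p`_(jidx ns 0).

Definition subtop_coef (p : {poly C}) : C :=
  if jidx ns 0 is d.+1 then p`_d else 0.

End OneEigenvalue.

Definition star_analytic_wrt n (M : 'M[C]_n) (J : jordan_reduction M)
    (D : set 'cV[C]_n) (f g : 'cV[C]_n -> C) : Prop :=
  forall a, D a ->
  exists (V : forall k, 'cV[C]_(jdim (jr_ns J k)) -> {poly C}) (c : C),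
    (forall k, sum_of_star_series (V k)) /\
    \forall x \near a,
      let v k := V k (submxcol (jr_A J *m (x - a)) k) in
      let gk k := top_coef (jr_ns J k) (v k) in
      let hk k := subtop_coef (jr_ns J k) (v k) in
      g x = \sum_k gk k /\ f x = \sum_k (jr_lam J k * gk k + hk k) + c.

(* A reduction of M to Jordan form has to be chosen; we ask that there be one *)
(* and that the representation exist whichever is chosen.                     *)
Definition star_analytic n (M : 'M[C]_n) (D : set 'cV[C]_n)
    (f g : 'cV[C]_n -> C) : Prop :=
  inhabited (jordan_reduction M) /\
  forall J : jordan_reduction M, star_analytic_wrt J D f g.

End StarAnalytic.

(* Main.v *)
From HB Require Import structures.
Require Import Defs.
From mathcomp Require Import all_boot all_order all_algebra.
From mathcomp Require Import finmap complex ring lra zify.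
From mathcomp Require Import boolp classical_sets reals topology normedtype.
From mathcomp Require Import derive convex realfun trigo.
From mathcomp.analysis.showcase Require Import summability.

Set Implicit Arguments.
Unset Strict Implicit.
Unset Printing Implicit Defensive.

Import Order.TTheory GRing.Theory Num.Theory numFieldNormedType.Exports.
Local Open Scope classical_set_scope.
Local Open Scope ring_scope.

(** Let U be the nilpotent part of a Jordan block matrix, and suppose that the
    gradient of h is U times the gradient of g. Symmetry of the second derivatives
    of h says that U times the Hessian of g is symmetric, so that the Hessian of g
    consists of Hankel blocks: a derivative of g of order at least two depends
    only on the blocks of the variables and on the sum of their positions in
    these blocks, and it vanishes as soon as this sum exceeds the Jordan index of
    one of the blocks (shift1, collect_weight, Gam_eq0). For two distinct
    eigenvalues, the mixed second derivatives vanish (mixed_eq0). Hence, in the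
    Taylor expansion of g, all monomials with given blocks and given total
    position w have the same derivative as coefficient, and their sum is the
    coefficient of mu^w in a product of the simple solutions
    y_t = x_(t,0) + x_(t,1) mu + x_(t,2) mu^2 + ... (positions_sum_poly). Placing
    the coefficient attached to w at mu^(n_1 - w) exhibits g as the coefficient of
    mu^(n_1) of a combination of products of the y_t. The coefficient below
    it is h, since U raises positions by one (form_G, form_F). When the last
    block involved is the one of index q, the weights do not exceed its Jordan
    index, which provides the power of mu required in a star-power of the first
    q + 1 subsystems (star_term). This gives the representation, one series for
    each q and each eigenvalue (star_representation).

    Convergence, and the expansion itself, rest on Taylor's formula for functions
    of several variables that are only assumed complex differentiable. Goursat's
    theorem is proved for Riemann sums of contour integrals instead of the
    integrals (goursat_annulus); it yields Cauchy's estimate for the first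
    derivative (cauchy_estimate). Applied to difference quotients, this estimate
    shows that directional derivatives are again holomorphic and commute
    (hol_second, hol_dirder, dirder_comm); iterating it bounds all derivatives, and
    Taylor's formula follows from the mean value inequality (taylor_rate). A
    geometric bound on the contributions of words allows passing from sums by
    degree to unordered sums over exponents (profile_sum_cvg).

    The Jordan form itself is obtained by induction on the dimension, extending
    the chains of the image of phi - a to the whole space (jordan_chains). *)

(** * The modulus and the unit circle *)

Section Modulus.
Variable R : realType.
Notation C := (Cplx R).
Implicit Types (z w : C) (x y : R).

Definition rc x : C := (x%:C)%C.

HB.instance Definition _ := GRing.RMorphism.copy rc (real_complex R).

(** The modulus as an element of R: the order of the complex field is only
    partial, while estimates need the total order of R. *)
Definition cmod z : R := complex.Re `|z|.

Lemma cmodE z : `|z| = rc (cmod z).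
Proof. by rewrite /cmod normc_def. Qed.

Lemma cmod_sqrt z :
  cmod z = Num.sqrt ((complex.Re z) ^+ 2 + (complex.Im z) ^+ 2).
Proof. by rewrite /cmod normc_def. Qed.

Lemma rc_inj : injective rc.
Proof. exact: complexI. Qed.

Lemma rc_le x y : (rc x <= rc y) = (x <= y).
Proof. exact: lecR. Qed.

Lemma rc_lt x y : (rc x < rc y) = (x < y).
Proof. exact: ltcR. Qed.

Lemma cmod_ge0 z : 0 <= cmod z.
Proof. by rewrite -rc_le -cmodE rmorph0. Qed.

Lemma cmod0 : cmod 0 = 0.
Proof. by apply: rc_inj; rewrite -cmodE normr0 rmorph0. Qed.

Lemma cmod1 : cmod 1 = 1.
Proof. by apply: rc_inj; rewrite -cmodE normr1 rmorph1. Qed.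

Lemma cmod_gt0 z : z != 0 -> 0 < cmod z.
Proof. by rewrite -rc_lt -cmodE rmorph0 normr_gt0. Qed.

Lemma cmodM z w : cmod (z * w) = cmod z * cmod w.
Proof. by apply: rc_inj; rewrite rmorphM -!cmodE normrM. Qed.

Lemma cmodD z w : cmod (z + w) <= cmod z + cmod w.
Proof. by rewrite -rc_le rmorphD -!cmodE ler_normD. Qed.

Lemma cmodN z : cmod (- z) = cmod z.
Proof. by apply: rc_inj; rewrite -!cmodE normrN. Qed.

Lemma cmodBC z w : cmod (z - w) = cmod (w - z).
Proof. by rewrite -cmodN opprB. Qed.

Lemma cmodB z w : cmod (z - w) <= cmod z + cmod w.
Proof. by rewrite (le_trans (cmodD _ _)) ?cmodN. Qed.

Lemma cmod_triangle u z w : cmod (z - w) <= cmod (z - u) + cmod (u - w).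
Proof. by rewrite (le_trans _ (cmodD _ _)) // addrA subrK. Qed.

Lemma cmodV z : cmod z^-1 = (cmod z)^-1.
Proof. by apply: rc_inj; rewrite fmorphV -!cmodE normfV. Qed.

Lemma cmodX z n : cmod (z ^+ n) = cmod z ^+ n.
Proof. by apply: rc_inj; rewrite rmorphXn -!cmodE normrX. Qed.

Lemma cmod_rc x : cmod (rc x) = `|x|.
Proof. by rewrite cmod_sqrt /= expr0n addr0 sqrtr_sqr. Qed.

Lemma cmod_nat n : cmod n%:R = n%:R.
Proof. by rewrite -(rmorph_nat rc) cmod_rc ger0_norm. Qed.

Lemma cmod_sum (I : Type) (s : seq I) (P : pred I) (F : I -> C) :
  cmod (\sum_(i <- s | P i) F i) <= \sum_(i <- s | P i) cmod (F i).
Proof.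
elim/big_rec2: _ => [|i x z _ le_z]; first by rewrite cmod0.
by rewrite (le_trans (cmodD _ _)) // lerD2l.
Qed.

Lemma cmod_Re z : `|complex.Re z| <= cmod z.
Proof.
rewrite cmod_sqrt -(sqrtr_sqr (complex.Re z)) ler_wsqrtr //.
by rewrite lerDl sqr_ge0.
Qed.

Lemma cmod_Im z : `|complex.Im z| <= cmod z.
Proof.
rewrite cmod_sqrt -(sqrtr_sqr (complex.Im z)) ler_wsqrtr //.
by rewrite lerDr sqr_ge0.
Qed.

Lemma cmod_le_ReIm z : cmod z <= `|complex.Re z| + `|complex.Im z|.
Proof.
rewrite cmod_sqrt -[leRHS]ger0_norm ?addr_ge0 // -[leRHS]sqrtr_sqr.
rewrite ler_wsqrtr // sqrrD !real_normK ?num_real // -addrA lerD2l lerDr.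
by rewrite mulrn_wge0 // mulr_ge0.
Qed.

(** Completeness in the form used below. For real values the supremum of the
    lower bounds h i - tau i lies within tau i of every h i; the complex case
    follows from the real and imaginary parts. *)
Lemma rate_limit (I : Type) (h : I -> C) (tau : I -> R) :
  (exists i : I, True) ->
  (forall i j, cmod (h i - h j) <= tau i + tau j) ->
  exists l, forall i, cmod (h i - l) <= 2 * tau i.
Proof.
move=> [i0 _] hC.
have key (g : I -> R) : (forall i j, `|g i - g j| <= tau i + tau j) ->
    exists l, forall i, `|g i - l| <= tau i.
  move=> gC; pose S := [set x | exists i, x = g i - tau i].
  have S0 : S !=set0 by exists (g i0 - tau i0), i0.
  have Sub j : ubound S (g j + tau j).
    by move=> _ [i ->]; have := gC i j; rewrite ler_norml; lra.
  exists (sup S) => j; rewrite ler_norml.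
  have h1 : sup S <= g j + tau j by apply: ge_sup.
  have h2 : g j - tau j <= sup S.
    by apply: sup_upper_bound; [split => //; exists (g j + tau j)|exists j].
  lra.
have [|a ha] := key (fun i => complex.Re (h i)).
  move=> i j; apply: le_trans (hC i j); apply: le_trans (cmod_Re _).
  by case: (h i) (h j) => [? ?] [? ?].
have [|b hb] := key (fun i => complex.Im (h i)).
  move=> i j; apply: le_trans (hC i j); apply: le_trans (cmod_Im _).
  by case: (h i) (h j) => [? ?] [? ?].
exists (Complex a b) => i; apply: le_trans (cmod_le_ReIm _) _.
have := ha i; have := hb i; case: (h i) => x y /=; lra.
Qed.

Definition cexp2pi x : C := Complex (cos (2 * pi * x)) (sin (2 * pi * x)).

Lemma cexp2piD x y : cexp2pi (x + y) = cexp2pi x * cexp2pi y.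
Proof.
rewrite /cexp2pi mulrDr cosD sinD.
by apply/eqP; rewrite eq_complex /= eqxx /=; apply/eqP; ring.
Qed.

Lemma cexp2pi0 : cexp2pi 0 = 1.
Proof. by rewrite /cexp2pi mulr0 cos0 sin0. Qed.

Lemma cmod_cexp2pi x : cmod (cexp2pi x) = 1.
Proof. by rewrite cmod_sqrt /= cos2Dsin2 sqrtr1. Qed.

Lemma cexp2pi_neq0 x : cexp2pi x != 0.
Proof.
by apply/eqP => E0; have := cmod_cexp2pi x; rewrite E0 cmod0 => /eqP; rewrite eq_sym oner_eq0.
Qed.

Lemma cexp2pi_half : cexp2pi 2^-1 = -1.
Proof.
by rewrite /cexp2pi mulrAC divff ?pnatr_eq0 // mul1r cospi sinpi -(rmorphN1 rc).
Qed.

Lemma cexp2pi1 : cexp2pi 1 = 1.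
Proof.
have -> : (1 : R) = 2^-1 + 2^-1 by field.
by rewrite cexp2piD cexp2pi_half mulrNN mulr1.
Qed.

Lemma cexp2piMn x n : cexp2pi (x *+ n) = cexp2pi x ^+ n.
Proof.
elim: n => [|n IHn]; first by rewrite mulr0n cexp2pi0 expr0.
by rewrite mulrS exprS cexp2piD IHn.
Qed.

(** Mean value theorem for cosine and sine, with derivatives bounded by 1. *)
Lemma cexp2pi_lipschitz : exists2 L : R, 0 < L &
  forall x y, cmod (cexp2pi x - cexp2pi y) <= L * `|x - y|.
Proof.
have pi0 := pi_gt0 R.
exists (4 * pi); first by rewrite mulr_gt0.
suff key x y : x <= y -> cmod (cexp2pi x - cexp2pi y) <= 4 * pi * `|x - y|.
  move=> x y; case: (leP x y) => [/key //|/ltW /key].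
  by rewrite cmodBC (distrC x).
move=> le_xy.
have le2 : 2 * pi * x <= 2 * pi * y by rewrite ler_wpM2l // mulr_ge0 // ltW.
have b (f df : R -> R) : (forall t : R, is_derive t 1 f (df t)) ->
    (forall t : R, `|df t| <= 1) -> `|f (2 * pi * x) - f (2 * pi * y)| <= 2 * pi * `|x - y|.
  move=> fD df1.
  have [|c _] := MVT_segment le2 (fun t _ => fD t).
    apply: continuous_subspaceT => t; apply/differentiable_continuous.
    exact/derivable1_diffP/(@ex_derive _ _ _ _ _ _ _ (fD t)).
  rewrite distrC => ->; rewrite normrM -mulrBr normrM [ `|2 * pi|]ger0_norm ?mulr_ge0 ?(ltW pi0) //.
  by rewrite distrC -[leRHS]mul1r ler_wpM2r // mulr_ge0 // mulr_ge0 // ltW.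
apply: le_trans (cmod_le_ReIm _) _.
have hc := b cos (fun t => - sin t) (fun t => is_derive_cos t).
have hs := b sin cos (fun t => is_derive_sin t).
have := lerD (hc _) (hs _); rewrite /cexp2pi /=.
have -> : 4 * pi * `|x - y| = 2 * pi * `|x - y| + 2 * pi * `|x - y| by ring.
by apply=> t; rewrite ?normrN ?sin_max ?cos_max.
Qed.

End Modulus.

(** * Riemann sums of contour integrals *)

Section Bisection.
Variable R : realType.
Implicit Types u v : R.

Definition in_dyadic l j u := (j%:R <= u * 2 ^+ l <= j.+1%:R).

(** The dyadic interval of level l reached by taking left or right halves
    according to the bits of a. *)
Fixpoint dyadic_pos (a : nat -> bool) l : nat :=
  if l is l'.+1 then (dyadic_pos a l').*2 + a l' else 0.

Lemma dyadic_pos_limit (a : nat -> bool) :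
  exists u, 0 <= u <= 1 /\ forall l, in_dyadic l (dyadic_pos a l) u.
Proof.
pose lo l : R := (dyadic_pos a l)%:R / 2 ^+ l.
pose hi l : R := (dyadic_pos a l).+1%:R / 2 ^+ l.
have p2 l : (0 : R) < 2 ^+ l by rewrite exprn_gt0.
have posS l : dyadic_pos a l.+1 = ((dyadic_pos a l).*2 + a l)%N by [].
have loS l : lo l <= lo l.+1.
  rewrite /lo posS exprS invfM mulrA ler_pM2r ?invr_gt0 //.
  rewrite ler_pdivlMr // -natrM ler_nat muln2; lia.
have hiS l : hi l.+1 <= hi l.
  rewrite /hi posS exprS invfM mulrA ler_pM2r ?invr_gt0 //.
  rewrite ler_pdivrMr // -natrM ler_nat muln2; case: (a l); lia.
have lo_mono l i : lo l <= lo (l + i)%N.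
  elim: i => [|i IHi]; first by rewrite addn0.
  by rewrite addnS (le_trans IHi).
have hi_mono l i : hi (l + i)%N <= hi l.
  elim: i => [|i IHi]; first by rewrite addn0.
  by rewrite addnS (le_trans _ IHi).
have lo_hi l : lo l <= hi l.
  by rewrite /lo /hi ler_pM2r ?invr_gt0 // ler_nat.
have lohi l m : lo l <= hi m.
  apply: le_trans (lo_mono l m) _; apply: le_trans (lo_hi _) _.
  by rewrite addnC hi_mono.
pose S := [set x | exists l, x = lo l].
have S0 : S !=set0 by exists (lo 0%N), 0%N.
have Sub m : ubound S (hi m) by move=> _ [l ->].
have supS : has_sup S by split => //; exists (hi 0%N).
have loS' l : lo l <= sup S by apply: sup_upper_bound => //; exists l.
have hiS' l : sup S <= hi l by apply: ge_sup.
exists (sup S); split.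
  have := loS' 0%N; have := hiS' 0%N.
  by rewrite /lo /hi expr0 !divr1 /= => -> ->.
move=> l; rewrite /in_dyadic; apply/andP; split.
  by rewrite -ler_pdivrMr //; apply: loS'.
by rewrite -ler_pdivlMr //; apply: hiS'.
Qed.

(** Compactness of the unit square in the form used by Goursat: a property of
    dyadic squares that passes from the four quarters to the whole, and holds
    for all small squares around any given point, holds for the unit square. *)
Lemma bisection2 (P : nat -> nat -> nat -> Prop) :
  (forall l j k, P l.+1 j.*2 k.*2 -> P l.+1 j.*2.+1 k.*2 ->
     P l.+1 j.*2 k.*2.+1 -> P l.+1 j.*2.+1 k.*2.+1 -> P l j k) ->
  (forall u v, 0 <= u <= 1 -> 0 <= v <= 1 -> exists l0, forall l j k,
     (l0 <= l)%N -> in_dyadic l j u -> in_dyadic l k v -> P l j k) ->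
  P 0 0 0.
Proof.
move=> Psplit Ploc; apply: contrapT => nP0.
have step (x : nat * (nat * nat)) : exists ab : bool * bool,
    ~ P x.1 x.2.1 x.2.2 ->
    ~ P x.1.+1 (x.2.1.*2 + ab.1)%N (x.2.2.*2 + ab.2)%N.
  case: x => l [j k] /=; apply: contrapT => /forallNP nab.
  have hP (a b : bool) : P l.+1 (j.*2 + a)%N (k.*2 + b)%N.
    by apply: contrapT => nP; apply: (nab (a, b)) => _.
  apply: (nab (false, false)) => nP; case: nP; apply: Psplit.
  - by have := hP false false; rewrite !addn0.
  - by have := hP true false; rewrite addn0 addn1.
  - by have := hP false true; rewrite addn0 addn1.
  - by have := hP true true; rewrite !addn1.
have [ch chP] := choice step.
pose st := fix st l := if l is l'.+1 then
    let x := st l' in let ab := ch (l', x) in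
    ((x.1.*2 + ab.1)%N, (x.2.*2 + ab.2)%N)
  else (0%N, 0%N).
have nP l : ~ P l (st l).1 (st l).2.
  by elim: l => [//|l IHl]; apply: (chP (l, st l)).
pose a l := (ch (l, st l)).1; pose b l := (ch (l, st l)).2.
have st1 l : (st l).1 = dyadic_pos a l by elim: l => //= l ->.
have st2 l : (st l).2 = dyadic_pos b l by elim: l => //= l ->.
have [u [u01 hu]] := dyadic_pos_limit a.
have [v [v01 hv]] := dyadic_pos_limit b.
have [l0 hl0] := Ploc u v u01 v01.
by apply: (nP l0); rewrite st1 st2; apply: hl0.
Qed.

Lemma halfX_small (e : R) : 0 < e -> exists l0, forall l, (l0 <= l)%N ->
  2^-1 ^+ l < e.
Proof.
move=> e0; exists (Num.bound e^-1) => l le_l.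
have := upper_nthrootP le_l; rewrite exprVn => h.
by rewrite invf_plt ?posrE // exprn_gt0.
Qed.

End Bisection.

Section Goursat.
Variable R : realType.
Notation C := (Cplx R).
Implicit Types (phi : C -> C) (z d : C).

(** Difference quotients measured by the real modulus; with explicit bounds on
    increments, uniform estimates can be read off directly. *)
Definition cderiv phi z d := forall e : R, 0 < e -> exists2 k : R, 0 < k &
  forall h, cmod h < k -> cmod (phi (z + h) - phi z - d * h) <= e * cmod h.

Section Grid.
Variables (rho w : nat -> C).
Hypotheses (rho_neq0 : forall j, rho j != 0) (w_neq0 : forall k, w k != 0).
Let Z j k := rho j * w k.

(** Riemann sums for the contour integral of phi z / z ^ 2 along the sides of a
    polar rectangle. The difference of the values of 1/z at the ends of an edge is
    the exact integral of 1 / z ^ 2 over this edge. *)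
Definition radial_sum phi k j0 j1 :=
  \sum_(j0 <= j < j1) phi (Z j k) * ((Z j k)^-1 - (Z j.+1 k)^-1).
Definition arc_sum phi j k0 k1 :=
  \sum_(k0 <= k < k1) phi (Z j k) * ((Z j k)^-1 - (Z j k.+1)^-1).
Definition contour_sum phi j0 j1 k0 k1 :=
  radial_sum phi k0 j0 j1 + arc_sum phi j1 k0 k1
  - radial_sum phi k1 j0 j1 - arc_sum phi j0 k0 k1.

Lemma contour_sum_split phi j0 j1 j2 k0 k1 k2 :
  (j0 <= j1 <= j2)%N -> (k0 <= k1 <= k2)%N ->
  contour_sum phi j0 j2 k0 k2 =
    contour_sum phi j0 j1 k0 k1 + contour_sum phi j1 j2 k0 k1 +
    (contour_sum phi j0 j1 k1 k2 + contour_sum phi j1 j2 k1 k2).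
Proof.
move=> /andP[j01 j12] /andP[k01 k12].
have rs k : radial_sum phi k j0 j2 = radial_sum phi k j0 j1 + radial_sum phi k j1 j2.
  by rewrite /radial_sum (big_cat_nat j01 j12).
have hs j : arc_sum phi j k0 k2 = arc_sum phi j k0 k1 + arc_sum phi j k1 k2.
  by rewrite /arc_sum (big_cat_nat k01 k12).
rewrite /contour_sum !rs !hs; ring.
Qed.

Lemma contour_sumD phi psi j0 j1 k0 k1 :
  contour_sum (fun z => phi z + psi z) j0 j1 k0 k1 =
  contour_sum phi j0 j1 k0 k1 + contour_sum psi j0 j1 k0 k1.
Proof.
rewrite /contour_sum /radial_sum /arc_sum.
under eq_bigr do rewrite mulrDl; rewrite big_split /=.
under [X in _ + X - _ - _]eq_bigr do rewrite mulrDl; rewrite big_split /=.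
under [X in _ - X - _]eq_bigr do rewrite mulrDl; rewrite big_split /=.
under [X in _ - _ - X = _]eq_bigr do rewrite mulrDl; rewrite big_split /=.
ring.
Qed.

(** The weights telescope on constants. On the identity, the terms of a radial
    side do not depend on the angle, so that the two radial sides cancel. *)
Lemma contour_sum_affine (a b : C) j0 j1 k0 k1 :
  (j0 <= j1)%N -> (k0 <= k1)%N ->
  contour_sum (fun z => a + b * z) j0 j1 k0 k1 =
    b * (arc_sum id j1 k0 k1 - arc_sum id j0 k0 k1).
Proof.
move=> j01 k01; rewrite contour_sumD.
have Z0 j k : Z j k != 0 by rewrite mulf_neq0.
have -> : contour_sum (fun _ => a) j0 j1 k0 k1 = 0.
  rewrite /contour_sum /radial_sum /arc_sum -!mulr_sumr.
  have tj k : \sum_(j0 <= j < j1) ((Z j k)^-1 - (Z j.+1 k)^-1) =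
      (Z j0 k)^-1 - (Z j1 k)^-1.
    rewrite -[RHS]opprB -(telescope_sumr (fun j => (Z j k)^-1) j01) -sumrN.
    by apply: eq_bigr => j _; rewrite opprB.
  have tk j : \sum_(k0 <= k < k1) ((Z j k)^-1 - (Z j k.+1)^-1) =
      (Z j k0)^-1 - (Z j k1)^-1.
    rewrite -[RHS]opprB -(telescope_sumr (fun k => (Z j k)^-1) k01) -sumrN.
    by apply: eq_bigr => k _; rewrite opprB.
  by rewrite !tj !tk; ring.
rewrite add0r /contour_sum.
have -> : radial_sum [eta *%R b] k0 j0 j1 = radial_sum [eta *%R b] k1 j0 j1.
  apply: eq_bigr => j _; rewrite /Z; field.
  by rewrite !rho_neq0 !w_neq0.
have hs j : arc_sum [eta *%R b] j k0 k1 = b * arc_sum id j k0 k1.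
  by rewrite /arc_sum mulr_sumr; apply: eq_bigr => k _; rewrite mulrA.
by rewrite !hs; ring.
Qed.

(** The radius cancels: with equal steps in angle, both arcs contribute the
    same amount on the identity, and contour sums vanish on affine functions. *)
Lemma arc_sum_id j k0 k1 :
  arc_sum id j k0 k1 = \sum_(k0 <= k < k1) (1 - w k / w k.+1).
Proof.
apply: eq_bigr => k _; rewrite /Z; field.
by rewrite !rho_neq0 !w_neq0.
Qed.

Lemma contour_sum_le phi j0 j1 k0 k1 (e a b : R) :
  (j0 <= j1)%N -> (k0 <= k1)%N -> 0 <= e -> 0 <= a -> 0 <= b ->
  (forall j k, (j0 <= j <= j1)%N -> (k0 <= k <= k1)%N ->
    [/\ cmod (phi (Z j k)) <= e, cmod ((Z j k)^-1 - (Z j.+1 k)^-1) <= a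
      & cmod ((Z j k)^-1 - (Z j k.+1)^-1) <= b]) ->
  cmod (contour_sum phi j0 j1 k0 k1) <=
    2 * e * (a * (j1 - j0)%:R + b * (k1 - k0)%:R).
Proof.
move=> j01 k01 e0 a0 b0 hb.
have rb k : (k0 <= k <= k1)%N ->
    cmod (radial_sum phi k j0 j1) <= e * (a * (j1 - j0)%:R).
  move=> hk; apply: le_trans (cmod_sum _ _ _) _.
  rewrite [leRHS](_ : _ = \sum_(j0 <= j < j1) e * a); last first.
    by rewrite sumr_const_nat -[RHS]mulr_natr; ring.
  rewrite big_nat [leRHS]big_nat; apply: ler_sum => j /andP[h1 h2].
  have [] := hb j k _ hk; first by rewrite h1 ltnW.
  by move=> p1 p2 _; rewrite cmodM ler_pM ?cmod_ge0.
have ab j : (j0 <= j <= j1)%N ->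
    cmod (arc_sum phi j k0 k1) <= e * (b * (k1 - k0)%:R).
  move=> hj; apply: le_trans (cmod_sum _ _ _) _.
  rewrite [leRHS](_ : _ = \sum_(k0 <= k < k1) e * b); last first.
    by rewrite sumr_const_nat -[RHS]mulr_natr; ring.
  rewrite big_nat [leRHS]big_nat; apply: ler_sum => k /andP[h1 h2].
  have [] := hb j k hj; first by rewrite h1 ltnW.
  by move=> p1 _ p2; rewrite cmodM ler_pM ?cmod_ge0.
rewrite /contour_sum.
have r0 := rb k0; have r1 := rb k1; have a1 := ab j1; have a2 := ab j0.
rewrite !leqnn ?j01 ?k01 /= in r0 r1 a1 a2.
apply: le_trans (cmodB _ _) _.
apply: le_trans (lerD (cmodB _ _) (lexx _)) _.
apply: le_trans (lerD (lerD (cmodD _ _) (lexx _)) (lexx _)) _.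
have := r0 isT; have := r1 isT; have := a1 isT; have := a2 isT; lra.
Qed.

End Grid.

End Goursat.

Section Annulus.
Variable R : realType.
Notation C := (Cplx R).
Implicit Types (phi : C -> C) (z d : C).

Let step N : R := 2^-1 ^+ N.
(** Grid on the annulus between the circles of radii r and 2 r, with 2 ^ N steps
    in each direction. *)
Definition annulus_radius (r : R) N j : C := rc (r * (1 + j%:R * step N)).
Definition circle_node N k : C := cexp2pi (k%:R * step N).

Lemma step_gt0 N : 0 < step N. Proof. by rewrite exprn_gt0 ?invr_gt0. Qed.
Hint Resolve step_gt0 : core.

Lemma step_add l i : (2 ^ i)%:R * step (l + i) = step l.
Proof.
rewrite /step exprD natrX mulrCA -exprMn divff ?pnatr_eq0 //.
by rewrite expr1n mulr1.
Qed.

Lemma step_full N : (2 ^ N)%:R * step N = 1.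
Proof. by rewrite -[in step N](add0n N) step_add. Qed.

Lemma circle_node_neq0 N k : circle_node N k != 0.
Proof. exact: cexp2pi_neq0. Qed.

Lemma circle_nodeE N k : circle_node N k = cexp2pi (step N) ^+ k.
Proof. by rewrite /circle_node mulr_natl cexp2piMn. Qed.

Lemma circle_node_period N : circle_node N (2 ^ N) = 1.
Proof. by rewrite /circle_node step_full cexp2pi1. Qed.

Lemma annulus_radius_ge r N j : 0 < r -> r <= r * (1 + j%:R * step N).
Proof.
by move=> r0; rewrite ler_pMr // lerDl mulr_ge0 // ltW.
Qed.

Lemma annulus_radius_neq0 r N j : 0 < r -> annulus_radius r N j != 0.
Proof.
move=> r0; rewrite /annulus_radius fmorph_eq0 gt_eqF //.
exact: lt_le_trans (annulus_radius_ge N j r0).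
Qed.

Lemma contour_sum_annulus_affine r N (a b : C) j0 j1 k0 k1 : 0 < r ->
  (j0 <= j1)%N -> (k0 <= k1)%N ->
  contour_sum (annulus_radius r N) (circle_node N)
    (fun z => a + b * z) j0 j1 k0 k1 = 0.
Proof.
move=> r0 j01 k01.
have H1 := fun j => annulus_radius_neq0 N j r0.
rewrite contour_sum_affine //; last exact: circle_node_neq0.
by rewrite !arc_sum_id ?subrr ?mulr0 //; exact: circle_node_neq0.
Qed.

Lemma cmod_invB z w : z != 0 -> w != 0 ->
  cmod (z^-1 - w^-1) = cmod (w - z) / (cmod z * cmod w).
Proof.
move=> z0 w0; have -> : z^-1 - w^-1 = (w - z) / (z * w) by field; rewrite z0 w0.
by rewrite cmodM cmodV cmodM.
Qed.

(** Goursat's argument for Riemann sums. They are additive under subdivision and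
    vanish on affine functions; on a small rectangle around a point of
    differentiability the error term is therefore small compared with the product
    of diameter and perimeter, that is, with the area. Bisection concludes. *)
Lemma goursat_annulus phi (r : R) : 0 < r ->
  (forall z, r <= cmod z <= 2 * r -> exists d, cderiv phi z d) ->
  forall e : R, 0 < e -> exists N0, forall N, (N0 <= N)%N ->
    cmod (contour_sum (annulus_radius r N) (circle_node N) phi
            0 (2 ^ N) 0 (2 ^ N)) <= e.
Proof.
move=> r0 dphi e e0.
have [L L0 EL] := cexp2pi_lipschitz R.
pose P l j k := exists N0, forall i, (N0 <= i)%N ->
  cmod (contour_sum (annulus_radius r (l + i)) (circle_node (l + i)) phi
    (j * 2 ^ i) (j.+1 * 2 ^ i) (k * 2 ^ i) (k.+1 * 2 ^ i)) <= e * (step l * step l).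
suff [N0 hN] : P 0%N 0%N 0%N.
  exists N0 => N leN; have := hN N leN.
  by rewrite !add0n !mul0n !mul1n /step expr0 !mulr1.
apply: (@bisection2 R) => [l j k|u v u01 v01].
  move=> [N1 h1] [N2 h2] [N3 h3] [N4 h4].
  exists (maxn (maxn N1 N2) (maxn N3 N4)).+1 => -[//|i].
  rewrite ltnS !geq_max => /andP[/andP[i1 i2] /andP[i3 i4]].
  rewrite -addSnnS.
  have dbl m : (m * 2 ^ i.+1 = m.*2 * 2 ^ i)%N by rewrite expnS mulnA muln2.
  rewrite !dbl !doubleS.
  have lem m : (m.*2 * 2 ^ i <= m.*2.+1 * 2 ^ i <= m.*2.+2 * 2 ^ i)%N.
    by rewrite !leq_mul2r !leqnSn !orbT.
  rewrite (contour_sum_split _ _ _ (lem j) (lem k)).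
  have S2 : step l.+1 = step l / 2 by rewrite /step exprSr.
  have -> : e * (step l * step l) = e * (step l.+1 * step l.+1)
      + e * (step l.+1 * step l.+1)
      + (e * (step l.+1 * step l.+1) + e * (step l.+1 * step l.+1)).
    by rewrite S2; field.
  apply: le_trans (cmodD _ _) (lerD _ _);
    apply: le_trans (cmodD _ _) (lerD _ _).
  - exact: h1.
  - exact: h2.
  - exact: h3.
  - exact: h4.
have /andP[u0 u1] := u01; have /andP[v0 v1] := v01.
pose p : C := rc (r * (1 + u)) * cexp2pi v.
have cp : cmod p = r * (1 + u).
  rewrite cmodM cmod_cexp2pi mulr1 cmod_rc ger0_norm //.
  by rewrite mulr_ge0 ?(ltW r0) // addr_ge0.
have [|d dp] := dphi p.
  rewrite cp ler_peMr ?(ltW r0) ?lerDl //= mulrC ler_pM2r //; lra.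
(* D times the side of a dyadic square bounds the diameter of its image. *)
pose D := r + 2 * r * L.
have D0 : 0 < D by rewrite addr_gt0 // !mulr_gt0.
(* The choice makes twice the error on the square times the total weight of two
   adjacent sides equal to e times the area of the dyadic square. *)
pose e' := e * r / (2 * D * (1 + L)).
have L10 : 0 < 1 + L by rewrite addr_gt0.
have e'0 : 0 < e' by rewrite divr_gt0 ?mulr_gt0.
have [kk kk0 hkk] := dp e' e'0.
have [l0 hl0] := @halfX_small R (kk / D) (divr_gt0 kk0 D0).
exists l0 => l j k lel /andP[ju1 ju2] /andP[kv1 kv2].
have Dl : D * step l < kk by rewrite mulrC -ltr_pdivlMr //; exact: hl0.
exists 0%N => i _.
have st0 := step_gt0 (l + i); have sl0 := step_gt0 l.
have near_dyadic m a x : m%:R <= x * 2 ^+ l <= m.+1%:R ->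
    (m * 2 ^ i <= a <= m.+1 * 2 ^ i)%N -> `|a%:R * step (l + i) - x| <= step l.
  move=> /andP[mx1 mx2] /andP[ma1 ma2].
  have s2 : 2 ^+ l * step l = 1 by rewrite -natrX step_full.
  have x1 : m%:R * step l <= x.
    have := ler_wpM2r (ltW sl0) mx1; by rewrite -mulrA s2 mulr1.
  have x2 : x <= m.+1%:R * step l.
    have := ler_wpM2r (ltW sl0) mx2; by rewrite -mulrA s2 mulr1.
  have a1 : m%:R * step l <= a%:R * step (l + i).
    by rewrite -(step_add l i) mulrA -natrM ler_pM2r // ler_nat.
  have a2 : a%:R * step (l + i) <= m.+1%:R * step l.
    by rewrite -(step_add l i) mulrA -natrM ler_pM2r // ler_nat.
  have m1 : m.+1%:R * step l = m%:R * step l + step l :> R.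
    by rewrite -natr1 mulrDl mul1r.
  rewrite ler_norml; lra.
set rho := annulus_radius r (l + i); set w := circle_node (l + i).
have rhon j' : rho j' != 0 by exact: annulus_radius_neq0.
have wn k' : w k' != 0 by exact: circle_node_neq0.
(* Only the deviation from the tangent map at p contributes. *)
pose err z := phi z - phi p - d * (z - p).
have -> : contour_sum rho w phi (j * 2 ^ i) (j.+1 * 2 ^ i)
     (k * 2 ^ i) (k.+1 * 2 ^ i) =
   contour_sum rho w err (j * 2 ^ i) (j.+1 * 2 ^ i)
     (k * 2 ^ i) (k.+1 * 2 ^ i).
  have -> : phi = (fun z => err z + ((phi p - d * p) + d * z)).
    by apply/funext => z; rewrite /err; ring.
  rewrite contour_sumD contour_sum_annulus_affine ?leq_mul2r ?leqnSn ?orbT //.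
  rewrite addr0; congr contour_sum; apply/funext => z; rewrite /err; ring.
have cw k' : cmod (w k') = 1 by exact: cmod_cexp2pi.
have crho j' : cmod (rho j') = r * (1 + j'%:R * step (l + i)).
  by rewrite cmod_rc ger0_norm // (le_trans (ltW r0)) // annulus_radius_ge.
have crho_ge j' : r <= cmod (rho j') by rewrite crho annulus_radius_ge.
have cZ_ge j' k' : r <= cmod (rho j' * w k') by rewrite cmodM cw mulr1.
have le_div a b q : 0 <= a -> a <= b -> r <= q -> a / q <= b / r.
  move=> a0 ab rq; have q0 : 0 < q := lt_le_trans r0 rq.
  by rewrite ler_pM ?invr_ge0 ?(ltW q0) // lef_pV2 ?posrE.
apply: le_trans (@contour_sum_le _ rho w err _ _ _ _ (e' * (D * step l))
   (step (l + i) / r) (L * step (l + i) / r) _ _ _ _ _ _) _.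
- by rewrite leq_mul2r leqnSn orbT.
- by rewrite leq_mul2r leqnSn orbT.
- by rewrite mulr_ge0 ?(ltW e'0) // mulr_ge0 // ltW.
- by rewrite ltW // divr_gt0.
- by rewrite ltW // divr_gt0 // mulr_gt0.
- move=> j' k' hj hk.
  have hu := near_dyadic _ _ _ (introT andP (conj ju1 ju2)) hj.
  have hv := near_dyadic _ _ _ (introT andP (conj kv1 kv2)) hk.
  have jge : 0 <= j'%:R * step (l + i) by rewrite mulr_ge0 // ltW.
  split.
  + have zp : cmod (rho j' * w k' - p) <= D * step l.
      apply: le_trans (cmod_triangle (rc (r * (1 + u)) * w k') _ _) _.
      rewrite /p -mulrBl -mulrBr !cmodM cw mulr1 /rho /annulus_radius -rmorphB !cmod_rc.
      have -> : r * (1 + j'%:R * step (l + i)) - r * (1 + u) =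
         r * (j'%:R * step (l + i) - u) by ring.
      rewrite normrM (ger0_norm (ltW r0)).
      rewrite (ger0_norm (mulr_ge0 (ltW r0) (addr_ge0 ler01 u0))).
      rewrite [D * _]mulrDl; apply: lerD; first by rewrite ler_wpM2l ?(ltW r0).
      rewrite [leRHS](_ : _ = (2 * r) * (L * step l)); last by ring.
      rewrite ler_pM ?cmod_ge0 ?mulr_ge0 ?(ltW r0) ?addr_ge0 //.
        rewrite mulrC ler_wpM2r ?(ltW r0) //; lra.
      apply: le_trans (EL _ _) _; rewrite ler_wpM2l //; exact: ltW.
    have := hkk (rho j' * w k' - p) (le_lt_trans zp Dl).
    rewrite [p + _]addrC subrK => /le_trans; apply.
    by rewrite ler_wpM2l // ltW.
  + rewrite cmod_invB ?mulf_neq0 // -mulrBl !cmodM !cw !mulr1 /rho /annulus_radius -rmorphB.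
    rewrite -/(annulus_radius r (l + i) j') -/(annulus_radius r (l + i) j'.+1).
    rewrite cmod_rc -natr1.
    have -> : r * (1 + (j'%:R + 1) * step (l + i)) - r * (1 + j'%:R * step (l + i))
       = r * step (l + i) by ring.
    rewrite ger0_norm ?mulr_ge0 ?(ltW r0) ?(ltW st0) //.
    rewrite invfM mulrA; apply: le_div => //.
      by rewrite divr_ge0 ?cmod_ge0 // mulr_ge0 // ltW.
    rewrite ler_pdivrMr ?(lt_le_trans r0 (crho_ge _)) // mulrC.
    by rewrite ler_wpM2l // ltW.
  + rewrite cmod_invB ?mulf_neq0 // -mulrBr !cmodM !cw !mulr1.
    rewrite invfM mulrACA divff ?gt_eqF ?(lt_le_trans r0) // mul1r.
    apply: le_div; rewrite ?cmod_ge0 //.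
    apply: le_trans (EL _ _) _; rewrite ler_wpM2l ?(ltW L0) //.
    rewrite -mulrBl -natr1 [X in X * _]addrAC subrr add0r mul1r ger0_norm //.
    exact: ltW.
- rewrite !mulSn !addnK natrX.
  have -> : 2 ^+ i = step l / step (l + i) :> R.
    by rewrite -(step_add l i) natrX mulfK // gt_eqF.
  rewrite le_eqVlt; apply/orP; left; apply/eqP.
  rewrite /e'; field.
  by rewrite !gt_eqF.
Qed.
End Annulus.

(** * Goursat's theorem and Cauchy's estimate *)

Section CauchyEstimate.
Variable R : realType.
Notation C := (Cplx R).
Implicit Types (phi : C -> C) (z d : C) (r : R).

(** Riemann sum, over 2 ^ N equidistant points, of the mean of phi z / z over a
    circle; in the limit this mean is the first Taylor coefficient of phi. *)
Definition circle_mean phi r N : C :=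
  (2 ^ N)%:R^-1 * \sum_(0 <= k < 2 ^ N)
     phi (rc r * circle_node R N k) / (rc r * circle_node R N k).

(** Half of the edges of the inscribed polygon lead from 1 to -1, so that its
    perimeter is at least 4. *)
Lemma circle_node_pred_ge N : 4 <= cmod (1 - (circle_node R N.+1 1)^-1) * (2 ^ N.+1)%:R.
Proof.
set w := circle_node R N.+1 1.
have w0 : w != 0 by exact: circle_node_neq0.
have wn k : circle_node R N.+1 k = w ^+ k by rewrite /w !circle_nodeE expr1.
have wh : w ^+ (2 ^ N) = -1.
  rewrite -wn /circle_node -(@cexp2pi_half R); congr cexp2pi.
  by rewrite exprS natrX mulrCA -exprMn divff ?pnatr_eq0 // expr1n mulr1.
have cw : cmod w = 1 by exact: cmod_cexp2pi.
have -> : cmod (1 - w^-1) = cmod (w - 1).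
  have -> : 1 - w^-1 = (w - 1) / w by field.
  by rewrite cmodM cmodV cw invr1 mulr1.
have : cmod (w ^+ (2 ^ N) - 1) <= cmod (w - 1) * (2 ^ N)%:R.
  have := telescope_sumr (fun k => w ^+ k) (leq0n (2 ^ N)).
  rewrite expr0 => <-; apply: le_trans (cmod_sum _ _ _) _.
  rewrite [leRHS](_ : _ = \sum_(0 <= k < 2 ^ N) cmod (w - 1)); last first.
    by rewrite sumr_const_nat subn0 mulr_natr.
  apply: ler_sum => k _.
  by rewrite exprSr -{2}[w ^+ k]mulr1 -mulrBr cmodM cmodX cw expr1n mul1r.
rewrite wh -opprD cmodN -[1 + 1]/(2%:R) cmod_nat expnS natrM; lra.
Qed.

Lemma circle_mean_le phi r N (M : R) : 0 < r ->
  (forall z, cmod z = r -> cmod (phi z) <= M) ->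
  cmod (circle_mean phi r N) <= M / r.
Proof.
move=> r0 hM; rewrite /circle_mean cmodM cmodV cmod_nat.
rewrite ler_pdivrMl ?ltr0n ?expn_gt0 //.
apply: le_trans (cmod_sum _ _ _) _.
rewrite [leRHS](_ : _ = \sum_(0 <= k < 2 ^ N) M / r); last first.
  by rewrite sumr_const_nat subn0 mulr_natl.
apply: ler_sum => k _.
have cz : cmod (rc r * circle_node R N k) = r.
  by rewrite cmodM cmod_cexp2pi mulr1 cmod_rc ger0_norm // ltW.
by rewrite cmodM cmodV cz ler_wpM2r ?invr_ge0 ?(ltW r0) // hM.
Qed.

Lemma circle_meanD phi psi r N : circle_mean (fun z => phi z + psi z) r N =
  circle_mean phi r N + circle_mean psi r N.
Proof.
rewrite /circle_mean -mulrDr -big_split /=; congr (_ * _).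
by apply: eq_bigr => k _; rewrite mulrDl.
Qed.

Lemma circle_mean_affine (a b : C) r N : 0 < r ->
  circle_mean (fun z => a + b * z) r N.+1 = b.
Proof.
move=> r0; have rr0 : rc r != 0 by rewrite fmorph_eq0 gt_eqF.
set w := circle_node R N.+1 1.
have w0 : w != 0 by exact: circle_node_neq0.
have wn k : circle_node R N.+1 k = w ^+ k by rewrite /w !circle_nodeE expr1.
rewrite circle_meanD [X in _ + X](_ : _ = b); last first.
  rewrite /circle_mean (eq_bigr (fun=> b)); last first.
    by move=> k _; rewrite mulfK // mulf_neq0 // circle_node_neq0.
  rewrite sumr_const_nat subn0 -[X in _ * X]mulr_natl mulKf //.
  by rewrite pnatr_eq0 expn_eq0.
rewrite [X in X + _](_ : _ = 0) ?add0r // /circle_mean.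
under eq_bigr do rewrite wn invfM mulrA -exprVn.
rewrite -mulr_sumr big_mkord.
have w1 : w^-1 - 1 != 0.
  apply/eqP => w1; have := circle_node_pred_ge N; rewrite -/w.
  by rewrite -opprB w1 oppr0 cmod0 mul0r; lra.
suff -> : \sum_(i < 2 ^ N.+1) w^-1 ^+ i = 0 by rewrite !mulr0.
apply: (mulfI w1); rewrite mulr0 -subrX1.
by rewrite exprVn -wn circle_node_period invr1 subrr.
Qed.

(** On the whole annulus the two radial sides coincide and cancel, which leaves
    the two circles; each arc sum is a common factor times the mean. *)
Lemma circle_mean_annulus phi r N : 0 < r ->
  4 * cmod (circle_mean phi (2 * r) N.+1 - circle_mean phi r N.+1) <=
  cmod (contour_sum (annulus_radius r N.+1) (circle_node R N.+1) phi
     0 (2 ^ N.+1) 0 (2 ^ N.+1)).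
Proof.
move=> r0; set rho := annulus_radius r N.+1; set cn := circle_node R N.+1.
have rhon j' : rho j' != 0 by exact: annulus_radius_neq0.
have cnn k' : cn k' != 0 by exact: circle_node_neq0.
set w := circle_node R N.+1 1.
have w0 : w != 0 by exact: circle_node_neq0.
have wn k : cn k = w ^+ k by rewrite /cn /w !circle_nodeE expr1.
have rad j0 j1 : radial_sum rho cn phi 0 j0 j1 = radial_sum rho cn phi (2 ^ N.+1) j0 j1.
  by apply: eq_bigr => j _; rewrite /cn circle_node_period /circle_node mul0r cexp2pi0.
have arc j r' : rho j = rc r' -> arc_sum rho cn phi j 0 (2 ^ N.+1) =
    (1 - w^-1) * ((2 ^ N.+1)%:R * circle_mean phi r' N.+1).
  move=> rhoj; rewrite /circle_mean mulVKf ?pnatr_eq0 ?expn_eq0 //.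
  rewrite mulr_sumr; apply: eq_bigr => k _; rewrite -rhoj -/cn.
  rewrite [in cn k.+1]wn exprSr -wn.
  move: (rho j) (cn k) (rhon j) (cnn k) => x y x0 y0; field.
  by rewrite w0 x0 y0.
rewrite /contour_sum -rad [X in _ <= cmod X](_ : _ = arc_sum rho cn phi (2 ^ N.+1) 0 (2 ^ N.+1)
    - arc_sum rho cn phi 0 0 (2 ^ N.+1)); last by ring.
rewrite (arc _ (2 * r)); last first.
  rewrite /rho /annulus_radius step_full; congr rc; ring.
rewrite (arc _ r); last by rewrite /rho /annulus_radius mul0r addr0 mulr1.
move: (circle_mean _ _ _) (circle_mean _ _ _) => A B.
rewrite -!mulrBr !cmodM cmod_nat mulrA ler_wpM2r ?cmod_ge0 //.
exact: circle_node_pred_ge.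
Qed.

(** Cauchy's estimate for functions that are only assumed differentiable. The means
    over two concentric circles agree in the limit, by Goursat's theorem on a chain
    of annuli; on a small circle the mean is close to the derivative at the centre,
    and on the large one it is bounded by M / rho. *)
Lemma cauchy_estimate phi d (rho M : R) : 0 < rho ->
  (forall z, cmod z <= rho -> exists d, cderiv phi z d) -> cderiv phi 0 d ->
  (forall z, cmod z = rho -> cmod (phi z) <= M) -> cmod d <= M / rho.
Proof.
move=> rho0 dphi d0 hM.
pose rr m := rho / 2 ^+ m.
have rr0 m : 0 < rr m by rewrite divr_gt0 // exprn_gt0.
have rrS m : rr m = 2 * rr m.+1 by rewrite /rr exprS; field; rewrite expf_neq0 // pnatr_eq0.
have rr_le m : rr m <= rho.
  by rewrite ler_pdivrMr ?exprn_gt0 // ler_peMr ?(ltW rho0) // exprn_ege1 // ler1n.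
have chain m e : 0 < e -> exists N0, forall N, (N0 <= N)%N ->
    cmod (circle_mean phi rho N.+1 - circle_mean phi (rr m) N.+1) <= e.
  elim: m e => [|m IHm] e e0.
    by exists 0%N => N _; rewrite /rr expr0 divr1 subrr cmod0 ltW.
  have e20 : 0 < e / 2 by rewrite divr_gt0.
  have [N1 hN1] := IHm _ e20.
  have [|N2 hN2] := goursat_annulus (rr0 m.+1) _ e20 (phi := phi).
    by move=> z /andP[_ zr]; apply: dphi; rewrite (le_trans zr) // -rrS.
  exists (maxn N1 N2) => N; rewrite geq_max => /andP[h1 h2].
  have := circle_mean_annulus phi N (rr0 m.+1); rewrite -rrS.
  have := hN1 N h1; have := hN2 N.+1 (leqW h2).
  have := cmod_triangle (circle_mean phi (rr m) N.+1)
    (circle_mean phi rho N.+1) (circle_mean phi (rr m.+1) N.+1).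
  have := cmod_ge0 (circle_mean phi (rr m) N.+1 - circle_mean phi (rr m.+1) N.+1).
  lra.
(* One half of e pays for the annuli, the other for the circle of radius rr m. *)
apply/ler_addgt0Pr => e e0.
have e20 : 0 < e / 2 by rewrite divr_gt0.
have [k k0 hk] := d0 _ e20.
have [m hm] := halfX_small (divr_gt0 k0 rho0).
have rm : rr m < k.
  have := hm m (leqnn _); rewrite ltr_pdivlMr // exprVn mulrC //.
have [N0 hN] := chain m _ e20.
have h1 := hN N0 (leqnn _).
have h2 := circle_mean_le N0.+1 rho0 hM.
have h3 : cmod (circle_mean phi (rr m) N0.+1 - d) <= e / 2.
  have -> : phi = (fun z => (phi 0 + d * z) + (phi z - phi 0 - d * z)).
    by apply/funext => z; ring.
  rewrite circle_meanD circle_mean_affine // addrC addKr.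
  rewrite -[leRHS](@mulfK _ (rr m)) ?gt_eqF //.
  apply: circle_mean_le => // z cz.
  have := hk z; rewrite cz add0r; exact.
have := cmod_triangle (circle_mean phi (rr m) N0.+1) d 0.
have := cmod_triangle (circle_mean phi rho N0.+1) (circle_mean phi (rr m) N0.+1) 0.
rewrite !subr0 cmodBC => t1 t2.
rewrite cmodBC in h3; lra.
Qed.

End CauchyEstimate.

(** * Complex derivatives *)

Section ComplexDerivative.
Variable R : realType.
Notation C := (Cplx R).
Implicit Types (phi psi : C -> C) (z d : C) (r : R).

Lemma cderiv_unique phi z d1 d2 : cderiv phi z d1 -> cderiv phi z d2 -> d1 = d2.
Proof.
move=> h1 h2; apply/eqP; rewrite -subr_eq0; apply/negPn/negP => n0.
have p0 := cmod_gt0 n0; set e := cmod (d1 - d2) in p0.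
have e0 : 0 < e / 4 by rewrite divr_gt0.
have [k1 k10 hk1] := h1 _ e0; have [k2 k20 hk2] := h2 _ e0.
pose k := Num.min k1 k2 / 2.
have k0 : 0 < k by rewrite divr_gt0 // lt_min k10.
have ck : cmod (rc k) = k by rewrite cmod_rc ger0_norm // ltW.
have m0 : Num.min k1 k2 = 2 * k by rewrite /k; field.
have b1 := hk1 (rc k); have b2 := hk2 (rc k); rewrite ck in b1 b2.
have : k < Num.min k1 k2 by lra.
rewrite lt_min => /andP[/b1 {}b1 /b2 {}b2].
have : cmod ((d1 - d2) * rc k) <= e / 4 * k + e / 4 * k.
  have -> : (d1 - d2) * rc k = (phi (z + rc k) - phi z - d2 * rc k) -
    (phi (z + rc k) - phi z - d1 * rc k) by ring.
  apply: le_trans (cmodB _ _) _; lra.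
rewrite cmodM ck -/e -mulrDl ler_pM2r //; lra.
Qed.

Lemma cderiv_near phi psi z d r : 0 < r ->
  (forall h, cmod h < r -> phi (z + h) = psi (z + h)) ->
  cderiv phi z d -> cderiv psi z d.
Proof.
move=> r0 eqp dp e e0; have [k k0 hk] := dp e e0.
exists (Num.min k r); first by rewrite lt_min k0.
move=> h; rewrite lt_min => /andP[h1 h2].
have z0 : phi z = psi z by have := eqp 0; rewrite addr0 cmod0; apply.
by rewrite -eqp // -z0 hk.
Qed.

Lemma cderiv_cst (c : C) z : cderiv (fun=> c) z 0.
Proof.
by move=> e e0; exists 1 => // h _; rewrite mul0r !subrr cmod0 mulr_ge0 ?cmod_ge0 ?ltW.
Qed.

Lemma cderiv_id z : cderiv id z 1.
Proof.
move=> e e0; exists 1 => // h _.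
have -> : id (z + h) - id z - 1 * h = 0 by rewrite /=; ring.
by rewrite cmod0 mulr_ge0 ?cmod_ge0 ?ltW.
Qed.

Lemma cderivD phi psi z d d' : cderiv phi z d -> cderiv psi z d' ->
  cderiv (fun t => phi t + psi t) z (d + d').
Proof.
move=> h1 h2 e e0; have e20 : 0 < e / 2 by rewrite divr_gt0.
have [k1 k10 hk1] := h1 _ e20; have [k2 k20 hk2] := h2 _ e20.
exists (Num.min k1 k2); first by rewrite lt_min k10.
move=> h; rewrite lt_min => /andP[/hk1 {}hk1 /hk2 {}hk2].
have -> : phi (z + h) + psi (z + h) - (phi z + psi z) - (d + d') * h =
  (phi (z + h) - phi z - d * h) + (psi (z + h) - psi z - d' * h) by ring.
apply: le_trans (cmodD _ _) _; lra.
Qed.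

(** The bound B dominates all values and derivatives; the increments of the two
    factors are of order (B + 1) |h|, and their product is negligible. *)
Lemma cderivM phi psi z d d' : cderiv phi z d -> cderiv psi z d' ->
  cderiv (fun t => phi t * psi t) z (d * psi z + phi z * d').
Proof.
move=> h1 h2 e e0.
pose B := 1 + cmod (phi z) + cmod (psi z) + cmod d + cmod d'.
have B1 : 1 <= B by rewrite /B -!addrA lerDl !addr_ge0 ?cmod_ge0.
have B0 : 0 < B by lra.
have bphi : cmod (phi z) <= B.
  by rewrite /B; have := cmod_ge0 (psi z); have := cmod_ge0 d; have := cmod_ge0 d'; lra.
have bpsi : cmod (psi z) <= B.
  by rewrite /B; have := cmod_ge0 (phi z); have := cmod_ge0 d; have := cmod_ge0 d'; lra.
have bd : cmod d <= B.
  by rewrite /B; have := cmod_ge0 (phi z); have := cmod_ge0 (psi z); have := cmod_ge0 d'; lra.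
have bd' : cmod d' <= B.
  by rewrite /B; have := cmod_ge0 (phi z); have := cmod_ge0 d; have := cmod_ge0 (psi z); lra.
pose q := Num.min 1 (e / (4 * B)).
have q0 : 0 < q by rewrite lt_min ltr01 divr_gt0 // mulr_gt0.
have q1 : q <= 1 by rewrite ge_min lexx.
have qe : q * (4 * B) <= e by rewrite -ler_pdivlMr ?mulr_gt0 // ge_min lexx orbT.
have [k1 k10 hk1] := h1 _ q0; have [k2 k20 hk2] := h2 _ q0.
pose k3 := e / (4 * (B + 1) * (B + 1)).
have k30 : 0 < k3 by rewrite divr_gt0 // !mulr_gt0 // addr_gt0.
exists (Num.min (Num.min k1 k2) k3); first by rewrite !lt_min k10 k20.
move=> h; rewrite !lt_min => /andP[/andP[/hk1 {}hk1 /hk2 {}hk2] h3].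
have c0 := cmod_ge0 h.
set P := phi (z + h) - phi z - d * h in hk1.
set S := psi (z + h) - psi z - d' * h in hk2.
have -> : phi (z + h) * psi (z + h) - phi z * psi z - (d * psi z + phi z * d') * h
  = P * psi z + phi z * S + (P + d * h) * (S + d' * h).
  by rewrite /P /S; ring.
have a1 : cmod (P * psi z) <= (q * cmod h) * B by rewrite cmodM ler_pM ?cmod_ge0.
have a2 : cmod (phi z * S) <= B * (q * cmod h) by rewrite cmodM ler_pM ?cmod_ge0.
have a3 : cmod ((P + d * h) * (S + d' * h)) <= ((B + 1) * cmod h) * ((B + 1) * cmod h).
  rewrite cmodM ler_pM ?cmod_ge0 //; apply: le_trans (cmodD _ _) _;
    rewrite cmodM mulrDl addrC mul1r lerD // ?ler_wpM2r //.
    by rewrite (le_trans hk1) // ler_piMl.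
  by rewrite (le_trans hk2) // ler_piMl.
have a4 : ((B + 1) * cmod h) * ((B + 1) * cmod h) <= e / 4 * cmod h.
  rewrite mulrA ler_wpM2r //.
  have -> : e / 4 = (B + 1) * k3 * (B + 1).
    rewrite /k3; field; rewrite gt_eqF //; lra.
  by rewrite ler_wpM2r ?ler_wpM2l ?ltW //; lra.
have a5 : (q * cmod h) * B * 4 <= e * cmod h.
  by rewrite [leLHS](_ : _ = q * (4 * B) * cmod h) ?ler_wpM2r //; ring.
apply: le_trans (cmodD _ _) _; apply: le_trans (lerD (cmodD _ _) (lexx _)) _.
have : 0 <= e * cmod h by rewrite mulr_ge0 // ltW.
lra.
Qed.

Lemma cderivZ (c : C) phi z d : cderiv phi z d -> cderiv (fun t => c * phi t) z (c * d).
Proof.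
by move=> h; have := cderivM (cderiv_cst c z) h; rewrite mul0r add0r.
Qed.

Lemma cderivB phi psi z d d' : cderiv phi z d -> cderiv psi z d' ->
  cderiv (fun t => phi t - psi t) z (d - d').
Proof.
move=> h1 h2; have := cderivD h1 (cderivZ (-1) h2); rewrite mulN1r.
by congr cderiv; apply/funext => t; rewrite mulN1r.
Qed.

Lemma cderiv_scale phi (c z d : C) : cderiv phi (z * c) d ->
  cderiv (fun t => phi (t * c)) z (d * c).
Proof.
move=> h e e0.
have B0 : 0 < 1 + cmod c by rewrite ltr_pwDl ?cmod_ge0.
have [k k0 hk] := h _ (divr_gt0 e0 B0).
exists (k / (1 + cmod c)); first by rewrite divr_gt0.
move=> x; rewrite ltr_pdivlMr // => hx.
have x0 := cmod_ge0 x; have c0 := cmod_ge0 c.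
have cx : cmod (x * c) <= cmod x * (1 + cmod c).
  by rewrite cmodM ler_wpM2l //; lra.
rewrite mulrDl -mulrA [c * x]mulrC; apply: le_trans (hk _ (le_lt_trans cx hx)) _.
rewrite -mulrA ler_pM2l // ler_pdivrMl // [leRHS]mulrC //.
Qed.

(** The mean value inequality for complex values, where the mean value theorem
    itself fails: a bound on the increments at small scales adds up over dyadic
    intervals. *)
Lemma mean_value_le (G : C -> C) (g' : R -> C) (K : R) :
  (forall s, 0 <= s <= 1 -> cderiv G (rc s) (g' s) /\ cmod (g' s) <= K) ->
  cmod (G 1 - G 0) <= K.
Proof.
move=> hG; apply/ler_addgt0Pr => e e0.
pose P l j (k : nat) := cmod (G (rc (j.+1%:R * 2^-1 ^+ l)) - G (rc (j%:R * 2^-1 ^+ l)))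
   <= (K + e) * 2^-1 ^+ l.
suff : P 0%N 0%N 0%N by rewrite /P expr0 !mulr1 rmorph0 rmorph1.
apply: (@bisection2 R P) => [l j k h1 h2 _ _|u v u01 _].
  move: h1 h2; rewrite /P -!doubleS.
  have hd m : m.*2%:R * 2^-1 ^+ l.+1 = m%:R * 2^-1 ^+ l :> R.
    by rewrite -muln2 natrM exprS mulrA mulfK // pnatr_eq0.
  rewrite !hd => h1 h2.
  apply: le_trans (cmod_triangle (G (rc (j.*2.+1%:R * 2^-1 ^+ l.+1))) _ _) _.
  have : 2^-1 ^+ l.+1 = 2^-1 ^+ l / 2 :> R by rewrite exprSr.
  move=> hh; rewrite hh in h1 h2 *; lra.
have [du K_ge] := hG u u01; have [k k0 hk] := du _ e0.
have [l0 hl0] := halfX_small k0.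
exists l0 => l j i lel /andP[j1 j2] _.
pose s : R := 2^-1 ^+ l; have s0 : 0 < s by rewrite exprn_gt0 ?invr_gt0.
have sk : s < k by exact: hl0.
have s2 : 2 ^+ l * s = 1 by rewrite -exprMn divff ?pnatr_eq0 // expr1n.
have x1 : j%:R * s <= u by have := ler_wpM2r (ltW s0) j1; rewrite -mulrA s2 mulr1.
have x2 : u <= j.+1%:R * s by have := ler_wpM2r (ltW s0) j2; rewrite -mulrA s2 mulr1.
have jS : j.+1%:R * s = j%:R * s + s :> R by rewrite -natr1 mulrDl mul1r.
have key x : `|x - u| <= s ->
    cmod (G (rc x) - G (rc u) - g' u * (rc x - rc u)) <= e * `|x - u|.
  move=> xs; have := hk (rc x - rc u).
  have -> : cmod (rc x - rc u) = `|x - u| by rewrite -rmorphB cmod_rc.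
  by rewrite [rc u + _]addrC subrK; apply; exact: le_lt_trans sk.
have k1 : `|j.+1%:R * s - u| = j.+1%:R * s - u by rewrite ger0_norm //; lra.
have k2 : `|j%:R * s - u| = u - j%:R * s by rewrite distrC ger0_norm //; lra.
have b1 := key (j.+1%:R * s); have b2 := key (j%:R * s).
rewrite k1 in b1; rewrite k2 in b2.
have {}b1 := b1 ltac:(lra); have {}b2 := b2 ltac:(lra).
rewrite /P -/s.
have -> : G (rc (j.+1%:R * s)) - G (rc (j%:R * s)) =
  (G (rc (j.+1%:R * s)) - G (rc u) - g' u * (rc (j.+1%:R * s) - rc u)) -
  (G (rc (j%:R * s)) - G (rc u) - g' u * (rc (j%:R * s) - rc u)) + g' u * rc s.
  rewrite jS rmorphD; ring.
apply: le_trans (cmodD _ _) _; apply: le_trans (lerD (cmodB _ _) (lexx _)) _.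
have : cmod (g' u * rc s) <= K * s.
  by rewrite cmodM cmod_rc ger0_norm ?(ltW s0) // ler_wpM2r // ltW.
lra.
Qed.

End ComplexDerivative.

(** * Directional derivatives of holomorphic functions *)

Section Holomorphy.
Variables (R : realType).
Notation C := (Cplx R).
Variables (V : lmodType C) (nv : V -> R).
Hypothesis nvD : forall x y, nv (x + y) <= nv x + nv y.
Hypothesis nvZ : forall (c : C) x, nv (c *: x) = cmod c * nv x.
Implicit Types (f : V -> C) (a x y u v : V).

Lemma nv0 : nv 0 = 0.
Proof. by rewrite -(scale0r 0) nvZ cmod0 mul0r. Qed.

Lemma nvN x : nv (- x) = nv x.
Proof. by rewrite -scaleN1r nvZ cmodN cmod1 mul1r. Qed.

Lemma nv_ge0 x : 0 <= nv x.
Proof.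
by have := nvD x (- x); rewrite nvN subrr nv0; lra.
Qed.

(** Derivative at x in the complex direction v. *)
Definition lderiv f x v (d : C) := cderiv (fun t => f (x + t *: v)) 0 d.

Lemma lderiv_unique f x v d1 d2 : lderiv f x v d1 -> lderiv f x v d2 -> d1 = d2.
Proof. exact: cderiv_unique. Qed.

Lemma lderiv_line f x v (t d : C) : lderiv f (x + t *: v) v d ->
  cderiv (fun s => f (x + s *: v)) t d.
Proof.
move=> h e e0; have [k k0 hk] := h e e0; exists k => // s /hk.
by rewrite !add0r scale0r addr0 scalerDl addrA.
Qed.

Definition dirder v f x : C := xget 0 [set d | lderiv f x v d].

Lemma dirder_eq v f x d : lderiv f x v d -> dirder v f x = d.
Proof.
move=> h; apply: (lderiv_unique _ h).
by apply: (@xgetPex _ 0 [set d | lderiv f x v d]); exists d.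
Qed.

(** Holomorphy on the ball of radius rho, in the form that is stable under taking
    directional derivatives: complex differentiability along all lines, linear
    dependence on the direction, and a uniform bound. The ball is that of the
    seminorm nv. *)
Definition hol a (rho M : R) f := forall x, nv (x - a) < rho ->
  [/\ cmod (f x) <= M, forall v, lderiv f x v (dirder v f x)
    & forall (c : C) u v, dirder (c *: u + v) f x = c * dirder u f x + dirder v f x].

Lemma ball_open a (rho : R) x v : nv (x - a) < rho -> exists2 k : R, 0 < k &
  forall t : C, cmod t < k -> nv (x + t *: v - a) < rho.
Proof.
move=> xa; exists ((rho - nv (x - a)) / (1 + nv v)).
  by rewrite divr_gt0 ?subr_gt0 // ltr_pwDl ?nv_ge0.
move=> t; rewrite ltr_pdivlMr; last by rewrite ltr_pwDl ?nv_ge0.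
rewrite mulrDr mulr1 => h; rewrite addrAC.
apply: le_lt_trans (nvD _ _) _; rewrite nvZ.
have := cmod_ge0 t; lra.
Qed.

Lemma lderiv_germ a rho f g x v d : nv (x - a) < rho ->
  (forall y, nv (y - a) < rho -> f y = g y) -> lderiv f x v d -> lderiv g x v d.
Proof.
move=> xa fg; have [k k0 hk] := ball_open v xa.
by apply: (cderiv_near k0) => h /hk hh; rewrite add0r fg.
Qed.

Lemma ball_line a rho x v (t : C) (c : R) : nv v <= c ->
  nv (x - a) + cmod t * c < rho -> nv (x + t *: v - a) < rho.
Proof.
move=> vc; apply: le_lt_trans; rewrite addrAC.
apply: le_trans (nvD _ _) _; rewrite nvZ lerD2l ler_wpM2l ?cmod_ge0 //.
Qed.

(** Cauchy's estimate on the complex line through x in the direction v. *)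
Lemma hol_dirder_le a rho M f x v (c delta : R) : hol a rho M f ->
  0 < delta -> 0 < c -> nv v <= c -> nv (x - a) + delta < rho ->
  cmod (dirder v f x) <= M * (c / delta).
Proof.
move=> hf d0 c0 vc xa.
have -> : M * (c / delta) = M / (delta / c) by rewrite invf_div mulrCA mulrC.
have in_ball t : cmod t <= delta / c -> nv (x + t *: v - a) < rho.
  move=> ht; apply: (ball_line vc); apply: le_lt_trans xa.
  by rewrite lerD2l -ler_pdivlMr.
apply: (@cauchy_estimate _ (fun t => f (x + t *: v))).
- by rewrite divr_gt0.
- move=> t /in_ball ht; exists (dirder v f (x + t *: v)).
  by apply: lderiv_line; case: (hf _ ht).
- suff xa' : nv (x - a) < rho by case: (hf _ xa') => _ + _; apply.
  by apply: lt_trans xa; rewrite ltrDl.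
- by move=> t ht; case: (hf (x + t *: v)) => //; apply: in_ball; rewrite ht.
Qed.

Lemma hol_lipschitz a rho M f x v (t : C) (c delta : R) : hol a rho M f ->
  0 < delta -> 0 < c -> nv v <= c -> nv (x - a) + cmod t * c + delta < rho ->
  cmod (f (x + t *: v) - f x) <= cmod t * (M * (c / delta)).
Proof.
move=> hf d0 c0 vc xa.
have := @mean_value_le R (fun s => f (x + (s * t) *: v))
  (fun s => dirder v f (x + (rc s * t) *: v) * t) (cmod t * (M * (c / delta))).
rewrite mul0r mul1r scale0r addr0; apply => s /andP[s0 s1].
have st : cmod (rc s * t) * c <= cmod t * c.
  rewrite cmodM cmod_rc ger0_norm // -mulrA ler_piMl // mulr_ge0 ?cmod_ge0 //.
  exact: ltW.
have ya : nv (x + (rc s * t) *: v - a) + delta < rho.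
  apply: le_lt_trans xa; rewrite lerD2r addrAC.
  apply: le_trans (nvD _ _) _; rewrite nvZ lerD2l.
  by apply: le_trans st; rewrite ler_wpM2l ?cmod_ge0.
split.
  apply: (@cderiv_scale _ (fun t => f (x + t *: v))); apply: lderiv_line.
  suff ya' : nv (x + (rc s * t) *: v - a) < rho by case: (hf _ ya').
  by apply: lt_trans ya; rewrite ltrDl.
rewrite cmodM mulrC ler_wpM2l ?cmod_ge0 //.
exact: hol_dirder_le hf d0 c0 vc ya.
Qed.

Lemma hol_sub a rho rho' M f : rho' <= rho -> hol a rho M f -> hol a rho' M f.
Proof. by move=> le_rho hf x xa; apply: hf; apply: lt_le_trans xa le_rho. Qed.

Definition diff_quotient u (t : C) f x := (f (x + t *: u) - f x) / t.

Lemma lderiv_diff_quotient u t f x v d1 d2 : lderiv f (x + t *: u) v d1 -> lderiv f x v d2 ->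
  lderiv (diff_quotient u t f) x v ((d1 - d2) / t).
Proof.
move=> h1 h2; rewrite /lderiv /diff_quotient.
have := cderivZ t^-1 (cderivB h1 h2); rewrite mulrC.
congr cderiv; apply/funext => s; rewrite mulrC; congr ((f _ - _) / _).
by rewrite addrAC.
Qed.

Lemma dirder_diff_quotient a rho M f u t x v : hol a rho M f ->
  nv (x - a) < rho -> nv (x + t *: u - a) < rho ->
  dirder v (diff_quotient u t f) x = diff_quotient u t (dirder v f) x.
Proof.
move=> hf xa xta; apply: dirder_eq; apply: lderiv_diff_quotient.
  by case: (hf _ xta).
by case: (hf _ xa).
Qed.

(** Difference quotients are holomorphic on a smaller ball, with a bound that does
    not depend on the increment t. *)
Lemma hol_diff_quotient a rho rho' M f u (t : C) (c delta : R) : hol a rho M f ->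
  t != 0 -> 0 < delta -> 0 < c -> nv u <= c -> rho' + cmod t * c + delta <= rho ->
  hol a rho' (M * (c / delta)) (diff_quotient u t f).
Proof.
move=> hf t0 d0 c0 uc hrho x xa.
have tc : 0 <= cmod t * c by rewrite mulr_ge0 ?cmod_ge0 // ltW.
have xa1 : nv (x - a) < rho by lra.
have xa2 : nv (x + t *: u - a) < rho by apply: (ball_line uc); lra.
have [_ f1 l1] := hf _ xa1; have [_ f2 l2] := hf _ xa2.
split.
- rewrite /diff_quotient cmodM cmodV mulrC ler_pdivrMl ?cmod_gt0 //.
  by apply: hol_lipschitz hf d0 c0 uc _; lra.
- by move=> v; rewrite (dirder_diff_quotient _ hf) //; apply: lderiv_diff_quotient.
- move=> k v w; rewrite !(dirder_diff_quotient _ hf) // /diff_quotient l1 l2; ring.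
Qed.

(** Cauchy's estimate for the difference quotient along u. *)
Lemma hol_dirder_lipschitz a rho M f x u v (t : C) (c delta : R) : hol a rho M f ->
  0 < delta -> 0 < c -> nv u <= c -> nv v <= c ->
  nv (x - a) + cmod t * c + 2 * delta < rho ->
  cmod (dirder v f (x + t *: u) - dirder v f x) <= cmod t * (M * (c / delta) ^+ 2).
Proof.
move=> hf d0 c0 uc vc xa.
have tc : 0 <= cmod t * c by rewrite mulr_ge0 ?cmod_ge0 // ltW.
have [->|t0] := eqVneq t 0; first by rewrite scale0r addr0 subrr cmod0 mul0r.
have hq := @hol_diff_quotient a rho (rho - cmod t * c - delta) M f u t c delta hf t0 d0 c0 uc ltac:(lra).
have xa2 : nv (x - a) + delta < rho - cmod t * c - delta by lra.
have := hol_dirder_le hq d0 c0 vc xa2.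
rewrite (dirder_diff_quotient _ hf) //; [|lra|by apply: (ball_line uc); lra].
rewrite /diff_quotient cmodM cmodV [X in X <= _]mulrC ler_pdivrMl ?cmod_gt0 //.
by rewrite expr2 -(mulrA M).
Qed.

(** Subtract the linear part and apply the mean value inequality; the derivative
    of the difference is small since directional derivatives are Lipschitz. *)
Lemma hol_taylor1 a rho M f x u (t : C) (c delta : R) : hol a rho M f ->
  0 < delta -> 0 < c -> nv u <= c ->
  nv (x - a) + cmod t * c + 2 * delta < rho ->
  cmod (f (x + t *: u) - f x - t * dirder u f x) <= cmod t ^+ 2 * (M * (c / delta) ^+ 2).
Proof.
move=> hf d0 c0 uc xa.
have tc : 0 <= cmod t * c by rewrite mulr_ge0 ?cmod_ge0 // ltW.
have M0 : 0 <= M.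
  by have [|h _ _] := hf x; [lra|apply: le_trans h; apply: cmod_ge0].
have := @mean_value_le R (fun s => f (x + (s * t) *: u) - s * (t * dirder u f x))
  (fun s => dirder u f (x + (rc s * t) *: u) * t - t * dirder u f x)
  (cmod t ^+ 2 * (M * (c / delta) ^+ 2)).
rewrite !mul0r !mul1r scale0r addr0 subr0 addrAC; apply => s /andP[s0 s1].
have st : cmod (rc s * t) <= cmod t.
  by rewrite cmodM cmod_rc ger0_norm // ler_piMl ?cmod_ge0.
have stc : cmod (rc s * t) * c <= cmod t * c by rewrite ler_wpM2r // ltW.
split.
  apply: cderivB.
    apply: (@cderiv_scale _ (fun t => f (x + t *: u))); apply: lderiv_line.
    suff ya' : nv (x + (rc s * t) *: u - a) < rho by case: (hf _ ya').
    by apply: (ball_line uc); lra.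
  have := cderivZ (t * dirder u f x) (cderiv_id (rc s)); rewrite mulr1.
  by congr cderiv; apply/funext => z; rewrite mulrC.
rewrite mulrC -mulrBr cmodM expr2 -mulrA ler_wpM2l ?cmod_ge0 //.
apply: le_trans (hol_dirder_lipschitz hf d0 c0 uc uc _) _; first by lra.
by rewrite ler_wpM2r // mulr_ge0 // exprn_ge0 // divr_ge0 // ltW.
Qed.

(** The key step towards derivatives of all orders: difference quotients of f
    along u converge uniformly, at a linear rate, to the derivative along u, and
    by Cauchy's estimate their derivatives along v converge at a linear rate too.
    The limit of the latter is a second derivative of f for both orders of
    differentiation. *)
Lemma hol_second a rho M f x u v : hol a rho M f -> nv (x - a) < rho ->
  exists L, lderiv (dirder v f) x u L /\ lderiv (dirder u f) x v L.
Proof.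
move=> hf xa.
pose c := 1 + nv u + nv v.
have u0 := nv_ge0 u; have v0 := nv_ge0 v; have x0 := nv_ge0 (x - a).
have c0 : 0 < c by rewrite /c; lra.
have uc : nv u <= c by rewrite /c; lra.
have vc : nv v <= c by rewrite /c; lra.
(* Eight times delta leaves room for all the shifts and for the radii of the
   discs on which Cauchy's estimate is applied. *)
pose delta := (rho - nv (x - a)) / 8.
have d0 : 0 < delta by rewrite divr_gt0 // subr_gt0.
have rhoE : rho = nv (x - a) + 8 * delta by rewrite /delta; field.
pose tau := delta / c.
have tau0 : 0 < tau by rewrite divr_gt0.
have tauc : tau * c = delta by rewrite /tau divfK // gt_eqF.
have M0 : 0 <= M.
  by have [h _ _] := hf x xa; apply: le_trans h; apply: cmod_ge0.
pose q := c / delta; have q0 : 0 < q by rewrite divr_gt0.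
have small t : cmod t <= tau -> cmod t * c <= delta.
  by move=> ht; rewrite -tauc ler_wpM2r // ltW.
pose I := {t : C | t != 0 /\ cmod t <= tau}.
have unif (t : C) y : t != 0 -> cmod t <= tau -> nv (y - a) + 4 * delta < rho ->
    cmod (diff_quotient u t f y - dirder u f y) <= cmod t * (M * q ^+ 2).
  move=> t0 ht ya; have st := small t ht.
  have := @hol_taylor1 _ _ _ _ y u t c delta hf d0 c0 uc ltac:(lra).
  have -> : f (y + t *: u) - f y - t * dirder u f y = t * (diff_quotient u t f y - dirder u f y).
    by rewrite /diff_quotient; field.
  by rewrite cmodM expr2 -mulrA ler_pM2l ?cmod_gt0.
have holI (t : I) : hol a (rho - 2 * delta) (M * q) (diff_quotient u (sval t) f).
  case: t => t [t0 ht] /=; have st := small t ht.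
  by apply: hol_diff_quotient hf t0 d0 c0 uc _; lra.
pose h (t : I) := dirder v (diff_quotient u (sval t) f) x.
have [] := @rate_limit R I h (fun t => cmod (sval t) * (M * q ^+ 3)).
- have t0 : rc tau != 0 by rewrite fmorph_eq0 gt_eqF.
  have ht : cmod (rc tau) <= tau by rewrite cmod_rc ger0_norm // ltW.
  by exists (exist _ (rc tau) (conj t0 ht)).
- move=> t t'; pose F y := diff_quotient u (sval t) f y - diff_quotient u (sval t') f y.
  (* Two difference quotients are both close to dirder u f, hence to each other. *)
  have hF : hol a (rho - 4 * delta) ((cmod (sval t) + cmod (sval t')) * (M * q ^+ 2)) F.
    move=> y ya; have ya2 : nv (y - a) < rho - 2 * delta by lra.
    have [_ g1 l1] := holI t _ ya2; have [_ g2 l2] := holI t' _ ya2.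
    have pF w : lderiv F y w (dirder w (diff_quotient u (sval t) f) y - dirder w (diff_quotient u (sval t') f) y).
      exact: (cderivB (g1 w) (g2 w)).
    split.
    + have [t0 ht] := svalP t; have [t'0 ht'] := svalP t'.
      apply: le_trans (cmod_triangle (dirder u f y) _ _) _.
      rewrite [X in _ + X]cmodBC mulrDl lerD // unif //; lra.
    + by move=> w; rewrite (dirder_eq (pF w)).
    + move=> k w w'; rewrite !(dirder_eq (pF _)) l1 l2; ring.
  have xa4 : nv (x - a) + delta < rho - 4 * delta by lra.
  have := hol_dirder_le hF d0 c0 vc xa4.
  have [_ g1 _] := holI t x ltac:(lra); have [_ g2 _] := holI t' x ltac:(lra).
  rewrite (dirder_eq (cderivB (g1 v) (g2 v))) -/(h t) -/(h t') => /le_trans; apply.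
  by rewrite -/q le_eqVlt; apply/orP; left; apply/eqP; ring.
move=> L hL; exists L; split.
  move=> e e0; pose K := M * q ^+ 3.
  have K0 : 0 <= K by rewrite mulr_ge0 // exprn_ge0 // ltW.
  exists (Num.min tau (e / (2 * K + 1))).
    by rewrite lt_min tau0 divr_gt0 //; lra.
  move=> t; rewrite lt_min => /andP[ht]; rewrite ltr_pdivlMr; last lra.
  move=> hte; have [->|t0] := eqVneq t 0.
    by rewrite addr0 subrr mulr0 subr0 cmod0 mulr0.
  have := hL (exist _ t (conj t0 (ltW ht))).
  have st := small t (ltW ht).
  rewrite /h /= (dirder_diff_quotient _ hf) //; last by apply: (ball_line uc); lra.
  rewrite add0r scale0r addr0 => hLt.
  have -> : dirder v f (x + t *: u) - dirder v f x - L * t = t * (diff_quotient u t (dirder v f) x - L).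
    by rewrite /diff_quotient; field.
  rewrite cmodM mulrC ler_wpM2r ?cmod_ge0 //; apply: le_trans hLt _.
  rewrite -/K; have := cmod_ge0 t; lra.
move=> e e0; pose K := M * q * q ^+ 2.
have K0 : 0 <= K := mulr_ge0 (mulr_ge0 M0 (ltW q0)) (exprn_ge0 _ (ltW q0)).
exists (Num.min tau (e / (K + 1))).
  by rewrite lt_min tau0 divr_gt0 //; lra.
move=> s; rewrite lt_min => /andP[hs]; rewrite ltr_pdivlMr; last lra.
move=> hse; rewrite add0r scale0r addr0.
have ss := small s (ltW hs).
have sc : 0 <= cmod s * c by rewrite mulr_ge0 ?cmod_ge0 // ltW.
suff : cmod (dirder u f (x + s *: v) - dirder u f x - L * s) <= cmod s ^+ 2 * K.
  move=> /le_trans; apply; rewrite expr2 -mulrA [leRHS]mulrC ler_wpM2l ?cmod_ge0 //.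
  have := cmod_ge0 s; lra.
(* Let the increment of the difference quotient tend to zero, with s fixed. *)
apply/ler_addgt0Pr => e1 e10.
pose B := 2 * (M * q ^+ 2) + 2 * cmod s * (M * q ^+ 3) + 1.
have B0 : 0 < B.
  have p2 := mulr_ge0 M0 (exprn_ge0 2 (ltW q0)).
  have p3 := mulr_ge0 (cmod_ge0 s) (mulr_ge0 M0 (exprn_ge0 3 (ltW q0))).
  by rewrite /B; lra.
pose tt := Num.min tau (e1 / B).
have tt0 : 0 < tt by rewrite lt_min tau0 divr_gt0.
have ctt : cmod (rc tt) = tt by rewrite cmod_rc ger0_norm // ltW.
have t0 : rc tt != 0 by rewrite fmorph_eq0 gt_eqF.
have ht : cmod (rc tt) <= tau by rewrite ctt ge_min lexx.
have := @hol_taylor1 _ _ _ _ x v s c delta (holI (exist _ _ (conj t0 ht))) d0 c0 vc ltac:(lra).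
have := hL (exist _ _ (conj t0 ht)); rewrite /h /= -/q -/K.
have xsa : nv (x + s *: v - a) + 4 * delta < rho.
  have := ball_line vc (_ : nv (x - a) + cmod s * c < nv (x - a) + 2 * delta).
  move=> /(_ ltac:(lra)); lra.
have := unif _ (x + s *: v) t0 ht xsa.
have := unif _ x t0 ht ltac:(lra).
set F := diff_quotient u _ f; rewrite ctt => A1 A2 A3 A4.
have -> : dirder u f (x + s *: v) - dirder u f x - L * s =
  (F (x + s *: v) - F x - s * dirder v F x) - (F (x + s *: v) - dirder u f (x + s *: v))
  + (F x - dirder u f x) + s * (dirder v F x - L) by ring.
have A5 : cmod (s * (dirder v F x - L)) <= cmod s * (2 * (tt * (M * q ^+ 3))).
  by rewrite cmodM ler_wpM2l ?cmod_ge0.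
have A6 : tt * B <= e1 by rewrite -ler_pdivlMr // ge_min lexx orbT.
apply: le_trans (cmodD _ _) _; apply: le_trans (lerD (cmodD _ _) (lexx _)) _.
apply: le_trans (lerD (lerD (cmodB _ _) (lexx _)) (lexx _)) _.
have A7 : tt * B = 2 * (tt * (M * q ^+ 2)) + cmod s * (2 * (tt * (M * q ^+ 3))) + tt.
  by rewrite /B; ring.
lra.
Qed.

Lemma dirder_comm a rho M f x u v : hol a rho M f -> nv (x - a) < rho ->
  dirder u (dirder v f) x = dirder v (dirder u f) x.
Proof.
by move=> hf xa; have [L [h1 h2]] := hol_second u v hf xa; rewrite !(dirder_eq (d:=L)).
Qed.

Lemma hol_dirder a rho M f u (c delta : R) : hol a rho M f ->
  0 < delta -> 0 < c -> nv u <= c -> hol a (rho - delta) (M * (c / delta)) (dirder u f).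
Proof.
move=> hf d0 c0 uc x xa.
have xa' : nv (x - a) < rho by lra.
have gd w w' : lderiv (dirder w f) x w' (dirder w' (dirder w f) x).
  by have [L [h1 h2]] := hol_second w' w hf xa'; rewrite (dirder_eq h1).
split.
- by apply: hol_dirder_le hf d0 c0 uc _; lra.
- by move=> v; apply: gd.
- move=> k v w; rewrite !(dirder_comm _ u hf xa').
  apply: dirder_eq; apply: (@lderiv_germ a rho (fun y => k * dirder v f y + dirder w f y)) => //.
    by move=> y ya; have [_ _ ->] := hf y ya.
  apply: cderivD; last exact: gd.
  by apply: cderivZ; apply: gd.
Qed.

End Holomorphy.

(** * Taylor expansion *)

(** The falling factorial of 2 d with d factors is at least d ^ d; it equals d!
    times a binomial coefficient, which is at most 4 ^ d. *)
Lemma expn_self_le_fact d : (d ^ d <= 4 ^ d * d`!)%N.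
Proof.
have h m n : (m <= n)%N -> ((n - m) ^ m <= n ^_ m)%N.
  elim: m n => [//|m IHm] [//|n]; rewrite ltnS => le_mn.
  rewrite ffactSS subSS expnS leq_mul //; first by rewrite (leq_trans (leq_subr _ _)).
  by apply: IHm.
have := h d d.*2; rewrite -addnn addnK leq_addr => /(_ isT) /leq_trans; apply.
rewrite -bin_ffact leq_mul2r; apply/orP; right.
rewrite -[4%N]/(2 ^ 2)%N -expnM mul2n addnn.
have := Pascal 1 1 d.*2; rewrite /= addn1 => ->.
rewrite (bigD1 (inord d)) //= inordK ?ltnS -?addnn ?leq_addr //.
by rewrite !exp1n !muln1 leq_addr.
Qed.

Section Taylor.
Variables (R : realType).
Notation C := (Cplx R).
Variables (V : lmodType C) (nv : V -> R).
Hypothesis nvD : forall x y, nv (x + y) <= nv x + nv y.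
Hypothesis nvZ : forall (c : C) x, nv (c *: x) = cmod c * nv x.
Implicit Types (f g h : V -> C) (a x y u v : V) (s : seq V).

(** Directional derivatives are bounded on smaller balls only; this form of
    holomorphy is preserved on the same ball. *)
Definition lhol a (rho : R) f := forall rho', rho' < rho -> exists M, hol nv a rho' M f.

Lemma hol_lhol a rho M f : hol nv a rho M f -> lhol a rho f.
Proof. by move=> hf r hr; exists M; apply: hol_sub hf; apply: ltW. Qed.

Lemma lhol_dirder a rho f u : lhol a rho f -> lhol a rho (dirder u f).
Proof.
move=> hf r hr; have [M hM] := hf ((r + rho) / 2) ltac:(lra).
have u0 := nv_ge0 nvD nvZ u.
exists (M * ((1 + nv u) / ((rho - r) / 2))).
rewrite [X in hol _ _ X _](_ : r = (r + rho) / 2 - (rho - r) / 2); last by field.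
by apply: (hol_dirder nvD nvZ hM) => //; lra.
Qed.

Lemma lholP a rho f x : lhol a rho f -> nv (x - a) < rho ->
  exists r M, [/\ nv (x - a) < r, r < rho & hol nv a r M f].
Proof.
move=> hf xa; have [M hM] := hf ((nv (x - a) + rho) / 2) ltac:(lra).
by exists ((nv (x - a) + rho) / 2), M; split => //; lra.
Qed.

(** Iterated directional derivatives. The head of the list is the innermost
    direction, so that a relation between first derivatives passes to all
    iterated ones. *)
Definition iter_dirder s f : V -> C := foldl (fun f v => dirder v f) f s.

Lemma iter_dirder_rcons s v f : iter_dirder (rcons s v) f = dirder v (iter_dirder s f).
Proof. by rewrite /iter_dirder foldl_rcons. Qed.

Lemma lhol_iter_dirder a rho s f : lhol a rho f -> lhol a rho (iter_dirder s f).
Proof. by elim: s f => [//|v s IHs] f hf; apply: IHs; apply: lhol_dirder. Qed.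

Lemma lhol_lderiv a rho f x u : lhol a rho f -> nv (x - a) < rho -> lderiv f x u (dirder u f x).
Proof. by move=> hf /(lholP hf)[r [M [xr _ /(_ x xr)[]]]]. Qed.

Lemma iter_dirder_linear a rho s f g h (k : C) : lhol a rho g -> lhol a rho h ->
  (forall y, nv (y - a) < rho -> f y = k * g y + h y) ->
  forall y, nv (y - a) < rho -> iter_dirder s f y = k * iter_dirder s g y + iter_dirder s h y.
Proof.
elim: s f g h => [//|v s IHs] f g h hg hh fE.
apply: IHs; try exact: lhol_dirder.
move=> y ya; apply: dirder_eq.
apply: (lderiv_germ nvD nvZ ya (f := fun y => k * g y + h y)) => [z /fE //|].
by apply: cderivD; [apply: cderivZ|]; apply: lhol_lderiv ya.
Qed.

Lemma iter_dirder_germ a rho s f g : lhol a rho g ->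
  (forall y, nv (y - a) < rho -> f y = g y) ->
  forall y, nv (y - a) < rho -> iter_dirder s f y = iter_dirder s g y.
Proof.
elim: s f g => [//|v s IHs] f g hg fE.
apply: IHs; first exact: lhol_dirder.
move=> y ya; apply: dirder_eq.
apply: (lderiv_germ nvD nvZ ya (f := g)) => [z /fE //|].
exact: lhol_lderiv ya.
Qed.

Lemma iter_dirder_head a rho s f u v (k : C) y : lhol a rho f -> nv (y - a) < rho ->
  iter_dirder ((k *: u + v) :: s) f y = k * iter_dirder (u :: s) f y + iter_dirder (v :: s) f y.
Proof.
move=> hf; move: y.
apply: (@iter_dirder_linear a rho s (dirder (k *: u + v) f) (dirder u f) (dirder v f));
  try exact: lhol_dirder.
by move=> y ya; have [r [M [xr _ /(_ y xr)[]]]] := lholP hf ya.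
Qed.

Lemma iter_dirder_swap a rho s f u v y : lhol a rho f -> nv (y - a) < rho ->
  iter_dirder (u :: v :: s) f y = iter_dirder (v :: u :: s) f y.
Proof.
move=> hf; move: y.
apply: (@iter_dirder_germ a rho s (dirder v (dirder u f)) (dirder u (dirder v f))).
  by do 2 apply: lhol_dirder.
move=> y ya; have [r [M [xr _ hM]]] := lholP hf ya.
exact: (dirder_comm nvD nvZ _ _ hM xr).
Qed.

Lemma iter_dirder_perm a rho s1 s2 f y : lhol a rho f -> nv (y - a) < rho ->
  perm_eq s1 s2 -> iter_dirder s1 f y = iter_dirder s2 f y.
Proof.
move=> hf ya.
have mv u s t g : lhol a rho g -> iter_dirder (u :: s ++ t) g y = iter_dirder (s ++ u :: t) g y.
  elim: s g => [//|v s IHs] g hg; rewrite [(v :: s) ++ t]/= [RHS]/=.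
  rewrite (iter_dirder_swap _ _ _ hg ya); apply: (IHs (dirder v g)); exact: lhol_dirder.
have ca s t w g : lhol a rho g -> iter_dirder (s ++ t ++ w) g y = iter_dirder (t ++ s ++ w) g y.
  elim: s g => [//|v s IHs] g hg; rewrite -mv //.
  by apply: (IHs (dirder v g)); apply: lhol_dirder.
move=> p12; apply/esym.
apply: (@catCA_perm_ind _ (fun s => iter_dirder s f y = iter_dirder s1 f y) _ _ _ p12) => //.
by move=> t1 t2 t3; rewrite ca.
Qed.

(** Each differentiation shrinks the radius by eta. *)
Lemma hol_iter_dirder a rho M f s (c eta : R) : hol nv a rho M f -> 0 < eta -> 0 < c ->
  (forall v, v \in s -> nv v <= c) ->
  hol nv a (rho - eta * (size s)%:R) (M * (c / eta) ^+ size s) (iter_dirder s f).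
Proof.
move=> hf e0 c0; elim/last_ind: s => [|s v IHs] hs.
  by rewrite mulr0 subr0 expr0 mulr1.
rewrite iter_dirder_rcons size_rcons.
have -> : rho - eta * (size s).+1%:R = rho - eta * (size s)%:R - eta.
  by rewrite -natr1; ring.
rewrite exprSr mulrA; apply: (hol_dirder nvD nvZ) => //.
  by apply: IHs => u us; apply: hs; rewrite mem_rcons inE us orbT.
by apply: hs; rewrite mem_rcons mem_head.
Qed.

(** Half of the radius is shared equally between the differentiations; the powers
    of their number are absorbed by the factorial. *)
Lemma iter_dirder_le a rho M f s (c : R) x : hol nv a rho M f -> 0 < rho -> 0 < c ->
  (forall v, v \in s -> nv v <= c) -> nv (x - a) < rho / 2 ->
  cmod (iter_dirder s f x) <= M * (8 * c / rho) ^+ size s * ((size s)`!)%:R.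
Proof.
move=> hf r0 c0 hs xa.
have [s0|s0] := posnP (size s).
  rewrite s0 expr0 !mulr1; rewrite (size0nil s0) /=.
  by have [] := hf x => //; lra.
have sR : 0 < (size s)%:R :> R by rewrite ltr0n.
have eta0 : 0 < rho / 2 / (size s)%:R by rewrite !divr_gt0.
have := hol_iter_dirder hf eta0 c0 hs.
rewrite divfK ?gt_eqF // => /(_ x) [|h _ _]; first lra.
have M0 : 0 <= M.
  by have [|h' _ _] := hf x; [lra|apply: le_trans h'; apply: cmod_ge0].
apply: le_trans h _; rewrite -(mulrA M) ler_wpM2l //.
have -> : c / (rho / 2 / (size s)%:R) = (8 * c / rho) / 4 * (size s)%:R.
  by field; rewrite !gt_eqF.
have A0 : 0 <= 8 * c / rho by rewrite divr_ge0 ?mulr_ge0 // ltW.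
move: (8 * c / rho) A0 => A A0.
rewrite exprMn exprMn -(mulrA (A ^+ _)) ler_wpM2l ?exprn_ge0 //.
by rewrite exprVn ler_pdivrMl ?exprn_gt0 // -!natrX -natrM ler_nat expn_self_le_fact.
Qed.

Lemma cderiv_pow1B n (z : C) :
  cderiv (fun s : C => (1 - s) ^+ n.+1) z (- n.+1%:R * (1 - z) ^+ n).
Proof.
have h1 : cderiv (fun s : C => 1 - s) z (-1).
  by have := cderivB (cderiv_cst 1 z) (cderiv_id z); rewrite sub0r.
elim: n => [|n IHn].
  by rewrite expr0 mulr1.
have := cderivM h1 IHn.
have -> : -1 * (1 - z) ^+ n.+1 + (1 - z) * (- n.+1%:R * (1 - z) ^+ n) =
   - n.+2%:R * (1 - z) ^+ n.+1 by rewrite -[n.+2%:R]natr1 exprS; ring.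
by congr cderiv; apply/funext => s; rewrite [RHS]exprS.
Qed.

(** Taylor polynomial with respect to a moving base point: in its derivative all
    terms but the last cancel. *)
Lemma cderiv_taylor (phi : nat -> C -> C) (z : C) d :
  (forall k, cderiv (phi k) z (phi k.+1 z)) ->
  cderiv (fun s : C => \sum_(k < d.+1) phi k s * ((1 - s) ^+ k / (k`!)%:R)) z
    (phi d.+1 z * ((1 - z) ^+ d / (d`!)%:R)).
Proof.
move=> hphi; elim: d => [|d IHd].
  have := hphi 0%N; rewrite expr0 fact0 divr1 mulr1; congr cderiv.
  by apply/funext => s; rewrite big_ord1 expr0 fact0 divr1 mulr1.
have h2 := cderivZ ((d.+1)`!%:R^-1) (cderiv_pow1B d z).
have := cderivD IHd (cderivM (hphi d.+1) h2).
set lhs := (X in cderiv _ _ X -> _); have -> : lhs = phi d.+2 z * ((1 - z) ^+ d.+1 / d.+1`!%:R).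
  rewrite /lhs factS natrM; field.
  by rewrite nat1r !pnatr_eq0 -lt0n fact_gt0.
by congr cderiv; apply/funext => s; rewrite [RHS]big_ord_recr /= [_ / _]mulrC.
Qed.

(** Taylor's formula along the segment from a to a + x. The rate is geometric
    because the iterated derivatives are bounded by a factorial times a power. *)
Lemma taylor_rate a rho M f x : hol nv a rho M f -> 0 < rho -> 64 * nv x < rho ->
  forall d, cmod (f (a + x) - \sum_(k < d.+1) iter_dirder (nseq k x) f a / (k`!)%:R)
    <= M * 2^-1 ^+ d.+1.
Proof.
move=> hf r0 hx d.
have lf := hol_lhol hf.
have x0 := nv_ge0 nvD nvZ x.
have M0 : 0 <= M.
  have [|h' _ _] := hf a; first by rewrite subrr (nv0 nvZ).
  by apply: le_trans h'; apply: cmod_ge0.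
pose phi k (s : C) := iter_dirder (nseq k x) f (a + s *: x).
pose G (s : C) := \sum_(k < d.+1) phi k s * ((1 - s) ^+ k / (k`!)%:R).
(* Then 8 c / rho = 1/4: one factor 1/2 gives the rate, the other absorbs d + 1. *)
pose c := rho / 32.
have c0 : 0 < c by rewrite divr_gt0.
have := @mean_value_le R G (fun s : R => phi d.+1 (rc s) * ((1 - rc s) ^+ d / (d`!)%:R))
   (M * 2^-1 ^+ d.+1).
have -> : G 1 = f (a + x).
  rewrite /G big_ord_recl /= big1 ?addr0.
    by rewrite expr0 fact0 divr1 mulr1 /phi /= scale1r.
  by move=> i _; rewrite /= subrr expr0n /= mul0r mulr0.
have -> : G 0 = \sum_(k < d.+1) iter_dirder (nseq k x) f a / (k`!)%:R.
  by apply: eq_bigr => k _; rewrite subr0 expr1n mul1r /phi scale0r addr0.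
apply=> s /andP[s0 s1].
have sa : nv (a + rc s *: x - a) < rho / 2.
  rewrite addrAC subrr add0r nvZ cmod_rc ger0_norm //.
  have : s * nv x <= nv x by rewrite ler_piMl.
  lra.
have sa' : nv (a + rc s *: x - a) < rho by lra.
split.
  apply: cderiv_taylor => k; apply: lderiv_line.
  have -> : phi k.+1 (rc s) = dirder x (iter_dirder (nseq k x) f) (a + rc s *: x).
    rewrite -iter_dirder_rcons /phi; congr (iter_dirder _ f _).
    by elim: (k) => //= i ->.
  by apply: lhol_lderiv sa'; apply: lhol_iter_dirder.
have hc v : v \in nseq d.+1 x -> nv v <= c.
  by rewrite mem_nseq => /andP[_ /eqP->]; rewrite /c; lra.
have := iter_dirder_le hf r0 c0 hc sa; rewrite size_nseq -/(phi d.+1 (rc s)).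
have -> : 8 * c / rho = 2^-1 * 2^-1 by rewrite /c; field; rewrite gt_eqF.
move=> hb; rewrite cmodM cmodM cmodV cmod_nat cmodX.
have b1 : cmod (1 - rc s) ^+ d <= 1.
  rewrite exprn_ile1 ?cmod_ge0 // -(rmorph1 (@rc R)) -rmorphB cmod_rc ger0_norm; lra.
have f0 : 0 < d`!%:R :> R by rewrite ltr0n fact_gt0.
rewrite mulrA ler_pdivrMr //.
have : cmod (phi d.+1 (rc s)) * cmod (1 - rc s) ^+ d <= cmod (phi d.+1 (rc s)).
  by rewrite ler_piMr ?cmod_ge0.
move=> /le_trans; apply; apply: le_trans hb _.
rewrite exprMn factS natrM !mulrA ler_pM2r // -!mulrA ler_wpM2l // ler_piMr //.
  by rewrite exprn_ge0 // invr_ge0.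
rewrite exprVn ler_pdivrMl ?exprn_gt0 // mulr1 -natrX ler_nat.
exact/ltnW/ltn_expl.
Qed.

End Taylor.

(** * Holomorphic functions of several variables *)

Section Interface.
Variables (R : realType).
Notation C := (Cplx R).
Variable n : nat.
Implicit Types (f : 'cV[C]_n -> C) (x y v : 'cV[C]_n).

(** The sum norm, for which linear maps are estimated entrywise. *)
Definition l1norm x : R := \sum_i cmod (x i 0).

Lemma l1normD x y : l1norm (x + y) <= l1norm x + l1norm y.
Proof.
by rewrite /l1norm -big_split; apply: ler_sum => i _; rewrite mxE cmodD.
Qed.

Lemma l1normZ (c : C) x : l1norm (c *: x) = cmod c * l1norm x.
Proof. by rewrite /l1norm mulr_sumr; apply: eq_bigr => i _; rewrite mxE cmodM. Qed.

Lemma cmod_le_l1norm x i : cmod (x i 0) <= l1norm x.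
Proof.
by rewrite /l1norm (bigD1 i) //= lerDl sumr_ge0 // => j _; apply: cmod_ge0.
Qed.

Lemma Cplx_gt0 (e : C) : 0 < e -> e = rc (cmod e) /\ 0 < cmod e.
Proof.
move=> e0; split; last by apply: cmod_gt0; rewrite gt_eqF.
by rewrite -cmodE ger0_norm // ltW.
Qed.

Lemma ltC_cmod (z e : C) : 0 < e -> (`|z| < e) = (cmod z < cmod e).
Proof. by move=> /Cplx_gt0[eE _]; rewrite cmodE {1}eE rc_lt. Qed.

Lemma nbhs_l1norm x (P : set 'cV[C]_n) : nbhs x P <->
  exists2 r : R, 0 < r & forall y, l1norm (y - x) < r -> P y.
Proof.
split.
  move=> /nbhs_ballP[e /= e0 he]; have [eE ce0] := Cplx_gt0 e0.
  exists (cmod e) => // y hy; apply: he; split=> // i j.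
  rewrite /ball /= ltC_cmod // (ord1 j) cmodBC.
  have := cmod_le_l1norm (y - x) i; rewrite !mxE => h.
  exact: le_lt_trans hy.
move=> [r r0 hr]; apply/nbhs_ballP.
have d0 : 0 < r / (n%:R + 1) by rewrite divr_gt0 // ltr_wpDl.
exists (rc (r / (n%:R + 1))); first by rewrite /= -(rmorph0 (@rc R)) rc_lt.
move=> y hy; apply: hr.
apply: (@le_lt_trans _ _ (\sum_(i < n) r / (n%:R + 1))).
  apply: ler_sum => i _; have := hy.2 i 0; rewrite /ball /= cmodE rc_lt => /ltW.
  by rewrite cmodBC !mxE.
rewrite sumr_const card_ord -[X in X < _]mulr_natr mulrAC ltr_pdivrMr ?ltr_wpDl //.
by rewrite ltr_pM2l // ltrDl.
Qed.

Lemma cmod_slope (a b d h : C) (e : R) : h != 0 ->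
  cmod (d - h^-1 * (b - a)) <= e -> cmod (b - a - d * h) <= e * cmod h.
Proof.
move=> h0 hd; have -> : b - a - d * h = - ((d - h^-1 * (b - a)) * h) by field.
by rewrite cmodN cmodM ler_wpM2r ?cmod_ge0.
Qed.

Lemma lderiv_differentiable f x v : differentiable f x -> lderiv f x v ('D_v f x).
Proof.
move=> df; have dv : derivable f x v by exact: diff_derivable.
move: dv; rewrite /derivable => dv e e0.
have /cvgrPdist_le hc := dv.
have rce : 0 < rc e by rewrite -(rmorph0 (@rc R)) rc_lt.
have := hc _ rce; rewrite near_withinE => /nbhs_ballP[d /= d0 hd].
have [dE cd0] := Cplx_gt0 d0; exists (cmod d) => // h hk.
have [->|h0] := eqVneq h 0.
  by rewrite addr0 subrr mulr0 subr0 cmod0 mulr0.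
have := hd h; rewrite /ball /= sub0r normrN ltC_cmod // => /(_ hk h0).
rewrite cmodE rc_le add0r scale0r addr0 => hh.
rewrite [x + _]addrC; exact: (cmod_slope h0 hh).
Qed.

Lemma dirder_differentiable f x v : differentiable f x -> dirder v f x = 'D_v f x.
Proof. by move=> df; apply/dirder_eq/lderiv_differentiable. Qed.

(** Differentiability gives the linear directional derivatives, and continuity at
    a the bound on a small ball. *)
Lemma holomorphic_hol (D : set 'cV[C]_n) f a : open D -> D a -> holomorphic_on D f ->
  exists rho M, [/\ 0 < rho, forall x, l1norm (x - a) < rho -> D x & hol l1norm a rho M f].
Proof.
move=> oD Da hf.
have [r1 r10 h1] := (nbhs_l1norm a D).1 (open_nbhs_nbhs (conj oD Da)).
have cf := differentiable_continuous (hf a Da).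
move: cf => /cvgrPdist_lt cf; have ca := cf 1 ltr01.
have [r2 r20 h2] := (nbhs_l1norm a _).1 ca.
exists (Num.min r1 r2), (cmod (f a) + 1); split.
- by rewrite lt_min r10.
- by move=> x; rewrite lt_min => /andP[/h1].
move=> x; rewrite lt_min => /andP[/h1 Dx /h2].
rewrite ltC_cmod // cmod1 => hx; split.
- have := cmod_triangle (f a) (f x) 0; rewrite !subr0 cmodBC; lra.
- by move=> v; rewrite dirder_differentiable //; [apply: lderiv_differentiable|]; apply: hf.
- move=> c u v; rewrite !dirder_differentiable; try exact: hf.
  by rewrite !deriveE; try exact: hf; rewrite linearP.
Qed.

End Interface.

(** * Symmetric forms on Jordan chains *)

Section Words.
Variable T : eqType.
Implicit Types (L : seq T) (w : seq T).

Fixpoint words L d : seq (seq T) :=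
  if d is d'.+1 then [seq e :: w | e <- L, w <- words L d'] else [:: [::]].

Lemma big_wordsS (A : nmodType) L d (F : seq T -> A) :
  \sum_(w <- words L d.+1) F w = \sum_(e <- L) \sum_(w <- words L d) F (e :: w).
Proof. by rewrite /= big_allpairs_dep. Qed.

Lemma big_words0 (A : nmodType) L (F : seq T -> A) :
  \sum_(w <- words L 0) F w = F [::].
Proof. by rewrite big_seq1. Qed.

Lemma size_words L d : size (words L d) = (size L ^ d)%N.
Proof. by elim: d => //= d IHd; rewrite size_allpairs IHd expnS. Qed.

Lemma mem_words L d w : (w \in words L d) = (size w == d) && all (mem L) w.
Proof.
elim: d w => [|d IHd] [|e w] //=.
  by apply/allpairsP => -[[x y] [_ _]].
apply/allpairsP/idP => [[[x y] /= [xL yw [-> ->]]]|].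
  by move: yw; rewrite IHd eqSS xL => /andP[-> ->].
rewrite eqSS => /and3P[sw eL wL]; exists (e, w); split => //=.
by rewrite IHd sw.
Qed.

End Words.

(** The family of iterated derivatives at a point, a symmetric form in any number
    of vectors, linear in the first one. *)
Section Multilinear.
Variables (K : fieldType) (V : lmodType K) (E : eqType).
Variable Tm : seq V -> K.
Hypothesis Tm_perm : forall s t, perm_eq s t -> Tm s = Tm t.
Hypothesis Tm_head : forall (k : K) u v s,
  Tm ((k *: u + v) :: s) = k * Tm (u :: s) + Tm (v :: s).

Lemma Tm_0 s : Tm (0 :: s) = 0.
Proof.
have := Tm_head 1 0 0 s; rewrite scaler0 addr0 mul1r => /eqP.
by rewrite -subr_eq0 opprD addNKr oppr_eq0 => /eqP.
Qed.

Lemma Tm_sum (L : seq E) (c : E -> K) (b : E -> V) s :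
  Tm ((\sum_(e <- L) c e *: b e) :: s) = \sum_(e <- L) c e * Tm (b e :: s).
Proof.
elim: L => [|e L IHL]; first by rewrite !big_nil Tm_0.
by rewrite !big_cons Tm_head IHL.
Qed.

(** Linearity is available for the head only; symmetry moves each vector to the
    head in turn. *)
Lemma multilinear_words (L : seq E) (c : E -> K) (b : E -> V) x d s :
  x = \sum_(e <- L) c e *: b e ->
  Tm (nseq d x ++ s) =
    \sum_(w <- words L d) (\prod_(e <- w) c e) * Tm (map b w ++ s).
Proof.
move=> xE; elim: d s => [|d IHd] s.
  by rewrite big_words0 big_nil mul1r.
rewrite big_wordsS /= [X in X :: _]xE Tm_sum; apply: eq_bigr => e _.
have perm_mid (t1 : seq V) v t2 : Tm (v :: t1 ++ t2) = Tm (t1 ++ v :: t2).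
  by apply: Tm_perm; apply: (permEl (perm_catCA [:: v] t1 t2)).
rewrite perm_mid IHd mulr_sumr; apply: eq_bigr => w _.
by rewrite big_cons -mulrA -perm_mid.
Qed.

End Multilinear.

(** The letter (k, (t, i)) stands for the vector of index i in the chain t of the
    eigenvalue k, and for zero beyond the end of the chain. The values G w and F w
    are the iterated derivatives of g and f at a point in the directions of the
    letters of w. Hypothesis F_head is the differential equation. *)
Section JordanWords.
Variables (K : fieldType) (p : nat) (lam : 'I_p -> K) (ns : 'I_p -> seq nat).
Hypothesis lam_inj : injective lam.
Notation letter := ('I_p * (nat * nat))%type.
Variables (F G : seq letter -> K).
Hypothesis G_perm : forall s t, perm_eq s t -> G s = G t.
Hypothesis F_perm : forall s t, perm_eq s t -> F s = F t.
Hypothesis F_head : forall k t i s,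
  F ((k, (t, i)) :: s) = lam k * G ((k, (t, i)) :: s) + G ((k, (t, i.+1)) :: s).
Hypothesis G_out : forall k t i s, ~~ (i <= nth 0%N (ns k) t)%N ->
  G ((k, (t, i)) :: s) = 0.
Let top k t := nth 0%N (ns k) t.

Lemma G_swap a b s : G (a :: b :: s) = G (b :: a :: s).
Proof. by apply: G_perm; apply: (permEl (perm_catCA [:: a] [:: b] s)). Qed.

(** Symmetry of the second derivatives of f, expressed through g. *)
Lemma compat a b s :
  lam a.1 * G (a :: b :: s) + G ((a.1, (a.2.1, a.2.2.+1)) :: b :: s) =
  lam b.1 * G (b :: a :: s) + G ((b.1, (b.2.1, b.2.2.+1)) :: a :: s).
Proof.
case: a b => [k [t i]] [k' [t' i']] /=; rewrite -!F_head.
by apply: F_perm; apply: (permEl (perm_catCA [:: _] [:: _] s)).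
Qed.

(** Letters of distinct eigenvalues do not interact: the second derivatives
    across two generalized eigenspaces solve a homogeneous Sylvester equation. *)
Lemma mixed_eq0 k k' t i t' i' s : k != k' ->
  G ((k, (t, i)) :: (k', (t', i')) :: s) = 0.
Proof.
move=> kk'; have [m] := ubnP (((top k t).+1 - i) + ((top k' t').+1 - i'))%N.
elim: m i i' => // m IHm i i' lem.
have [i_le|/G_out ->//] := boolP (i <= nth 0%N (ns k) t)%N.
have [i'_le|/G_out] := boolP (i' <= nth 0%N (ns k') t')%N; last by rewrite G_swap.
have := compat (k, (t, i)) (k', (t', i')) s => /=.
have -> : G ((k, (t, i.+1)) :: (k', (t', i')) :: s) = 0.
  by apply: IHm; move: lem i_le i'_le; rewrite /top; lia.
have -> : G ((k', (t', i'.+1)) :: (k, (t, i)) :: s) = 0.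
  by rewrite G_swap; apply: IHm; move: lem i_le i'_le; rewrite /top; lia.
rewrite !addr0 [in RHS]G_swap => /eqP; rewrite -subr_eq0 -mulrBl mulf_eq0.
by rewrite subr_eq0 (inj_eq lam_inj) (negPf kk') => /eqP.
Qed.

Lemma mixed_word_eq0 k e s : has (fun e' => e'.1 != k) s -> e.1 = k ->
  G (e :: s) = 0.
Proof.
move=> /hasP[e' e's e'k] ek.
have ps : perm_eq (e :: s) (e :: e' :: rem e' s) by rewrite perm_cons perm_to_rem.
rewrite (G_perm ps); case: e e' ek e'k {e's ps} => [k1 [t i]] [k2 [t' i']] /= -> k2k.
by apply: mixed_eq0; rewrite eq_sym.
Qed.

Definition tag_word k (u : seq (nat * nat)) : seq letter := map (pair k) u.

(** Within one eigenvalue the second derivatives depend on the sum of the two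
    positions only: the Hessian consists of Hankel blocks. *)
Lemma shift1 k t i t' i' s :
  G ((k, (t, i.+1)) :: (k, (t', i')) :: s) = G ((k, (t, i)) :: (k, (t', i'.+1)) :: s).
Proof.
have := compat (k, (t, i)) (k, (t', i')) s => /=.
by rewrite [in X in _ = X + _]G_swap [in X in _ = _ + X]G_swap => /addrI.
Qed.

Lemma shift k t i t' j s :
  G ((k, (t, i)) :: (k, (t', j)) :: s) = G ((k, (t, (i + j)%N)) :: (k, (t', 0%N)) :: s).
Proof.
elim: j i => [|j IHj] i; first by rewrite addn0.
by rewrite -shift1 IHj addSnnS.
Qed.

Definition weight (u : seq (nat * nat)) : nat := sumn (map snd u).
Definition zero_word (sigma : seq nat) : seq (nat * nat) := [seq (t, 0%N) | t <- sigma].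

(** All positions can be transferred to the first letter. *)
Lemma collect_weight k t i u s :
  G ((k, (t, i)) :: tag_word k u ++ s) =
  G ((k, (t, (i + weight u)%N)) :: tag_word k (zero_word (map fst u)) ++ s).
Proof.
elim: u i s => [|[t' j] u IHu] i s; first by rewrite /= addn0.
rewrite /= shift /weight /= addnA -/(weight u).
have mv e a b : G (e :: (k, (t', 0%N)) :: a ++ b) = G (e :: a ++ ((k, (t', 0%N)) :: b)).
  apply: G_perm; rewrite perm_cons.
  by apply: (permEl (perm_catCA [:: _] a b)).
by rewrite mv IHu -mv.
Qed.

(** The common value of G on the words with the blocks sigma and the total
    position w: the whole weight is carried by the first letter. *)
Definition Gam k (sigma : seq nat) (w : nat) : K :=
  if sigma is t :: sigma' then G (tag_word k ((t, w) :: zero_word sigma')) else 0.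

Lemma G_Gam k e u : G (tag_word k (e :: u)) = Gam k (map fst (e :: u)) (weight (e :: u)).
Proof.
case: e => t i; have := collect_weight k t i u [::]; rewrite !cats0.
by rewrite /= => ->; rewrite /weight.
Qed.

(** The weight can be moved to any letter, and a letter beyond the end of its
    chain stands for the zero vector. *)
Lemma Gam_eq0 k sigma w t : t \in sigma -> (top k t < w)%N -> Gam k sigma w = 0.
Proof.
case: sigma => // t0 sigma; rewrite inE => /predU1P[->|ts] wt.
  by apply: G_out; rewrite -ltnNge.
have tz : (k, (t, 0%N)) \in tag_word k (zero_word sigma) by do 2 apply: map_f.
have ps := perm_to_rem tz; rewrite -(perm_cons (k, (t0, w))) in ps.
rewrite /Gam /= (G_perm ps).
have /esym := shift k t0 0 t w (rem (k, (t, 0%N)) (tag_word k (zero_word sigma))).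
by rewrite add0n => ->; rewrite G_swap G_out // -ltnNge.
Qed.

Definition block_letters k : seq (nat * nat) :=
  [seq (t, i) | t <- iota 0 (size (ns k)), i <- index_iota 0 (top k t).+1].
Definition letters : seq letter :=
  [seq (k, e) | k <- enum 'I_p, e <- block_letters k].

Variable x : letter -> K.

Lemma sum_pure k d (Psi : seq letter -> K) :
  (forall w, has (fun e => e.1 != k) w -> Psi w = 0) ->
  \sum_(w <- words letters d) Psi w =
  \sum_(u <- words (block_letters k) d) Psi (tag_word k u).
Proof.
elim: d Psi => [|d IHd] Psi hPsi; first by rewrite !big_words0.
rewrite !big_wordsS /letters big_allpairs_dep big_enum /= (bigD1 k) //=.
rewrite [X in _ + X]big1 ?addr0 => [|k' k'k].
  apply: eq_bigr => e _; rewrite -/letters (IHd (fun w => Psi ((k, e) :: w))) //.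
  by move=> w hw; apply: hPsi; rewrite /= hw orbT.
by rewrite big1 // => e _; rewrite big1 // => w _; rewrite hPsi //= k'k.
Qed.

(** Words that mix eigenvalues contribute nothing. *)
Lemma sum_letters d (Psi : seq letter -> K) :
  (forall k e w, e.1 = k -> has (fun e' => e'.1 != k) w -> Psi (e :: w) = 0) ->
  \sum_(w <- words letters d.+1) Psi w =
  \sum_k \sum_(u <- words (block_letters k) d.+1) Psi (tag_word k u).
Proof.
move=> hPsi; rewrite big_wordsS {1}/letters big_allpairs_dep big_enum.
apply: eq_bigr => k _; rewrite big_wordsS; apply: eq_bigr => e _.
by rewrite (@sum_pure k) // => w hw; apply: hPsi hw.
Qed.

(** Sum over the words with prescribed blocks sigma and arbitrary positions. *)
Fixpoint positions_sum k (sigma : seq nat) (Psi : seq (nat * nat) -> K) : K :=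
  if sigma is t :: sigma' then
    \sum_(0 <= i < (top k t).+1) positions_sum k sigma' (fun u => Psi ((t, i) :: u))
  else Psi [::].

Lemma sum_block_words k d (Psi : seq (nat * nat) -> K) :
  \sum_(u <- words (block_letters k) d) Psi u =
  \sum_(sigma <- words (iota 0 (size (ns k))) d) positions_sum k sigma Psi.
Proof.
elim: d Psi => [|d IHd] Psi; first by rewrite !big_words0.
rewrite !big_wordsS {1}/block_letters big_allpairs_dep.
apply: eq_bigr => t _; under eq_bigr do rewrite IHd.
by rewrite exchange_big.
Qed.

Lemma positions_sum_ext k sigma (Psi Psi' : seq (nat * nat) -> K) :
  (forall u, map fst u = sigma -> Psi u = Psi' u) ->
  positions_sum k sigma Psi = positions_sum k sigma Psi'.
Proof.
elim: sigma Psi Psi' => [|t sigma IH] Psi Psi' h /=; first exact: h.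
by apply: eq_bigr => i _; apply: IH => u hu; apply: h; rewrite /= hu.
Qed.

Lemma positions_sumZ k sigma (c : K) (Psi : seq (nat * nat) -> K) :
  positions_sum k sigma (fun u => c * Psi u) = c * positions_sum k sigma Psi.
Proof.
elim: sigma Psi => [//|t sigma IH] Psi /=.
by rewrite mulr_sumr; apply: eq_bigr => i _; rewrite -IH.
Qed.

Lemma positions_sumD k sigma (Psi Psi' : seq (nat * nat) -> K) :
  positions_sum k sigma (fun u => Psi u + Psi' u) =
  positions_sum k sigma Psi + positions_sum k sigma Psi'.
Proof.
elim: sigma Psi Psi' => [//|t sigma IH] Psi Psi' /=.
by rewrite -big_split /=; apply: eq_bigr => i _; rewrite -IH.
Qed.

(** The simple solution x_0 + x_1 mu + x_2 mu^2 + ... of the subsystem whose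
    first block is t. *)
Definition block_poly k t : {poly K} :=
  \sum_(0 <= i < (top k t).+1) x (k, (t, i)) *: 'X^i.

(** Positions add up like exponents of mu, so summing a function of the total
    weight over all choices of positions reads off a coefficient of a product. *)
Lemma positions_sum_poly k N sigma (gam : nat -> K) (beta : {poly K}) :
  (forall w, (if (w <= N)%N then beta`_(N - w) else 0) = gam w) ->
  positions_sum k sigma
    (fun u => (\prod_(e <- u) x (k, e)) * gam (weight u)) =
  (beta * \prod_(t <- sigma) block_poly k t)`_N.
Proof.
elim: sigma gam beta => [|t sigma IH] gam beta hb /=.
  by rewrite !big_nil mul1r mulr1 -hb leq0n subn0.
rewrite big_cons {1}/block_poly mulrA mulr_sumr mulr_suml coef_sum.
apply: eq_bigr => i _.
rewrite -scalerAr -!scalerAl coefZ.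
(* A letter of position i shifts the weights by i and multiplies beta by mu^i. *)
rewrite -(IH (fun w => gam (i + w)%N)); last first.
  move=> w; rewrite -hb coefMXn.
  case: (leqP w N) => wN; last first.
    by have -> : (i + w <= N)%N = false by lia.
  case: (leqP (i + w) N) => iwN.
    have -> : (N - w < i)%N = false by lia.
    by congr (beta`_ _); lia.
  by have -> : (N - w < i)%N by lia.
rewrite -positions_sumZ; apply: positions_sum_ext => u _.
by rewrite big_cons -mulrA.
Qed.

Definition head_index k := nth 0%N (ns k) 0.

(** The weight w is paired with mu^(N - w), where N is the largest Jordan index, so
    that the coefficient of mu^N in a product sums over matching weights. *)
Definition Gam_poly k sigma : {poly K} :=
  \poly_(j < (head_index k).+1) Gam k sigma (head_index k - j).

Hypothesis ns_sorted : forall k, sorted geq (ns k).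

Lemma top_le_head k t : (top k t <= head_index k)%N.
Proof.
rewrite /top /head_index; case: (ltnP t (size (ns k))) => [ts|ts]; last by rewrite nth_default.
have tr : transitive geq by move=> a b c h1 h2; apply: leq_trans h2 h1.
by apply: (sorted_leq_nth tr (fun a => leqnn a) 0%N (ns_sorted k)) => //; rewrite inE //; case: (ns k) ts.
Qed.

Lemma Gam_large k t sigma w : (head_index k < w)%N -> Gam k (t :: sigma) w = 0.
Proof.
move=> hw; apply: (@Gam_eq0 _ _ _ t); rewrite ?mem_head //.
exact: leq_ltn_trans (top_le_head k t) hw.
Qed.

Lemma Gam_polyP k t sigma w :
  (if (w <= head_index k)%N then (Gam_poly k (t :: sigma))`_(head_index k - w) else 0)
  = Gam k (t :: sigma) w.
Proof.
case: leqP => hw; last by rewrite Gam_large.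
by rewrite coef_poly ltnS leq_subr subKn.
Qed.

(** Contribution of the block word sigma to the solution V of the first subsystem,
    up to the factor 1 / d!. *)
Definition word_poly k sigma := Gam_poly k sigma * \prod_(t <- sigma) block_poly k t.

Definition sub_coef k (q : {poly K}) : K := if head_index k is d.+1 then q`_d else 0.

(** Lowering the coefficient read off by one raises the weight by one, which is the
    action of the nilpotent part. *)
Lemma sub_coef_word k t sigma :
  positions_sum k (t :: sigma)
    (fun u => (\prod_(e <- u) x (k, e)) * Gam k (map fst u) (weight u).+1) =
  sub_coef k (word_poly k (t :: sigma)).
Proof.
rewrite (@positions_sum_ext _ _ _ (fun u =>
  (\prod_(e <- u) x (k, e)) * Gam k (t :: sigma) (weight u).+1)); last by move=> u ->.
rewrite /sub_coef; case hN: (head_index k) => [|N].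
  rewrite (@positions_sum_ext _ _ _ (fun u => 0 * \prod_(e <- u) x (k, e))).
    by rewrite positions_sumZ mul0r.
  by move=> u _; rewrite Gam_large ?mulr0 ?mul0r // hN.
rewrite /word_poly -(@positions_sum_poly k N (t :: sigma) (fun w => Gam k (t :: sigma) w.+1)) //.
by move=> w; have := Gam_polyP k t sigma w.+1; rewrite hN ltnS subSS.
Qed.

Lemma top_coef_word k t sigma :
  positions_sum k (t :: sigma)
    (fun u => (\prod_(e <- u) x (k, e)) * Gam k (map fst u) (weight u)) =
  (word_poly k (t :: sigma))`_(head_index k).
Proof.
rewrite (@positions_sum_ext _ _ _ (fun u =>
  (\prod_(e <- u) x (k, e)) * Gam k (t :: sigma) (weight u))); last by move=> u ->.
by apply: positions_sum_poly => w; apply: Gam_polyP.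
Qed.

Definition form_poly k d := \sum_(sigma <- words (iota 0 (size (ns k))) d) word_poly k sigma.

Lemma prod_tag_word k u : \prod_(e <- tag_word k u) x e = \prod_(e <- u) x (k, e).
Proof. by rewrite /tag_word big_map. Qed.

Lemma eq_words (T : eqType) (L : seq T) d (P Q : seq T -> K) :
  (forall e w, P (e :: w) = Q (e :: w)) ->
  \sum_(w <- words L d.+1) P w = \sum_(w <- words L d.+1) Q w.
Proof.
by move=> h; rewrite !big_wordsS; apply: eq_bigr => e _; apply: eq_bigr => w _.
Qed.

Lemma form_G d : \sum_(w <- words letters d.+1) (\prod_(e <- w) x e) * G w =
  \sum_k (form_poly k d.+1)`_(head_index k).
Proof.
rewrite sum_letters => [|k e w ek hw]; last by rewrite (mixed_word_eq0 hw) // mulr0.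
apply: eq_bigr => k _; rewrite coef_sum.
rewrite (@eq_words _ _ _ _ (fun u => (\prod_(e <- u) x (k, e)) * Gam k (map fst u) (weight u))).
  by rewrite sum_block_words; apply: eq_words => t sigma; apply: top_coef_word.
by move=> e u; rewrite G_Gam prod_tag_word.
Qed.

Lemma sub_coef_sum k (I : Type) (r : seq I) (P : I -> {poly K}) :
  sub_coef k (\sum_(i <- r) P i) = \sum_(i <- r) sub_coef k (P i).
Proof. by rewrite /sub_coef; case: head_index => [|N]; [rewrite big1|rewrite coef_sum]. Qed.

(** The head of a word splits off the eigenvalue from the nilpotent part; the
    latter is accounted for by the coefficient below the top one. *)
Lemma form_F d : \sum_(w <- words letters d.+1) (\prod_(e <- w) x e) * F w =
  \sum_k (lam k * (form_poly k d.+1)`_(head_index k) + sub_coef k (form_poly k d.+1)).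
Proof.
rewrite sum_letters => [|k [k1 [t i]] w /= ek hw]; last first.
  by rewrite F_head !(mixed_word_eq0 hw) // !mulr0 addr0 mulr0.
apply: eq_bigr => k _; rewrite coef_sum sub_coef_sum mulr_sumr -big_split /=.
rewrite (@eq_words _ _ _ _ (fun u => lam k * ((\prod_(e <- u) x (k, e)) * Gam k (map fst u) (weight u))
   + (\prod_(e <- u) x (k, e)) * Gam k (map fst u) (weight u).+1)).
  rewrite sum_block_words; apply: eq_words => t sigma.
  by rewrite positions_sumD positions_sumZ top_coef_word sub_coef_word.
move=> [t i] u; rewrite prod_tag_word /= F_head.
have := G_Gam k (t, i) u; have := G_Gam k (t, i.+1) u => /= -> ->.
by rewrite mulrDr mulrCA.
Qed.

End JordanWords.

(** * Unordered sums *)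

(** Words, listed by length in W, are grouped by a profile of the same degree. The
    unordered sum over profiles is compared with the sum over words by length. *)
Section Net.
Variables (R : realType).
Notation C := (Cplx R).
Variables (T : choiceType) (S : eqType).
Variables (W : nat -> seq (seq S)) (prof : seq S -> T) (deg : T -> nat).
Variables (good : pred (seq S)) (v : seq S -> C) (K : R).
Hypothesis deg_prof : forall d s, s \in W d -> good s -> deg (prof s) = d.
Hypothesis v_le : forall d, \sum_(s <- W d) cmod (v s) <= K * 2^-1 ^+ d.

Definition level_sum d := \sum_(s <- W d | good s) v s.
Definition initial_sum D := \sum_(0 <= d < D) level_sum d.
Definition profile_sum t := \sum_(s <- W (deg t) | good s && (prof s == t)) v s.

Lemma K_ge0 : 0 <= K.
Proof.
have := v_le 0; rewrite expr0 mulr1; apply: le_trans.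
by apply: sumr_ge0 => s _; apply: cmod_ge0.
Qed.

Lemma cmod_filter_le d (P : pred (seq S)) :
  cmod (\sum_(s <- W d | P s) v s) <= K * 2^-1 ^+ d.
Proof.
apply: le_trans (cmod_sum _ _ _) _; apply: le_trans (v_le d).
rewrite big_mkcond; apply: ler_sum => s _.
by case: (P s) => //; apply: cmod_ge0.
Qed.

Lemma tail_le (F : nat -> C) D E : (D <= E)%N ->
  (forall d, cmod (F d) <= K * 2^-1 ^+ d) ->
  cmod (\sum_(D <= d < E) F d) <= 2 * K * 2^-1 ^+ D.
Proof.
move=> DE hF; apply: le_trans (cmod_sum _ _ _) _.
suff : \sum_(D <= d < E) cmod (F d) <= 2 * K * (2^-1 ^+ D - 2^-1 ^+ E).
  move=> /le_trans; apply; rewrite ler_wpM2l ?mulr_ge0 ?K_ge0 //.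
  by rewrite gerBl exprn_ge0 // invr_ge0.
elim: E DE => [|E IHE].
  by rewrite leqn0 => /eqP->; rewrite big_geq // subrr mulr0.
rewrite leq_eqVlt => /predU1P[->|DE]; first by rewrite big_geq // subrr mulr0.
rewrite big_nat_recr //=; apply: le_trans (lerD (IHE DE) (hF E)) _.
by rewrite le_eqVlt; apply/orP; left; apply/eqP; rewrite exprS; field.
Qed.

Lemma initial_sum_limit : exists l, forall D,
  cmod (initial_sum D - l) <= 4 * K * 2^-1 ^+ D.
Proof.
have [||l hl] := @rate_limit R nat initial_sum (fun D => 2 * K * 2^-1 ^+ D).
- by exists 0%N.
- suff h D E : (D <= E)%N -> cmod (initial_sum D - initial_sum E) <= 2 * K * 2^-1 ^+ D.
    have p2 D : 0 <= 2 * K * 2^-1 ^+ D :> R.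
      by rewrite !mulr_ge0 ?K_ge0 ?exprn_ge0 ?invr_ge0.
    move=> D E; case: (leqP D E) => [/h|/ltnW/h] hh.
      by apply: le_trans hh _; rewrite lerDl p2.
    by rewrite cmodBC; apply: le_trans hh _; rewrite lerDr p2.
  move=> DE; rewrite cmodBC /initial_sum (big_cat_nat (leq0n D) DE) /= addrAC subrr add0r.
  by apply: tail_le => // d; apply: cmod_filter_le.
by exists l => D; apply: le_trans (hl D) _; rewrite le_eqVlt; apply/orP; left; apply/eqP; ring.
Qed.

Lemma partial_profile_sum (A : {fset T}) E :
  (forall t, t \in A -> (deg t < E)%N) ->
  partial_sum profile_sum A =
  \sum_(0 <= d < E) \sum_(s <- W d | good s && (prof s \in A)) v s.
Proof.
move=> hE; rewrite /partial_sum.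
transitivity (\sum_(0 <= d < E) \sum_(t : A | deg (val t) == d) profile_sum (val t)).
  rewrite [RHS](exchange_big_dep xpredT) //=; apply: eq_bigr => t _.
  rewrite (big_rem (deg (val t))) /=; last first.
    by rewrite mem_index_iota leq0n hE // (valP t).
  rewrite eqxx big1_seq ?addr0 // => d /andP[/eqP dt].
  by rewrite (rem_filter _ (iota_uniq _ _)) mem_filter /= dt eqxx.
apply: eq_bigr => d _.
under eq_bigr => t /eqP td do rewrite /profile_sum td.
rewrite (exchange_big_dep good) /=; last by move=> t s _ /andP[].
rewrite big_seq_cond [RHS]big_mkcondr /= [RHS]big_seq_cond.
apply: eq_bigr => s /andP[sW sg]; case: ifPn => sA.
  rewrite (big_pred1 [` sA]%fset) // => t; rewrite sg /=.
  apply/andP/eqP => [[_ /eqP h]|->]; first exact/val_inj/esym.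
  by rewrite /= eqxx (deg_prof sW sg).
rewrite big_pred0 // => t; rewrite sg /=; apply/negP => /andP[_ /eqP h].
by case/negP: sA; rewrite h; apply: (valP t).
Qed.

(** Once a finite set of profiles contains those of all words of length below
    D, its partial sum differs from that over these words by words of length
    at least D only. *)
Lemma profile_sum_cvg l : (forall D, cmod (initial_sum D - l) <= 4 * K * 2^-1 ^+ D) ->
  partial_sum profile_sum @ totally --> l.
Proof.
move=> hl; have FF : ProperFilter (@totally T) := @totally_filter T.
apply/cvgrPdist_le => e e0.
have [eE ce0] := Cplx_gt0 e0.
have K1 : 0 < 6 * K + 1 by have := K_ge0; lra.
have [D hD] := halfX_small (divr_gt0 ce0 K1).
have {}hD := hD D (leqnn D).
pose A0 := seq_fset tt [seq prof s | s <- flatten [seq W d | d <- iota 0 D]].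
exists A0 => // A /= A0A.
pose E := (D + \max_(t : A) (deg (val t)).+1)%N.
have hE t : t \in A -> (deg t < E)%N.
  move=> tA; rewrite /E; apply: leq_trans (leq_addl _ _).
  exact: (@leq_bigmax _ (fun t : A => (deg (val t)).+1) [` tA]%fset).
rewrite (partial_profile_sum hE) (big_cat_nat (leq0n D) (leq_addr _ D)) /=.
have -> : \sum_(0 <= d < D) \sum_(s <- W d | good s && (prof s \in A)) v s = initial_sum D.
  rewrite /initial_sum big_nat [RHS]big_nat; apply: eq_bigr => d /andP[_ dD].
  rewrite /level_sum big_seq_cond [RHS]big_seq_cond; apply: eq_bigl => s.
  case sW: (s \in W d) => //=; case: (good s) => //=.
  apply: (fsubsetP A0A); rewrite seq_fsetE; apply: map_f.
  apply/flattenP; exists (W d) => //; apply/mapP; exists d => //.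
  by rewrite mem_iota.
rewrite cmodE eE rc_le.
have t1 := @tail_le (fun d => \sum_(s <- W d | good s && (prof s \in A)) v s) D E
  (leq_addr _ _) (fun d => cmod_filter_le d _).
rewrite cmodBC addrAC; apply: le_trans (cmodD _ _) _.
have h1 := hl D; move: t1 h1.
set x := cmod (\sum_(D <= d < E) _); set y := cmod (_ - l) => hx hy.
rewrite ltr_pdivlMr // in hD.
have : 0 <= 2^-1 ^+ D :> R by rewrite exprn_ge0 // invr_ge0.
lra.
Qed.

End Net.

(** * Subsystems and simple solutions *)

Section StarSeries.
Variable R : realType.
Notation C := (Cplx R).
Variable ns : seq nat.
Notation dim := (\sum_(t < size ns) (nth 0%N ns t).+1)%N.
Notation top t := (nth 0%N ns t).
Notation N := (nth 0%N ns 0).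
Hypothesis ns_sorted : sorted geq ns.
Hypothesis ns_gt0 : (0 < size ns)%N.
Implicit Types (z : 'cV[C]_dim) (sigma : seq nat).

Lemma top_mono s t : (s <= t)%N -> (top t <= top s)%N.
Proof.
move=> st; case: (ltnP t (size ns)) => [ts|ts]; last by rewrite nth_default.
have tr : transitive geq by move=> a b c h1 h2; apply: leq_trans h2 h1.
apply: (sorted_leq_nth tr (fun a => leqnn a) 0%N ns_sorted) => //; rewrite inE //.
exact: leq_ltn_trans ts.
Qed.

(** Coordinate z_(t, i), extended by zero outside the Jordan structure. *)
Definition block_coord z (t i : nat) : C :=
  if insub t is Some t' then
    if insub i is Some i' then submxcol z (t' : 'I_(size ns)) i' 0 else 0
  else 0.

(** The standard simple solution of the subsystem of index t. *)
Definition yblock t z : {poly C} := \sum_(0 <= i < (top t).+1) block_coord z t i *: 'X^i.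

Lemma coef_yblock t z j : (yblock t z)`_j = if (j <= top t)%N then block_coord z t j else 0.
Proof.
rewrite /yblock coef_sum; under eq_bigr do rewrite coefZ coefXn.
case: leqP => jt.
  rewrite (bigD1_seq j) ?mem_index_iota ?iota_uniq //= eqxx mulr1.
  by rewrite big1 ?addr0 // => i ij; rewrite eq_sym (negPf ij) mulr0.
rewrite big1_seq // => i /andP[_]; rewrite mem_index_iota ltnS => /= it.
by rewrite gtn_eqF ?mulr0 // (leq_ltn_trans it).
Qed.

Lemma block_coord_le z t i : cmod (block_coord z t i) <= l1norm z.
Proof.
have z0 : 0 <= l1norm z by apply: sumr_ge0 => ? _; apply: cmod_ge0.
rewrite /block_coord; case: insubP => [t' _ _|_]; last by rewrite cmod0.
case: insubP => [i' _ _|_]; last by rewrite cmod0.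
by rewrite mxE; apply: cmod_le_l1norm.
Qed.

Lemma block_coord_scalar t i : scalar (fun z => block_coord z t i).
Proof.
move=> c z w; rewrite /block_coord; case: insubP => [t' _ _|_]; last by rewrite mulr0 addr0.
case: insubP => [i' _ _|_]; last by rewrite mulr0 addr0.
by rewrite !mxE.
Qed.

Lemma yblock_scalar t j : scalar (fun z => (yblock t z)`_j).
Proof.
move=> c z w; rewrite !coef_yblock; case: ifP => _; last by rewrite mulr0 addr0.
exact: block_coord_scalar.
Qed.

Lemma yblock_diff t j z : differentiable (fun z => (yblock t z)`_j) z.
Proof.
have [jt|jt] := boolP (j <= top t)%N; last first.
  have -> : (fun z => (yblock t z)`_j) = (fun=> 0).
    by apply/funext => w; rewrite coef_yblock (negPf jt).
  exact: differentiable_cst.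
have -> : (fun z => (yblock t z)`_j) = (fun z => block_coord z t j).
  by apply/funext => w; rewrite coef_yblock jt.
rewrite /block_coord; case: insubP => [t' _ _|_]; last exact: differentiable_cst.
case: insubP => [i' _ _|_]; last exact: differentiable_cst.
have -> : (fun z => submxcol z t' i' 0) = (fun z : 'cV[C]_dim => z (tagnat.Rank t' i') 0).
  by apply/funext => w; rewrite mxE.
exact: differentiable_coord.
Qed.

Lemma derive_scalar (f : 'cV[C]_dim -> C) v z : scalar f -> 'D_v f z = f v.
Proof.
move=> fl; apply: lim_near_cst => //.
near=> h; have h0 : h != 0 by near: h; apply: nbhs_dnbhs_neq.
rewrite /= fl addrK; rewrite /GRing.scale /= mulKf //.
Unshelve. all: by end_near.
Qed.

End StarSeries.

Lemma submxcol_mxdiag_mul (K : pzSemiRingType) p (p_ : 'I_p -> nat) m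
    (D : forall t, 'M[K]_(p_ t)) (w : 'M[K]_(\sum_t p_ t, m)) t :
  submxcol (\mxdiag_s D s *m w) t = D t *m submxcol w t.
Proof. by rewrite -{1}(submxcolK w) mul_mxdiag_mxcol mxcolK. Qed.

Lemma nilU_mul (K : numClosedFieldType) k m (v : 'M[K]_(k.+1, m)) i j :
  (nilU K k *m v) i j = if insub i.+1 is Some i' then v i' j else 0.
Proof.
rewrite mxE; case: insubP => [i' _ ii'|].
  rewrite (bigD1 i') //= big1 ?addr0 => [|l li']; first by rewrite mxE ii' eqxx mul1r.
  by rewrite mxE -ii' val_eqE (negPf li') mul0r.
rewrite -leqNgt => ki; rewrite big1 // => l _; rewrite mxE.
by rewrite ltn_eqF ?mul0r // (leq_trans (ltn_ord l)).
Qed.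

Lemma dvdp_Xn (K : fieldType) n (q : {poly K}) :
  (forall j, (j < n)%N -> q`_j = 0) -> 'X^n %| q.
Proof.
move=> h; rewrite -(poly_take_drop n q).
have -> : take_poly n q = 0.
  by apply/polyP => j; rewrite coef_take_poly coef0; case: ifP => // /h.
by rewrite add0r dvdp_mull.
Qed.

Section SimpleSolutions.
Variable R : realType.
Notation C := (Cplx R).
Variable ns : seq nat.
Notation dim := (\sum_(t < size ns) (nth 0%N ns t).+1)%N.
Notation top t := (nth 0%N ns t).

Lemma block_coord_delta (t : 'I_(size ns)) (i : 'I_(top t).+1) s j :
  block_coord (delta_mx (tagnat.Rank t i) 0 : 'cV[C]_dim) s j =
  ((s == t :> nat) && (j == i :> nat))%:R.
Proof.
rewrite /block_coord; case: insubP => [s' _ <-|]; last first.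
  case: eqP => // ->; by rewrite ltn_ord.
case: insubP => [j' _ <-|].
  rewrite !mxE eqxx andbT -val_eqE tagnat.eq_Rank; congr (_ && _)%:R.
rewrite val_eqE; case: (eqVneq s' t) => //= ->; case: eqP => // ->.
by rewrite ltn_ord.
Qed.

(** Coefficientwise in mu, the subsystem asks that U maps the gradient of the
    coefficient of mu^j to that of mu^(j - 1). In the block s these gradients are
    consecutive vectors of the standard basis, and they vanish in other blocks. *)
Lemma yblock_simple s : (s < size ns)%N -> simple_solution s (@yblock R ns s).
Proof.
move=> hs; split; last by move=> j; apply: yblock_scalar.
split.
- move=> x; apply/leq_sizeP => j hj; rewrite coef_yblock.
  by rewrite leqNgt hj.
- move=> x y xy; apply/polyP => j; rewrite !coef_yblock; case: ifP => // _.
  rewrite /block_coord; case: insubP => [t _ ts|//]; case: insubP => [i _ _|//].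
  by rewrite xy // ts.
- by move=> j x; apply: yblock_diff.
move=> x t i st; set V := @yblock R ns s.
pose w j : 'cV[C]_dim := \col_l (block_coord (delta_mx l 0 : 'cV[C]_dim) s j).
have wE j t' : submxcol (w j) t' = \col_l ((s == t' :> nat) && (j == l :> nat))%:R.
  by apply/matrixP => l l0; rewrite !mxE block_coord_delta.
have gE l j : ((mugrad (top s) V x) l 0)`_j = if (j <= top s)%N then w j l 0 else 0.
  rewrite mxE coef_poly ltnS; case: ifP => // js.
  rewrite derive_scalar; last exact: yblock_scalar.
  by rewrite coef_yblock js mxE.
apply: dvdp_Xn => j; rewrite ltnS => js.
have -> : (submxcol ((map_mx polyC (- nilblocks C ns) + 'X%:M) *m mugrad (top s) V x) t i 0)`_j =
  - (nilblocks C ns *m w j) (tagnat.Rank t i) 0 +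
    (if j is j'.+1 then w j' (tagnat.Rank t i) 0 else 0).
  rewrite mxE mulmxDl mxE coefD; congr (_ + _).
    rewrite mxE coef_sum mxE -sumrN; apply: eq_bigr => l _.
    have -> : map_mx polyC (- nilblocks C ns) (tagnat.Rank t i) l =
      (- nilblocks C ns (tagnat.Rank t i) l)%:P by rewrite mxE [X in X%:P]mxE.
    by rewrite coefCM gE js mulNr.
  rewrite mul_scalar_mx mxE coefXM.
  by case: j js => // j' js; rewrite gE (ltnW js).
have -> : (nilblocks C ns *m w j) (tagnat.Rank t i) 0 =
  submxcol (nilblocks C ns *m w j) t i 0 by rewrite [RHS]mxE.
rewrite submxcol_mxdiag_mul nilU_mul.
have -> : (if j is j'.+1 then w j' (tagnat.Rank t i) 0 else 0) =
  (if j is j'.+1 then submxcol (w j') t i 0 else 0) by case: j js => // j' _; rewrite [RHS]mxE.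
case: insubP => [i' _ ii'|].
  rewrite wE mxE ii'; case: j js => [|j'] js; first by rewrite andbF oppr0 addr0.
  by rewrite wE mxE eqSS addNr.
rewrite -leqNgt ltnS => ti; case: j js => [|j'] js; first by rewrite oppr0 addr0.
rewrite wE mxE oppr0 add0r; case: (eqVneq (s : nat) t) => //= est.
by rewrite ltn_eqF // (leq_trans js) // est.
Qed.

Lemma poly_constant s (b : {poly C}) : (size b <= (top s).+1)%N ->
  @constant_solution C ns s b.
Proof.
move=> sb; split => //.
move=> x t i st.
have -> : mugrad (top s) (fun=> b) x = 0 :> 'cV[{poly C}]_dim.
  apply/matrixP => l l0; rewrite !mxE; apply/polyP => j; rewrite coef_poly coef0.
  case: ifP => // _; exact: derive_cst.
by rewrite mulmx0 submxcol0 mxE dvdp0.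
Qed.

End SimpleSolutions.

(** * Series of star-powers *)

Lemma mul_modXn (K : fieldType) a b (q : {poly K}) :
  'X^a * (q %% 'X^b) = ('X^a * q) %% 'X^(a + b).
Proof.
rewrite -!Pdiv.IdomainMonic.take_poly_modp; apply/polyP => j.
rewrite coefXnM !coef_take_poly coefXnM.
by case: ltnP => ja; [rewrite if_same|rewrite ltn_subLR].
Qed.

(** The remainders taken at the intermediate stages are absorbed by the last one,
    since a remainder modulo mu^b times mu^a is a remainder modulo mu^(a + b). *)
Lemma starpow_fromE (K : numClosedFieldType) ns (y : nat -> {poly K}) I s l :
  sorted geq ns ->
  starpow_from ns y I s l =
  ('X^(nth 0%N ns s - nth 0%N ns (s + l)) *
     \prod_(0 <= i < l.+1) y (s + i)%N ^+ nth 0%N I (s + i))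
  %% 'X^((nth 0%N ns s).+1).
Proof.
move=> ns_sorted; elim: l s => [|l IHl] s.
  by rewrite /= big_nat1 addn0 subnn expr0 mul1r.
rewrite /= IHl -mulrA mul_modXn.
have h1 : (nth 0%N ns s.+1 <= nth 0%N ns s)%N by apply: top_mono.
have h2 : (nth 0%N ns (s.+1 + l) <= nth 0%N ns s.+1)%N.
  by apply: top_mono => //; apply: leq_addr.
have -> : (nth 0%N ns s - nth 0%N ns s.+1 + (nth 0%N ns s.+1).+1 = (nth 0%N ns s).+1)%N.
  by rewrite addnS subnK.
rewrite modp_mul; congr (_ %% _).
rewrite [X in _ * X]mulrA -exprD [in RHS]big_nat_recl // addn0.
have -> : (nth 0%N ns s - nth 0%N ns s.+1 + (nth 0%N ns s.+1 - nth 0%N ns (s.+1 + l)) =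
   nth 0%N ns s - nth 0%N ns (s + l.+1))%N.
  by rewrite -addSnnS; lia.
rewrite mulrCA; congr (_ * (_ * _)).
by apply: eq_bigr => i _; rewrite addSnnS.
Qed.

Lemma prod_count (K : comNzRingType) (y : nat -> K) q sigma :
  all (fun t => t <= q)%N sigma ->
  \prod_(t <- sigma) y t = \prod_(0 <= i < q.+1) y i ^+ count_mem i sigma.
Proof.
elim: sigma => [_|t sigma IH /= /andP[tq hs]].
  by rewrite big_nil big1.
rewrite big_cons IH //.
under [RHS]eq_bigr do rewrite exprD; rewrite big_split /=; congr (_ * _).
rewrite (bigD1_seq t) ?mem_index_iota ?iota_uniq //= eqxx expr1.
by rewrite big1 ?mulr1 // => i it; rewrite eq_sym (negPf it) expr0.
Qed.

Lemma sumn_count q sigma : all (fun t => t <= q)%N sigma ->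
  sumn [seq count_mem i sigma | i <- iota 0 q.+1] = size sigma.
Proof.
rewrite sumnE big_map -[iota 0 q.+1]/(index_iota 0 q.+1).
elim: sigma => [_|t sigma IH].
  by rewrite big1.
rewrite [all _ _]/= => /andP[tq hs] /=; rewrite big_split /= IH //.
rewrite -[RHS]add1n; congr addn.
rewrite (bigD1_seq t) ?mem_index_iota ?iota_uniq //= eqxx.
by rewrite big1 // => i it; rewrite eq_sym (negPf it).
Qed.

(** The function Gam gives the coefficient attached to a block word and a weight.
    A word whose last block (the one of largest index) is q only has weights up to
    the Jordan index of q; its contribution is therefore divisible by the power of
    mu that embeds the subsystem of index q into the first one. It belongs to a
    series of star-powers in the first q + 1 simple solutions. *)
Section StarRepresentation.
Variable R : realType.
Notation C := (Cplx R).
Variable ns : seq nat.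
Notation dim := (\sum_(t < size ns) (nth 0%N ns t).+1)%N.
Notation top t := (nth 0%N ns t).
Notation N := (nth 0%N ns 0).
Hypothesis ns_sorted : sorted geq ns.
Hypothesis ns_gt0 : (0 < size ns)%N.
Implicit Types (z : 'cV[C]_dim) (sigma : seq nat).

Variables (Gam : seq nat -> nat -> C) (K0 c : R).
Hypothesis Gam0 : forall w, (0 < w)%N -> Gam [::] w = 0.
Hypothesis Gam_out : forall sigma w t, t \in sigma -> (top t < w)%N -> Gam sigma w = 0.
Hypothesis c_gt0 : 0 < c.
Hypothesis Gam_le : forall sigma w,
  cmod (Gam sigma w) <= K0 * c ^+ size sigma * ((size sigma)`!)%:R.

Definition Gpoly sigma : {poly C} := \poly_(j < N.+1) Gam sigma (N - j).
Definition block_words d := words (iota 0 (size ns)) d.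
Definition word_coef (j : nat) z sigma : C :=
  if (j <= N)%N then
    ((size sigma)`!)%:R^-1 * (Gpoly sigma * \prod_(t <- sigma) yblock t z)`_j
  else 0.
Definition last_block sigma := (\max_(t <- sigma) t)%N.
(** Multiplicities of the blocks 0, ..., q: the exponent of the star-power. *)
Definition profile q sigma : q.+1.-tuple nat :=
  map_tuple (fun i => count_mem i sigma) (iota_tuple q.+1 0).

Lemma Gam_last_block sigma w : (top (last_block sigma) < w)%N -> Gam sigma w = 0.
Proof.
case: sigma => [|t sigma].
  by rewrite /last_block big_nil => h; apply: Gam0; apply: leq_trans h.
move=> h; apply: (@Gam_out _ _ (last_block (t :: sigma))) => //.
rewrite /last_block; elim: sigma t {h} => [|s sigma IH] t.
  by rewrite big_seq1 mem_head.
rewrite big_cons; case: (leqP t (\max_(j <- s :: sigma) j)) => h.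
  by rewrite in_cons IH orbT.
by rewrite mem_head.
Qed.

Lemma last_block_all q sigma : last_block sigma = q -> all (fun t => t <= q)%N sigma.
Proof.
move=> <-; apply/allP => t ts; rewrite /last_block.
by rewrite (big_rem t) //= leq_maxl.
Qed.

Let rate z : R := (size ns)%:R * (c * ((N.+1)%:R * l1norm z)).

Lemma coef_range_le (a : nat -> C) (L B : R) m (q : {poly C}) j : 0 <= L -> 0 <= B ->
  (forall i, (i < m)%N -> cmod (a i) <= L) -> (forall i, cmod q`_i <= B) ->
  cmod ((\sum_(0 <= i < m) a i *: 'X^i) * q)`_j <= m%:R * L * B.
Proof.
move=> L0 B0 aL qB; rewrite mulr_suml coef_sum.
apply: le_trans (cmod_sum _ _ _) _.
rewrite [leRHS](_ : _ = \sum_(0 <= i < m) L * B); last first.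
  by rewrite sumr_const_nat subn0 -mulrA mulr_natl.
rewrite big_nat [leRHS]big_nat; apply: ler_sum => i /andP[_ im].
rewrite -scalerAl coefZ coefXnM cmodM; case: ifP => _.
  by rewrite cmod0 mulr0 mulr_ge0.
by rewrite ler_pM ?cmod_ge0 // aL.
Qed.

Lemma l1norm_ge0 z : 0 <= l1norm z.
Proof. by apply: sumr_ge0 => i _; apply: cmod_ge0. Qed.

Lemma top_le t : (top t <= N)%N.
Proof. exact: (top_mono ns_sorted). Qed.

Lemma prod_yblock_le z sigma j :
  cmod (\prod_(t <- sigma) yblock t z)`_j <= ((N.+1)%:R * l1norm z) ^+ size sigma.
Proof.
have L0 := l1norm_ge0 z.
elim: sigma j => [|t sigma IH] j.
  by rewrite big_nil coef1 expr0 cmod_nat lern1; case: eqP.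
rewrite big_cons [size _]/= exprS.
have B0 : 0 <= ((N.+1)%:R * l1norm z) ^+ size sigma by rewrite exprn_ge0 // mulr_ge0.
apply: le_trans (@coef_range_le (block_coord z t) (l1norm z) _ _ _ j L0 B0 _ IH) _.
  by move=> i _; apply: block_coord_le.
by rewrite ler_wpM2r // ler_wpM2r // ler_nat ltnS top_le.
Qed.

Lemma word_coef_le j z sigma :
  cmod (word_coef j z sigma) <=
    K0 * (N.+1)%:R * (c * ((N.+1)%:R * l1norm z)) ^+ size sigma.
Proof.
have K00 : 0 <= K0.
  by have := Gam_le [::] 0; rewrite expr0 fact0 !mulr1; apply: le_trans; apply: cmod_ge0.
have L0 : 0 <= (N.+1)%:R * l1norm z by rewrite mulr_ge0 // l1norm_ge0.
have cL0 : 0 <= c * ((N.+1)%:R * l1norm z) by rewrite mulr_ge0 // ltW.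
rewrite /word_coef; case: ifP => _; last first.
  by rewrite cmod0 !mulr_ge0 // exprn_ge0.
have f0 : 0 < ((size sigma)`!)%:R :> R by rewrite ltr0n fact_gt0.
rewrite cmodM cmodV cmod_nat ler_pdivrMl //.
rewrite /Gpoly poly_def -(big_mkord xpredT (fun i => Gam sigma (N - i) *: 'X^i)).
have G0 : 0 <= K0 * c ^+ size sigma * ((size sigma)`!)%:R.
  by rewrite !mulr_ge0 // exprn_ge0 // ltW.
apply: le_trans (@coef_range_le (fun i => Gam sigma (N - i)) _ _ _ _ j G0
  (exprn_ge0 (size sigma) L0) (fun i _ => Gam_le sigma (N - i)) (prod_yblock_le z sigma)) _.
by rewrite le_eqVlt; apply/orP; left; apply/eqP; rewrite !exprMn; ring.
Qed.

Let bound : R := K0 * (N.+1)%:R.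

Lemma word_coef_sum_le j z : rate z <= 2^-1 -> forall d,
  \sum_(sigma <- block_words d) cmod (word_coef j z sigma) <= bound * 2^-1 ^+ d.
Proof.
have K00 : 0 <= K0.
  by have := Gam_le [::] 0; rewrite expr0 fact0 !mulr1; apply: le_trans; apply: cmod_ge0.
have L0 : 0 <= (N.+1)%:R * l1norm z by rewrite mulr_ge0 // l1norm_ge0.
have cL0 : 0 <= c * ((N.+1)%:R * l1norm z) by rewrite mulr_ge0 // ltW.
move=> hr d.
apply: (@le_trans _ _ (\sum_(sigma <- block_words d)
   (bound * (c * ((N.+1)%:R * l1norm z)) ^+ d))).
  rewrite big_seq [leRHS]big_seq; apply: ler_sum => sigma.
  rewrite mem_words => /andP[/eqP <- _]; exact: word_coef_le.
rewrite big_const_seq count_predT size_words size_iota iter_addr_0 -[leLHS]mulr_natr -(mulrA bound).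
rewrite ler_wpM2l ?mulr_ge0 // mulrC natrX -exprMn.
by rewrite lerXn2r ?nnegrE ?invr_ge0 //; apply: (mulr_ge0 _ cL0).
Qed.

Let good q := [pred sigma | last_block sigma == q].

Lemma profile_deg q d sigma : sigma \in block_words d -> good q sigma ->
  sumn (profile q sigma) = d.
Proof.
rewrite mem_words => /andP[/eqP sd _] /eqP/last_block_all/sumn_count.
by rewrite -sd => <-.
Qed.

Definition word_limit q j z : C := xget 0 [set L : C | forall D,
  cmod (initial_sum block_words (good q) (word_coef j z) D - L)
    <= 4 * bound * 2^-1 ^+ D].

Lemma word_limitP q j z D : rate z <= 2^-1 ->
  cmod (initial_sum block_words (good q) (word_coef j z) D - word_limit q j z)
    <= 4 * bound * 2^-1 ^+ D.
Proof.
move=> hr; have [L hL] := initial_sum_limit (good q) (word_coef_sum_le j hr).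
exact: (@xgetPex _ 0 [set L : C | forall D,
  cmod (initial_sum block_words (good q) (word_coef j z) D - L)
    <= 4 * bound * 2^-1 ^+ D] (ex_intro _ L hL)).
Qed.

(** The sum of the series of star-powers in the first q + 1 simple solutions; the
    limits exist near the origin. *)
Definition star_part q z : {poly C} := \poly_(j < N.+1) word_limit q j z.

Definition star_coef q (I : q.+1.-tuple nat) : {poly C} :=
  \sum_(sigma <- block_words (sumn I) | good q sigma && (profile q sigma == I))
     ((size sigma)`!)%:R^-1 *: \poly_(j < (top q).+1) Gam sigma (top q - j).

(** A term of the series of star-powers collects the contributions of all words
    with a given profile. *)
Lemma star_term q (I : q.+1.-tuple nat) z j :
  (starmul N (star_coef I) (starpow ns (fun s => yblock s z) I))`_j =
  profile_sum block_words (profile q) (fun I => sumn I) (good q) (word_coef j z) I.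
Proof.
rewrite /starmul /starpow starpow_fromE // modp_mul.
rewrite -Pdiv.IdomainMonic.take_poly_modp coef_take_poly ltnS add0n.
rewrite /profile_sum /word_coef; case: leqP => jN; last by rewrite big1.
rewrite /star_coef mulr_suml coef_sum; apply: eq_bigr => sigma /andP[sq /eqP sI].
rewrite -scalerAl coefZ; congr (_ * _); rewrite mulrA.
have all_q := last_block_all (eqP sq).
have -> : \prod_(0 <= i < q.+1) yblock (0 + i) z ^+ nth 0%N I (0 + i) =
    \prod_(t <- sigma) yblock t z.
  rewrite (prod_count (fun t => yblock t z) all_q) big_nat [RHS]big_nat.
  apply: eq_bigr => i /andP[_ iq]; rewrite -sI add0n.
  by rewrite (nth_map 0%N) ?size_iota // nth_iota.
suff -> : \poly_(j < (top q).+1) Gam sigma (top q - j) * 'X^(N - top q) = Gpoly sigma.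
  by [].
apply/polyP => i; rewrite coefMXn !coef_poly.
have qN := top_le q.
case: (ltnP i (N - top q)) => h1.
  case: (ltnP i N.+1) => // h2; apply/esym/Gam_last_block.
  by rewrite (eqP sq); lia.
have -> : (i - (N - top q) < (top q).+1)%N = (i < N.+1)%N by lia.
by case: ifP => // h2; congr (Gam _ _); lia.
Qed.

Lemma star_part_series q : (q < size ns)%N -> star_series (star_part q).
Proof.
move=> qs; exists q.+1, (fun s => @yblock R ns s), (@star_coef q); split => //.
- move=> s sq; apply: yblock_simple; exact: leq_ltn_trans qs.
- move=> I; apply: poly_constant; rewrite /star_coef.
  apply: (leq_trans (size_sum _ _ _)); apply/bigmax_leqP_seq => sigma _ _.
  apply: (leq_trans (size_scale_leq _ _)); apply: (leq_trans (size_poly _ _)).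
  by rewrite ltnS top_le.
have M0 : 0 < 1 + (size ns)%:R * (c * (N.+1)%:R) :> R.
  by rewrite ltr_pwDl // !mulr_ge0 // ltW.
apply/nbhs_l1norm; exists (2^-1 / (1 + (size ns)%:R * (c * (N.+1)%:R))).
  by rewrite divr_gt0 ?invr_gt0.
move=> z; rewrite subr0 ltr_pdivlMr // => hz j.
have hr : rate z <= 2^-1.
  apply: ltW; apply: le_lt_trans hz.
  have -> : rate z = l1norm z * ((size ns)%:R * (c * N.+1%:R)) by rewrite /rate; ring.
  by rewrite ler_wpM2l ?l1norm_ge0 // lerDr.
rewrite (_ : (fun I => _) = profile_sum block_words (profile q) (fun I => sumn I) (good q) (word_coef j z)); last first.
  by apply/funext => I; apply: star_term.
apply: (@profile_sum_cvg _ _ _ _ _ _ _ _ bound).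
- by move=> d s sW sg; apply: profile_deg sW sg.
- exact: word_coef_sum_le.
move=> D; rewrite coef_poly ltnS; case: (leqP j N) => jN.
  exact: word_limitP.
rewrite subr0 /initial_sum big1 ?cmod0; last first.
  by move=> d _; rewrite /level_sum big1 // => s _; rewrite /word_coef leqNgt jN.
have := le_trans (cmod_ge0 _) (word_coef_le 0 z [::]).
rewrite expr0 mulr1 -/bound => b0; apply: mulr_ge0; first exact: mulr_ge0.
by rewrite exprn_ge0 // invr_ge0.
Qed.

Lemma last_block_lt d sigma : sigma \in block_words d -> (last_block sigma < size ns)%N.
Proof.
rewrite mem_words => /andP[_ /allP hs].
have : (last_block sigma <= (size ns).-1)%N.
  rewrite /last_block; apply/bigmax_leqP_seq => t /hs; rewrite inE mem_iota; lia.
lia.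
Qed.

(** Grouping the words by their last block and then by their profile turns the
    expansion over words into a finite sum of series of star-powers. The ball
    is so small that the contributions of the words of length d sum up to a
    multiple of 2^-d. *)
Lemma star_representation : exists V : 'cV[C]_dim -> {poly C},
  sum_of_star_series V /\ exists2 r : R, 0 < r & exists K1 : R,
    forall z, l1norm z < r -> forall j, (j <= N)%N -> forall D,
    cmod (\sum_(0 <= d < D) (d`!)%:R^-1 *
        (\sum_(sigma <- block_words d) Gpoly sigma * \prod_(t <- sigma) yblock t z)`_j
      - (V z)`_j) <= K1 * 2^-1 ^+ D.
Proof.
exists (fun z => \sum_(q < size ns) star_part q z); split.
  exists (size ns), (fun q : 'I_(size ns) => star_part q); split => // q.
  exact: star_part_series.
have M0 : 0 < 1 + (size ns)%:R * (c * (N.+1)%:R) :> R.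
  by rewrite ltr_pwDl // !mulr_ge0 // ltW.
exists (2^-1 / (1 + (size ns)%:R * (c * (N.+1)%:R))); first by rewrite divr_gt0 ?invr_gt0.
exists ((size ns)%:R * (4 * bound)) => z; rewrite ltr_pdivlMr // => hz j jN D.
have hr : rate z <= 2^-1.
  apply: ltW; apply: le_lt_trans hz.
  have -> : rate z = l1norm z * ((size ns)%:R * (c * N.+1%:R)) by rewrite /rate; ring.
  by rewrite ler_wpM2l ?l1norm_ge0 // lerDr.
have -> : \sum_(0 <= d < D) (d`!)%:R^-1 *
        (\sum_(sigma <- block_words d) Gpoly sigma * \prod_(t <- sigma) yblock t z)`_j
   = \sum_(q < size ns) initial_sum block_words (good q) (word_coef j z) D.
  rewrite /initial_sum exchange_big /=; apply: eq_bigr => d _.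
  rewrite coef_sum mulr_sumr /level_sum (exchange_big_dep xpredT) //=.
  rewrite big_seq [RHS]big_seq; apply: eq_bigr => sigma sd.
  rewrite (big_pred1 (Ordinal (last_block_lt sd))) /=; last first.
    by move=> q; apply/eqP/eqP => [h|-> //]; apply: val_inj; rewrite /= h.
  by rewrite /word_coef jN; move: sd; rewrite mem_words => /andP[/eqP ->].
rewrite coef_sum -sumrB; apply: le_trans (cmod_sum _ _ _) _.
rewrite -mulrA [leRHS](_ : _ = \sum_(q < size ns) 4 * bound * 2^-1 ^+ D); last first.
  by rewrite sumr_const card_ord mulr_natl.
apply: ler_sum => q _; rewrite coef_poly ltnS jN.
exact: word_limitP.
Qed.

End StarRepresentation.

(** * Jordan chains *)

Section JordanChains.
Variables (K : closedFieldType) (vT : vectType K) (phi : 'End(vT)).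
Implicit Types (U W : {vspace vT}) (a : K) (v : vT).

Definition shifted a : 'End(vT) := (phi - a *: \1)%VF.

Lemma shiftedE a v : shifted a v = phi v - a *: v.
Proof. by rewrite /shifted add_lfunE opp_lfunE scale_lfunE id_lfunE. Qed.

(** The matrix of the restriction of phi to U has an eigenvector. *)
Lemma stable_eigenvector U : (phi @: U <= U)%VS -> (0 < \dim U)%N ->
  exists a v, [/\ v \in U, v != 0 & shifted a v = 0].
Proof.
move=> stU dU; pose b := vbasis U.
pose A : 'M[K]_(\dim U) := \matrix_(i, j) coord b j (phi b`_i).
have bU (i : 'I_(\dim U)) : b`_i \in U by rewrite vbasis_mem // mem_nth // size_tuple.
have phib (i : 'I_(\dim U)) : phi b`_i = \sum_j A i j *: b`_j.
  have pU : phi b`_i \in U by apply: (subvP stU); apply: memv_img.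
  by rewrite {1}(coord_vbasis pU); apply: eq_bigr => j _; rewrite mxE.
have [|a] := closed_rootP (char_poly A) _.
  by rewrite size_char_poly eqSS -lt0n.
rewrite -eigenvalue_root_char => /eigenvalueP[c cA c0].
pose v := \sum_i c 0 i *: b`_i.
exists a, v; split.
- by apply: memv_suml => i _; apply: memvZ.
- apply: contra c0 => /eqP v0; apply/eqP/rowP => i; rewrite mxE.
  have /freeP := basis_free (vbasisP U); apply; exact: v0.
rewrite shiftedE; apply/eqP; rewrite subr_eq0; apply/eqP.
rewrite /v linear_sum scaler_sumr.
under eq_bigr => i _ do rewrite linearZ /= phib scaler_sumr.
rewrite exchange_big /=; apply: eq_bigr => j _.
under eq_bigr => i _ do rewrite scalerA.
rewrite -scaler_suml scalerA; congr (_ *: _).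
by have := congr1 (fun x : 'rV_(\dim U) => x 0 j) cA; rewrite !mxE.
Qed.

(** A triple of an eigenvalue, a first vector, and the index of the last vector. *)
Definition jchain := (K * vT * nat)%type.
Definition chain_vec (c : jchain) i := iter i (shifted c.1.1) c.1.2.
Definition chain_vecs (c : jchain) := [seq chain_vec c i | i <- iota 0 c.2.+1].
Definition all_vecs (cs : seq jchain) := flatten [seq chain_vecs c | c <- cs].
Definition ends (c : jchain) := chain_vec c c.2.+1 == 0.

Lemma mem_chain_vec c i : (i <= c.2)%N -> chain_vec c i \in chain_vecs c.
Proof. by move=> ic; apply: map_f; rewrite mem_iota. Qed.

Lemma mem_all_vecs cs c i : c \in cs -> (i <= c.2)%N -> chain_vec c i \in all_vecs cs.
Proof.
move=> ccs ic; apply/flattenP; exists (chain_vecs c); last exact: mem_chain_vec.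
exact: map_f.
Qed.

Lemma all_vecsP cs v : reflect (exists c i, [/\ c \in cs, (i <= c.2)%N & v = chain_vec c i])
  (v \in all_vecs cs).
Proof.
apply: (iffP flattenP) => [[s /mapP[c ccs ->]]|[c [i [ccs ic ->]]]].
  case/(mapP (T1 := nat) (T2 := vT)) => i; rewrite mem_iota => ic ->.
  by exists c, i.
by exists (chain_vecs c); [apply: map_f|apply: mem_chain_vec].
Qed.

Lemma chain_vecS c i : chain_vec c i.+1 = shifted c.1.1 (chain_vec c i).
Proof. by []. Qed.

Lemma shifted_stable a U : (phi @: U <= U)%VS -> (shifted a @: U <= U)%VS.
Proof.
move=> /subvP stU; apply/subvP => _ /memv_imgP[v vU ->]; rewrite shiftedE.
by rewrite memvB ?memvZ // stU // memv_img.
Qed.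

Lemma phi_shifted a v : phi (shifted a v) = shifted a (phi v).
Proof. by rewrite !shiftedE linearB linearZ. Qed.

Lemma chain_mem U c i : (phi @: U <= U)%VS -> c.1.2 \in U -> chain_vec c i \in U.
Proof.
move=> /(shifted_stable c.1.1)/subvP stU cU; elim: i => // i IHi.
by rewrite chain_vecS stU // memv_img.
Qed.

(** Jordan chains of the image of phi - a, for an eigenvalue a, are turned into
    Jordan chains of the whole space: the chains of a are extended by a preimage
    of their first vector, and a complement of the part of the kernel already
    reached provides chains of length one. *)
Lemma jordan_chains U : (phi @: U <= U)%VS ->
  exists cs, all ends cs /\ basis_of U (all_vecs cs).
Proof.
have [d] := ubnP (\dim U); elim: d U => // d IHd U dU stU.
have [/eqP U0|U0] := posnP (\dim U).
  exists [::]; split => //; rewrite dimv_eq0 in U0; rewrite (eqP U0).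
  by rewrite basisEdim sub0v.
have [a [w [wU w0 gw]]] := stable_eigenvector stU U0.
pose g := shifted a; pose W := (g @: U)%VS; pose Ker := lker g.
have WU : (W <= U)%VS by exact: shifted_stable.
have stW : (phi @: W <= W)%VS.
  apply/subvP => _ /memv_imgP[_ /memv_imgP[v vU ->] ->].
  rewrite phi_shifted memv_img //; apply: (subvP stU); exact: memv_img.
have dimUW : (\dim (U :&: Ker) + \dim W = \dim U)%N by exact: limg_ker_dim.
have dK : (0 < \dim (U :&: Ker))%N.
  rewrite lt0n dimv_eq0; apply: contra w0 => /eqP K0.
  by rewrite -memv0 -K0 memv_cap wU memv_ker gw eqxx.
have [|cs [ends_cs bW]] := IHd W _ stW; first by rewrite -ltnS (leq_trans _ dU) // -dimUW; lia.
have [pre preP] : {f : vT -> vT & forall u, u \in W -> f u \in U /\ g (f u) = u}.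
  apply: (@choice _ _ (fun u v => u \in W -> v \in U /\ g v = u)) => u.
  have [/memv_imgP[v vU ->]|uW] := boolP (u \in W); first by exists v.
  by exists 0.
pose Z := ((U :&: Ker) :\: (W :&: Ker))%VS.
pose ext (c : jchain) : jchain := if c.1.1 == a then (a, pre c.1.2, c.2.+1) else c.
pose cs1 := map ext cs.
pose cs2 : seq jchain := [seq (a, z, 0%N) | z <- vbasis Z].
have csW c : c \in cs -> c.1.2 \in W.
  move=> ccs; rewrite -(span_basis bW); apply: memv_span.
  exact: (@mem_all_vecs cs c 0%N).
have ext_vec c i : c \in cs -> c.1.1 = a -> chain_vec (ext c) i.+1 = chain_vec c i.
  move=> /csW cW ca; rewrite /ext ca eqxx /chain_vec [LHS]iterSr ca.
  by have [_ ->] := preP _ cW.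
exists (cs1 ++ cs2); split.
  rewrite all_cat; apply/andP; split.
    apply/allP => _ /mapP[c ccs ->]; have /allP/(_ c ccs) := ends_cs; rewrite /ends.
    have [ca|ca] := eqVneq c.1.1 a; last by rewrite /ext (negPf ca).
    have -> : (ext c).2 = c.2.+1 by rewrite /ext ca eqxx.
    by rewrite (ext_vec _ _ ccs ca).
  apply/allP => _ /mapP[z zZ ->]; rewrite /ends chain_vecS /chain_vec /=.
  have : z \in Z by apply: vbasis_mem.
  by move=> /(subvP (diffvSl _ _)); rewrite memv_cap memv_ker => /andP[].
have vecs_cat : all_vecs (cs1 ++ cs2) = all_vecs cs1 ++ all_vecs cs2.
  by rewrite /all_vecs map_cat flatten_cat.
have vecs2 : all_vecs cs2 = vbasis Z.
  by rewrite /all_vecs /cs2 -map_comp; elim: (val (vbasis Z)) => //= z s ->.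
set S := <<all_vecs (cs1 ++ cs2)>>%VS.
have vecs_S v : v \in all_vecs cs1 -> v \in S.
  by move=> h; apply: memv_span; rewrite vecs_cat mem_cat h.
have vecs_U v : v \in all_vecs (cs1 ++ cs2) -> v \in U.
  rewrite vecs_cat vecs2 mem_cat => /orP[/all_vecsP[c' [i [/mapP[c ccs ->] _ ->]]]|].
    apply: chain_mem => //; rewrite /ext; case: eqP => _ /=.
      by have [] := preP _ (csW _ ccs).
    by apply: (subvP WU); apply: csW.
  by move=> /vbasis_mem/(subvP (diffvSl _ _)); rewrite memv_cap => /andP[].
have SU : (S <= U)%VS by apply/span_subvP.
have cs_S v : v \in all_vecs cs -> v \in S.
  move=> /all_vecsP[c [i [ccs ic ->]]]; apply: vecs_S.
  have [ca|/eqP ca] := eqVneq c.1.1 a.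
    rewrite -(ext_vec c i ccs ca); apply: mem_all_vecs; first exact: map_f.
    by rewrite /ext ca eqxx.
  have -> : c = ext c by rewrite /ext; case: eqP.
  by apply: mem_all_vecs; [apply: map_f|rewrite /ext; case: eqP].
have WS : (W <= S)%VS by rewrite -(span_basis bW); apply/span_subvP.
have cs_gS v : v \in all_vecs cs -> v \in (g @: S)%VS.
  move=> /all_vecsP[c [i [ccs ic ->]]].
  have [ca|ca] := eqVneq c.1.1 a.
    rewrite -(ext_vec c i ccs ca) chain_vecS.
    have -> : (ext c).1.1 = a by rewrite /ext ca eqxx.
    apply: memv_img; apply: vecs_S; apply: mem_all_vecs; first exact: map_f.
    by rewrite /ext ca eqxx /= (leq_trans ic).
  (* For another eigenvalue g is invertible on the chain, by descending induction. *)
  have [j] := ubnP (c.2.+1 - i)%N; elim: j i ic => // j IHj i ic ij.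
  have next : chain_vec c i.+1 \in (g @: S)%VS.
    have [ic'|] := leqP i.+1 c.2; first by apply: IHj => //; lia.
    move=> ci; have -> : i.+1 = c.2.+1 by lia.
    by have /allP/(_ c ccs)/eqP-> := ends_cs; apply: mem0v.
  have ac : c.1.1 - a != 0 by rewrite subr_eq0.
  have -> : chain_vec c i = (c.1.1 - a)^-1 *: (g (chain_vec c i) - chain_vec c i.+1).
    rewrite /g chain_vecS !shiftedE opprB [X in _ *: X]addrC [X in _ *: X]addrA subrK -scalerBl scalerA.
    by rewrite mulVf ?scale1r.
  by rewrite memvZ // memvB // memv_img // cs_S // mem_all_vecs.
have US : (U <= S)%VS.
  apply/subvP => x xU.
  have : g x \in (g @: S)%VS.
    have : g x \in W by apply: memv_img.
    by rewrite -{1}(span_basis bW); apply: subvP; apply/span_subvP.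
  move=> /memv_imgP[s sS gxs].
  have : x - s \in (U :&: Ker)%VS.
    rewrite memv_cap; apply/andP; split; first by rewrite memvB // (subvP SU _ sS).
    by rewrite memv_ker linearB /= gxs subrr.
  have KS : (U :&: Ker <= S)%VS.
    apply: (@subv_trans _ _ (Z + (W :&: Ker))%VS).
      by rewrite addv_diff addvSl.
    rewrite subv_add (subv_trans (capvSl _ _) WS) andbT.
    rewrite -(span_basis (vbasisP Z)); apply/span_subvP => z zZ.
    by apply: memv_span; rewrite vecs_cat vecs2 mem_cat zZ orbT.
  by move=> /(subvP KS) xs; rewrite -(subrK s x) memvD.
(* A spanning family with at most dim U members is a basis: the number of chains
   that were extended is bounded by the kernel vectors that they contain. *)
rewrite basisEdim US /=.
have size_chain c : size (chain_vecs c) = c.2.+1 by rewrite size_map size_iota.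
pose inK := [pred v | v \in Ker].
have size1 : (size (all_vecs cs1) <= size (all_vecs cs) + count inK (all_vecs cs))%N.
  have vecs_cons c cs' : all_vecs (c :: cs') = chain_vecs c ++ all_vecs cs' by [].
  rewrite /cs1; elim: (cs) ends_cs => [//|c cs' IH /andP[ec ecs']].
  rewrite map_cons !vecs_cons !size_cat count_cat !size_chain.
  have := IH ecs'; suff : ((ext c).2 <= c.2 + count inK (chain_vecs c))%N by lia.
  have [ca|ca] := eqVneq c.1.1 a; last by rewrite /ext (negPf ca) leq_addr.
  have -> : (ext c).2 = c.2.+1 by rewrite /ext ca eqxx.
  rewrite -addn1 leq_add2l -has_count; apply/hasP.
  exists (chain_vec c c.2); first exact: mem_chain_vec.
  by rewrite inE memv_ker /g -ca -chain_vecS.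
have count_le : (count inK (all_vecs cs) <= \dim (W :&: Ker))%N.
  rewrite -size_filter; have := filter_free inK (basis_free bW).
  rewrite /free => /eqP <-; apply: dimvS; apply/span_subvP => v.
  rewrite mem_filter memv_cap => /andP[vK vcs]; rewrite (vK : v \in Ker) andbT.
  by rewrite -(span_basis bW) memv_span.
have sW : size (all_vecs cs) = \dim W by rewrite -(span_basis bW); apply/esym/eqP; exact: (basis_free bW).
have dZ : (\dim (W :&: Ker) + \dim Z <= \dim (U :&: Ker))%N.
  have := dimv_cap_compl (U :&: Ker) (W :&: Ker).
  rewrite -/Z => <-; rewrite leq_add2r dimvS // subv_cap (capvS WU (subvv _)) subvv //.
rewrite vecs_cat vecs2 size_cat size_tuple -dimUW.
apply: leq_trans (leq_add size1 (leqnn _)) _.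
by rewrite sW -addnA [leqRHS]addnC leq_add2l (leq_trans _ dZ) // leq_add2r.
Qed.

End JordanChains.

Section JordanReduction.
Variables (K : numClosedFieldType) (n : nat) (M : 'M[K]_n).

Let phi : 'End('rV[K]_n) := linfun (mulmxr M).

Lemma chain_vec_mulmx c i :
  chain_vec phi c i *m M = c.1.1 *: chain_vec phi c i + chain_vec phi c i.+1.
Proof. by rewrite chain_vecS shiftedE /phi lfunE /= addrC subrK. Qed.

(** The chains, sorted by eigenvalue and then by length, are the rows of an
    invertible matrix that conjugates M to its Jordan form. *)
Lemma jordan_reduction_exists : inhabited (jordan_reduction M).
Proof.
have [cs [ends_cs bcs]] := jordan_chains (subvf (phi @: fullv)%VS).
pose lams := undup [seq c.1.1 | c <- cs]; pose p := size lams.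
pose lam (k : 'I_p) : K := nth 0 lams k.
pose longer (c c' : jchain 'rV[K]_n) := (c'.2 <= c.2)%N.
pose blocks_of (a : K) := sort longer [seq c <- cs | c.1.1 == a].
pose ck (k : 'I_p) := blocks_of (lam k).
pose ns k := map snd (ck k).
pose c0 : jchain 'rV[K]_n := (0, 0, 0%N).
have mem_lams c : c \in cs -> c.1.1 \in lams.
  by move=> ccs; rewrite mem_undup; exact: (map_f (fun c : jchain 'rV[K]_n => c.1.1)).
have lam_inj : injective lam.
  move=> k k' /eqP; rewrite /lam nth_uniq ?undup_uniq ?ltn_ord // => /eqP; exact: val_inj.
have mem_ck k c : (c \in ck k) = (c \in cs) && (c.1.1 == lam k).
  by rewrite mem_sort mem_filter andbC.
have ns_gt0 k : (0 < size (ns k))%N.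
  rewrite size_map; have : lam k \in lams by apply: mem_nth.
  rewrite mem_undup => /mapP[c ccs lc].
  have : c \in ck k by rewrite mem_ck ccs lc eqxx.
  by case: (ck k).
have ns_sorted k : sorted geq (ns k).
  rewrite /ns sorted_map; apply: sort_sorted => c c'; exact: leq_total.
pose vec k t i : 'rV[K]_n := chain_vec phi (nth c0 (ck k) t) i.
pose Pkt k (t : 'I_(size (ns k))) : 'M[K]_((nth 0%N (ns k) t).+1, n) :=
  \matrix_(i < (nth 0%N (ns k) t).+1) vec k t i.
pose Pk k := \mxcol_(t < size (ns k)) Pkt k t.
pose P := \mxcol_(k < p) Pk k.
pose Jk k := (lam k)%:M + nilblocks K (ns k).
have nth_ck k (t : 'I_(size (ns k))) : nth c0 (ck k) t \in ck k.
  by rewrite mem_nth // -(size_map snd) ltn_ord.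
have nth_ns k (t : 'I_(size (ns k))) : nth 0%N (ns k) t = (nth c0 (ck k) t).2.
  by rewrite (nth_map c0) // -(size_map snd) ltn_ord.
have PM : (\mxdiag_k Jk k) *m P = P *m M.
  apply/mxcolP => k; rewrite submxcol_mxdiag_mul -submxcol_mul !mxcolK.
  apply/mxcolP => t; rewrite mulmxDl submxcolD submxcol_mxdiag_mul -[in RHS]submxcol_mul.
    rewrite mul_scalar_mx mxcolK.
  have -> : submxcol (lam k *: Pk k) t = lam k *: Pkt k t.
    apply/matrixP => i j; rewrite mxE mxE [RHS]mxE; congr (_ * _).
    by rewrite -(mxcolK (Pkt k) t) [RHS]mxE.
  apply/matrixP => i j; rewrite mxE nilU_mul mxE.
  have [cs_t /eqP lam_t] : nth c0 (ck k) t \in cs /\ (nth c0 (ck k) t).1.1 == lam k.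
    by apply/andP; rewrite -mem_ck.
  have -> : (Pkt k t *m M) i j = (vec k t i *m M) 0 j.
    by rewrite !mxE; apply: eq_bigr => l _; rewrite mxE.
  rewrite chain_vec_mulmx lam_t [RHS]mxE; congr (_ + _); first by rewrite !mxE.
  case: insubP => [i' _ ii'|]; first by rewrite mxE ii'.
  rewrite -leqNgt ltnS => ti.
  have -> : i.+1 = (nth c0 (ck k) t).2.+1.
    by congr _.+1; apply/eqP; rewrite -nth_ns eqn_leq ti andbT -ltnS ltn_ord.
  by have /allP/(_ _ cs_t)/eqP-> := ends_cs; rewrite mxE.
have row_P (v : 'rV[K]_n) : (v <= P)%MS.
  have : v \in <<all_vecs phi cs>>%VS by rewrite (span_basis bcs) memvf.
  rewrite -(in_tupleE (all_vecs phi cs)) => /coord_span->.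
  apply: summx_sub => r _; apply: scalemx_sub.
  have : (in_tuple (all_vecs phi cs))`_r \in all_vecs phi cs by apply: mem_nth.
  move=> /all_vecsP[c [i [ccs ic ->]]].
  have kp : (index c.1.1 lams < p)%N by rewrite index_mem mem_lams.
  pose k := Ordinal kp.
  have lamk : lam k = c.1.1 by rewrite /lam nth_index // mem_lams.
  have cck : c \in ck k by rewrite mem_ck ccs lamk eqxx.
  have tp : (index c (ck k) < size (ns k))%N by rewrite size_map index_mem.
  pose t := Ordinal tp.
  have ip : (i < (nth 0%N (ns k) t).+1)%N by rewrite nth_ns /= nth_index // ltnS.
  have -> : chain_vec phi c i = row (tagnat.Rank k (tagnat.Rank t (Ordinal ip))) P.
    apply/rowP => j; rewrite mxE.
    have -> : P (tagnat.Rank k (tagnat.Rank t (Ordinal ip))) j =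
       submxcol (submxcol P k) t (Ordinal ip) j by rewrite [RHS]mxE [RHS]mxE.
    by rewrite !mxcolK mxE /vec nth_index.
  exact: row_sub.
have full_P : row_full P.
  by rewrite -sub1mx; apply/row_subP => i; apply: row_P.
have dimE : (\sum_(k < p) \sum_(t < size (ns k)) (nth 0%N (ns k) t).+1)%N = n.
  transitivity (\sum_(a <- lams) \sum_(c <- cs | c.1.1 == a) c.2.+1)%N.
    rewrite (big_nth 0) big_mkord; apply: eq_bigr => k _.
    transitivity (\sum_(c <- ck k) c.2.+1)%N; last first.
      by rewrite (perm_big _ (permEl (perm_sort _ _))) big_filter.
    rewrite -(big_mkord xpredT (fun t => (nth 0%N (ns k) t).+1)).
    by rewrite -(big_nth 0%N xpredT (fun m => m.+1)) /ns big_map.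
  rewrite (exchange_big_dep xpredT) //=.
  transitivity (\sum_(c <- cs) c.2.+1)%N.
    rewrite big_seq [RHS]big_seq; apply: eq_bigr => c ccs.
    rewrite -big_filter (_ : [seq a <- lams | _] = [:: c.1.1]) ?big_seq1 //.
    rewrite (eq_filter (a2 := pred1 c.1.1)); last by move=> a; rewrite /= eq_sym.
    by rewrite filter_pred1_uniq ?undup_uniq // mem_lams.
  have -> : (\sum_(c <- cs) c.2.+1)%N = size (all_vecs phi cs).
    rewrite /all_vecs; elim: (cs) => [|c cs' IH]; first by rewrite big_nil.
    by rewrite big_cons IH map_cons [flatten _]/= size_cat size_map size_iota.
  have /eqP <- := basis_free bcs.
  by rewrite (span_basis bcs) dimvf /dim /= mul1n.
have free_P : row_free P by move: full_P; rewrite /row_free /row_full => /eqP->; rewrite eq_sym; apply/eqP.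
have PV : P *m pinvmx P = 1%:M by apply: mulmxVp.
have VP : pinvmx P *m P = 1%:M by apply: mulVpmx.
constructor.
apply: (@JordanReduction K n M p lam ns (pinvmx P)^T P^T) => //.
- by rewrite -trmx_mul PV trmx1.
- by rewrite -trmx_mul VP trmx1.
- by rewrite !trmxK -PM -mulmxA PV mulmx1.
Qed.

End JordanReduction.

(** * Solutions in Jordan coordinates *)

Section Assembly.
Variables (R : realType) (n : nat).
Notation C := (Cplx R).
Variables (M : 'M[C]_n) (D : set 'cV[C]_n) (f g : 'cV[C]_n -> C).
Hypotheses (oD : open D) (hf : holomorphic_on D f) (hg : holomorphic_on D g).
Hypothesis hfg : is_solution M D f g.
Variable J : jordan_reduction M.
Notation p := (jr_p J).
Notation lam := (@jr_lam _ _ _ J).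
Notation ns := (@jr_ns _ _ _ J).
Notation A := (jr_A J).
Notation B := (jr_B J).
Notation letter := ('I_p * (nat * nat))%type.

(** Direction of a Jordan coordinate: a column of the inverse of the reduction. *)
Definition chain_col k (t : 'I_(size (ns k))) (i : 'I_(nth 0%N (ns k) t).+1) : 'cV[C]_n :=
  col (tagnat.Rank k (tagnat.Rank t i)) B.

Definition letter_vec (e : letter) : 'cV[C]_n :=
  if insub e.2.1 is Some t then
    if insub e.2.2 is Some i then @chain_col e.1 t i else 0
  else 0.

Definition letter_coord (y : 'cV[C]_n) (e : letter) : C :=
  block_coord (submxcol (A *m y) e.1) e.2.1 e.2.2.

Lemma letter_vec_ord k (t : 'I_(size (ns k))) (i : 'I_(nth 0%N (ns k) t).+1) :
  letter_vec (k, (val t, val i)) = chain_col i.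
Proof. by rewrite /letter_vec /= !valK. Qed.

Lemma letter_vec_out k t i : ~~ (i <= nth 0%N (ns k) t)%N -> letter_vec (k, (t, i)) = 0.
Proof.
move=> hi; rewrite /letter_vec /=; case: insubP => [t' _ tt'|//].
by rewrite insubF // ltnS tt'; apply: negbTE.
Qed.

Lemma sum_letters_coord y :
  y = \sum_(e <- letters ns) letter_coord y e *: letter_vec e.
Proof.
transitivity (B *m (A *m y)); first by rewrite mulmxA (jr_BA J) mul1mx.
set z := A *m y.
have -> : B *m z = \sum_k \sum_(t < size (ns k)) \sum_(i < (nth 0%N (ns k) t).+1)
    submxcol (submxcol z k) t i 0 *: chain_col i.
  rewrite -{1}(submxrowK B) -{1}(submxcolK z) mul_mxrow_mxcol.
  apply: eq_bigr => k _.
  rewrite -{1}(submxrowK (submxrow B k)) -{1}(submxcolK (submxcol z k)) mul_mxrow_mxcol.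
  apply: eq_bigr => t _; apply/matrixP => r l; rewrite mxE summxE.
  by apply: eq_bigr => i _; rewrite !mxE mulrC (ord1 l).
rewrite /letters big_allpairs_dep big_enum /=; apply: eq_bigr => k _.
have iotaE m : iota 0 m = index_iota 0 m by rewrite /index_iota subn0.
rewrite /block_letters big_allpairs_dep iotaE big_mkord.
apply: eq_bigr => t _; rewrite big_mkord; apply: eq_bigr => i _.
by rewrite /letter_coord /letter_vec /block_coord /= !valK.
Qed.

(** The columns of the inverse of the reduction are Jordan chains of the transpose
    of M. *)
Lemma chain_col_mulmx k t i : (@chain_col k t i)^T *m M =
  lam k *: (letter_vec (k, (val t, val i)))^T + (letter_vec (k, (val t, (val i).+1)))^T.
Proof.
have PM : B^T *m M = \mxdiag_(k < p) ((lam k)%:M + nilblocks C (ns k)) *m B^T.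
  by rewrite -(jr_jordan J) -!mulmxA -trmx_mul (jr_BA J) trmx1 mulmx1.
have -> : (chain_col i)^T *m M = row i (submxcol (submxcol (B^T *m M) k) t).
  apply/rowP => r; rewrite !mxE; apply: eq_bigr => l _; by rewrite !mxE.
rewrite PM submxcol_mxdiag_mul mulmxDl mul_scalar_mx submxcolD submxcol_mxdiag_mul.
apply/rowP => r; rewrite mxE mxE nilU_mul [RHS]mxE; congr (_ + _).
  by rewrite /letter_vec /= !valK !mxE.
rewrite /letter_vec /= valK mxE; case: insubP => [i' _ ii'|]; last by rewrite mxE.
by rewrite !mxE.
Qed.

Lemma derive_grad (h : 'cV[C]_n -> C) v x : differentiable h x ->
  'D_v h x = (v^T *m grad h x) 0 0.
Proof.
move=> dh; rewrite deriveE // mxE.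
have -> : v = \sum_i v i 0 *: delta_mx i 0.
  apply/matrixP => r l; rewrite summxE (bigD1 r) //= !mxE eqxx (ord1 l) mulr1 big1 ?addr0 //.
  by move=> i ir; rewrite !mxE eq_sym (negPf ir) mulr0.
rewrite linear_sum; apply: eq_bigr => i _; rewrite linearZ /= -deriveE //.
rewrite !mxE; congr (_ * _).
rewrite summxE (bigD1 i) //= !mxE eqxx mulr1 big1 ?addr0 //.
by move=> j ji; rewrite !mxE eq_sym (negPf ji) mulr0.
Qed.

Lemma dirder_zero (h : 'cV[C]_n -> C) x : dirder 0 h x = 0.
Proof.
apply: dirder_eq; rewrite /lderiv.
rewrite (_ : (fun t => _) = fun=> h x); first exact: cderiv_cst.
by apply/funext => t; rewrite scaler0 addr0.
Qed.

(** Since the gradient of f is M times that of g, differentiating f along a vector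
    amounts to differentiating g along its image under the transpose of M. *)
Lemma dirder_letter k t i x : D x ->
  dirder (letter_vec (k, (t, i))) f x =
  lam k * dirder (letter_vec (k, (t, i))) g x + dirder (letter_vec (k, (t, i.+1))) g x.
Proof.
move=> Dx; have [df dg] := (hf Dx, hg Dx).
have [hi|hi] := boolP (i <= nth 0%N (ns k) t)%N; last first.
  have hi' : ~~ (i.+1 <= nth 0%N (ns k) t)%N by apply: contra hi; apply: ltnW.
  by rewrite !letter_vec_out // !dirder_zero mulr0 addr0.
have [ht|ht] := boolP (t < size (ns k))%N; last first.
  have v0 j : letter_vec (k, (t, j)) = 0 by rewrite /letter_vec /= insubF //; apply: negbTE.
  by rewrite !v0 !dirder_zero mulr0 addr0.
have vE : letter_vec (k, (t, i)) = @chain_col k (Ordinal ht) (Ordinal (hi : (i < (nth 0%N (ns k) (Ordinal ht)).+1)%N)).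
  exact: (@letter_vec_ord k (Ordinal ht) (Ordinal (hi : (i < (nth 0%N (ns k) (Ordinal ht)).+1)%N))).
rewrite !dirder_differentiable // !derive_grad // (hfg Dx) mulmxA.
rewrite [in X in X *m M]vE chain_col_mulmx /= mulmxDl -scalemxAl.
by rewrite mxE mxE.
Qed.

End Assembly.

Section LocalRepresentation.
Variables (R : realType) (n : nat).
Notation C := (Cplx R).
Hypothesis n_gt0 : (0 < n)%N.
Variables (M : 'M[C]_n) (D : set 'cV[C]_n) (f g : 'cV[C]_n -> C).
Hypotheses (oD : open D) (hf : holomorphic_on D f) (hg : holomorphic_on D g).
Hypothesis hfg : is_solution M D f g.
Variable J : jordan_reduction M.
Notation p := (jr_p J).
Notation lam := (@jr_lam _ _ _ J).
Notation ns := (@jr_ns _ _ _ J).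
Notation A := (jr_A J).
Notation B := (jr_B J).
Notation letter := ('I_p * (nat * nat))%type.
Notation lvec := (@letter_vec R n M J).
Notation lcoord := (@letter_coord R n M J).

Lemma eq_of_rate (u v : C) (K : R) :
  (forall d, cmod (u - v) <= K * 2^-1 ^+ d.+1) -> u = v.
Proof.
move=> h; apply/eqP; rewrite -subr_eq0; apply/negPn/negP => n0.
have p0 := cmod_gt0 n0.
have K0 : 0 < K + 1.
  have := h 0%N; rewrite expr1; lra.
have [l hl] := halfX_small (divr_gt0 p0 K0).
have := hl l.+1 (leqnSn l); rewrite ltr_pdivlMr //.
have := h l; have : 0 < 2^-1 ^+ l.+1 :> R by rewrite exprn_gt0 // invr_gt0.
lra.
Qed.

Lemma eigenvalue_count_gt0 : (0 < p)%N.
Proof.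
rewrite lt0n; apply/negP => /eqP p0.
have : (1%:M : 'M[C]_n) (Ordinal n_gt0) (Ordinal n_gt0) = 0.
  rewrite -(jr_BA J) mxE big1 // => i _.
  have k := tagnat.sig1 i; by move: (ltn_ord k); rewrite {2}p0.
by rewrite mxE eqxx => /eqP; rewrite oner_eq0.
Qed.

Lemma l1norm_mul_le m (X : 'M[C]_(m, n)) : exists2 K : R, 0 < K &
  forall y i, cmod ((X *m y) i 0) <= K * l1norm y.
Proof.
exists (1 + \sum_i \sum_j cmod (X i j)).
  by rewrite ltr_pwDl // sumr_ge0 // => i _; apply: sumr_ge0 => j _; apply: cmod_ge0.
move=> y i; rewrite mxE; apply: le_trans (cmod_sum _ _ _) _.
have l0 : 0 <= l1norm y by apply: sumr_ge0 => j _; apply: cmod_ge0.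
apply: (@le_trans _ _ (\sum_j cmod (X i j) * l1norm y)).
  by apply: ler_sum => j _; rewrite cmodM ler_wpM2l ?cmod_ge0 ?cmod_le_l1norm.
rewrite -mulr_suml ler_wpM2r // (bigD1 i) //= addrCA lerDl addr_ge0 // sumr_ge0 // => k _.
by apply: sumr_ge0 => j _; apply: cmod_ge0.
Qed.

Lemma block_coord_small k : exists2 K : R, 0 < K &
  forall y, l1norm (submxcol (A *m y) k) <= K * l1norm y.
Proof.
have [K K0 hK] := l1norm_mul_le A.
exists (1 + \sum_(i < \sum_(t < size (ns k)) (nth 0%N (ns k) t).+1) K).
  by rewrite ltr_pwDl // sumr_ge0 // => i _; apply: ltW.
move=> y; have l0 : 0 <= l1norm y by apply: sumr_ge0 => j _; apply: cmod_ge0.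
rewrite mulrDl mul1r mulr_suml; apply: ler_wpDl => //.
by apply: ler_sum => i _; rewrite mxE.
Qed.

Lemma letter_vec_bounded : exists2 c : R, 0 < c & forall e : letter, l1norm (letter_vec e) <= c.
Proof.
exists (1 + \sum_r \sum_l cmod (B r l)).
  by rewrite ltr_pwDl // sumr_ge0 // => i _; apply: sumr_ge0 => j _; apply: cmod_ge0.
move=> e.
have s0 : 0 <= \sum_r \sum_l cmod (B r l).
  by rewrite sumr_ge0 // => i _; apply: sumr_ge0 => j _; apply: cmod_ge0.
have z0 : l1norm (0 : 'cV[C]_n) <= 1 + \sum_r \sum_l cmod (B r l).
  rewrite /l1norm big1 ?addr_ge0 // => i _; by rewrite mxE cmod0.
rewrite /letter_vec; case: insubP => [t _ _|//]; case: insubP => [i _ _|//].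
apply: (@le_trans _ _ (\sum_r \sum_l cmod (B r l))); last by rewrite lerDr.
apply: ler_sum => r _; rewrite mxE (bigD1 (tagnat.Rank e.1 (tagnat.Rank t i))) //=.
by rewrite lerDl sumr_ge0 // => j _; apply: cmod_ge0.
Qed.

Section AtPoint.
Variables (a : 'cV[C]_n) (rho Mf Mg : R).
Hypothesis rho_gt0 : 0 < rho.
Hypothesis ball_D : forall x, l1norm (x - a) < rho -> D x.
Hypotheses (hol_f : hol (@l1norm R n) a rho Mf f) (hol_g : hol (@l1norm R n) a rho Mg g).

Let l1normD' := @l1normD R n.
Let l1normZ' := @l1normZ R n.
Let lf := hol_lhol hol_f.
Let lg := hol_lhol hol_g.

Definition form_at (h : 'cV[C]_n -> C) (w : seq letter) : C :=
  iter_dirder (map lvec w) h a.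
Let F := form_at f.
Let G := form_at g.

Lemma center_in_ball : l1norm (a - a) < rho.
Proof. by rewrite subrr (nv0 l1normZ'). Qed.

Lemma form_at_perm h : lhol (@l1norm R n) a rho h ->
  forall s t, perm_eq s t -> form_at h s = form_at h t.
Proof.
move=> lh s t st; apply: (iter_dirder_perm l1normD' l1normZ' lh center_in_ball).
exact: perm_map.
Qed.

Lemma form_f_head k t i s :
  F ((k, (t, i)) :: s) = lam k * G ((k, (t, i)) :: s) + G ((k, (t, i.+1)) :: s).
Proof.
apply: (@iter_dirder_linear _ _ _ l1normD' l1normZ' a rho (map lvec s)
  (dirder (letter_vec (k, (t, i))) f) (dirder (letter_vec (k, (t, i))) g)
  (dirder (letter_vec (k, (t, i.+1))) g)); last exact: center_in_ball.
- exact: (lhol_dirder l1normD' l1normZ').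
- exact: (lhol_dirder l1normD' l1normZ').
by move=> y /ball_D Dy; apply: dirder_letter Dy.
Qed.

Lemma iter_dirder_head_at h : lhol (@l1norm R n) a rho h -> forall (k : C) u v s,
  iter_dirder (k *: u + v :: s) h a = k * iter_dirder (u :: s) h a + iter_dirder (v :: s) h a.
Proof. by move=> lh k u v s; apply: (iter_dirder_head l1normD' l1normZ' _ _ _ _ lh center_in_ball). Qed.

Lemma form_g_out k t i s : ~~ (i <= nth 0%N (ns k) t)%N -> G ((k, (t, i)) :: s) = 0.
Proof.
move=> hi; rewrite /G /form_at /= letter_vec_out //.
exact: (@Tm_0 _ _ (fun s => iter_dirder s g a) (iter_dirder_head_at lg)).
Qed.

Lemma taylor_words h d y : lhol (@l1norm R n) a rho h ->
  iter_dirder (nseq d y) h a =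
  \sum_(w <- words (letters ns) d) (\prod_(e <- w) lcoord y e) * form_at h w.
Proof.
move=> lh; have hp s t : perm_eq s t -> iter_dirder s h a = iter_dirder t h a.
  by move=> st; apply: (iter_dirder_perm l1normD' l1normZ' lh center_in_ball).
have := @multilinear_words _ _ _ (fun s => iter_dirder s h a) hp (iter_dirder_head_at lh)
  (letters ns) _ _ y d [::] (sum_letters_coord J y).
rewrite cats0 => ->; apply: eq_bigr => w _.
by rewrite cats0.
Qed.

(** The constant term g a is shared equally between the eigenvalues. *)
Definition Gam_at k sigma w : C :=
  if sigma is [::] then (if w is 0%N then g a / p%:R else 0) else Gam G k sigma w.

Lemma Gam_at_out k sigma w t : t \in sigma -> (nth 0%N (ns k) t < w)%N ->
  Gam_at k sigma w = 0.
Proof.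
case: sigma => // t' sigma; rewrite /Gam_at.
exact: (Gam_eq0 (form_at_perm lg) (form_at_perm lf) form_f_head form_g_out).
Qed.

Lemma Gam_at_le : exists2 c : R, 0 < c & forall k sigma w,
  cmod (Gam_at k sigma w) <= Mg * c ^+ size sigma * ((size sigma)`!)%:R.
Proof.
have [c c0 hc] := letter_vec_bounded.
exists (8 * c / rho); first by rewrite divr_gt0 // mulr_gt0.
have ga_le : cmod (g a) <= Mg by have [] := hol_g center_in_ball.
move=> k [|t sigma] w.
  rewrite expr0 fact0 !mulr1 /Gam_at; case: w => [|w]; last first.
    by rewrite cmod0 (le_trans _ ga_le) ?cmod_ge0.
  rewrite cmodM cmodV cmod_nat ler_pdivrMr ?ltr0n ?eigenvalue_count_gt0 //.
  have Mg0 := le_trans (cmod_ge0 _) ga_le.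
  by rewrite (le_trans ga_le) // ler_peMr // ler1n eigenvalue_count_gt0.
rewrite /Gam_at /Gam /G /form_at.
set s := map _ _; have ss : size s = size (t :: sigma) by rewrite !size_map /= size_map.
rewrite -ss; apply: (iter_dirder_le l1normD' l1normZ' hol_g rho_gt0 c0); last first.
  by rewrite subrr (nv0 l1normZ') divr_gt0.
by move=> v /mapP[e _ ->].
Qed.

Variable y : 'cV[C]_n.

(** Homogeneous part of degree d of the solution for the eigenvalue k, times d!. *)
Definition level_poly k d : {poly C} :=
  \sum_(sigma <- block_words (ns k) d) Gpoly (ns k) (Gam_at k) sigma
     * \prod_(t <- sigma) yblock t (submxcol (A *m y) k).

Lemma level_polyS k d :
  level_poly k d.+1 = form_poly ns G (lcoord y) k d.+1.
Proof.
rewrite /level_poly /form_poly /block_words !big_wordsS.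
by apply: eq_bigr => t _; apply: eq_bigr => sigma _.
Qed.

Lemma coef_level_poly0 k j : (j <= nth 0%N (ns k) 0)%N ->
  (level_poly k 0)`_j = Gam_at k [::] (nth 0%N (ns k) 0 - j).
Proof.
by move=> hj; rewrite /level_poly /block_words big_words0 big_nil mulr1 coef_poly ltnS hj.
Qed.

Lemma sub_coef_level_poly0 k : sub_coef ns k (level_poly k 0) = 0.
Proof.
rewrite /sub_coef /head_index; case hN: (nth 0%N (ns k) 0) => [//|N].
by rewrite coef_level_poly0 hN // subSnn.
Qed.

Lemma taylor_g_level d : iter_dirder (nseq d y) g a =
  \sum_k (level_poly k d)`_(nth 0%N (ns k) 0).
Proof.
case: d => [|d].
  rewrite (eq_bigr (fun=> g a / p%:R)) => [|k _]; last first.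
    by rewrite coef_level_poly0 // subnn.
  rewrite sumr_const card_ord -[RHS]mulr_natr divfK //.
  by rewrite pnatr_eq0 -lt0n eigenvalue_count_gt0.
rewrite (taylor_words _ _ lg) (form_G (@jr_lam_inj _ _ _ J) (form_at_perm lg)
  (form_at_perm lf) form_f_head form_g_out _ (@jr_ns_sorted _ _ _ J)).
by apply: eq_bigr => k _; rewrite level_polyS.
Qed.

Definition shift_constant : C := f a - \sum_k lam k * (g a / p%:R).

(** For d = 0 the constant of integration compensates the eigenvalues times the
    shares of g a. *)
Lemma taylor_f_level d : iter_dirder (nseq d y) f a =
  \sum_k (lam k * (level_poly k d)`_(nth 0%N (ns k) 0) + sub_coef ns k (level_poly k d))
  + (if d is 0%N then shift_constant else 0).
Proof.
case: d => [|d].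
  rewrite (eq_bigr (fun k => lam k * (g a / p%:R))) => [|k _]; last first.
    by rewrite coef_level_poly0 // subnn sub_coef_level_poly0 addr0.
  by rewrite /shift_constant addrC subrK.
rewrite addr0 (taylor_words _ _ lf) (form_F (@jr_lam_inj _ _ _ J) (form_at_perm lg)
  (form_at_perm lf) form_f_head form_g_out _ (@jr_ns_sorted _ _ _ J)).
by apply: eq_bigr => k _; rewrite level_polyS.
Qed.

End AtPoint.

End LocalRepresentation.

Section Final.
Variables (R : realType) (n : nat).
Notation C := (Cplx R).
Hypothesis n_gt0 : (0 < n)%N.
Variables (M : 'M[C]_n) (D : set 'cV[C]_n) (f g : 'cV[C]_n -> C).
Hypotheses (oD : open D) (hf : holomorphic_on D f) (hg : holomorphic_on D g).
Hypothesis hfg : is_solution M D f g.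
Variable J : jordan_reduction M.
Notation p := (jr_p J).
Notation lam := (@jr_lam _ _ _ J).
Notation ns := (@jr_ns _ _ _ J).
Notation A := (jr_A J).

Lemma sum_dist_le (I : finType) (F G : I -> C) (c : I -> C) (K : I -> R) (e : R) :
  (forall k, cmod (F k - G k) <= K k * e) ->
  cmod (\sum_k c k * F k - \sum_k c k * G k) <= (\sum_k cmod (c k) * K k) * e.
Proof.
move=> h; rewrite -sumrB mulr_suml; apply: le_trans (cmod_sum _ _ _) _.
apply: ler_sum => k _; rewrite -mulrBr cmodM -mulrA.
by rewrite ler_wpM2l ?cmod_ge0.
Qed.

(** Near a, both sides are limits of the same partial sums over the degree: Taylor
    sums of f and g on the one hand, sums over block words on the other. *)
Lemma star_analytic_at_reduction : star_analytic_wrt J D f g.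
Proof.
move=> a Da.
have [rf [Mf [rf0 Df hol_f]]] := holomorphic_hol oD Da hf.
have [rg [Mg [rg0 Dg hol_g]]] := holomorphic_hol oD Da hg.
pose rho := Num.min rf rg.
have rho0 : 0 < rho by rewrite lt_min rf0.
have ball_D x : l1norm (x - a) < rho -> D x by rewrite lt_min => /andP[/Df].
have {}hol_f : hol (@l1norm R n) a rho Mf f by apply: hol_sub hol_f; rewrite ge_min lexx.
have {}hol_g : hol (@l1norm R n) a rho Mg g by apply: hol_sub hol_g; rewrite ge_min lexx orbT.
have [c0 c00 Gam_le] := Gam_at_le n_gt0 J rho0 hol_g.
have rep k : exists V : 'cV[C]_(\sum_(t < size (ns k)) (nth 0%N (ns k) t).+1) -> {poly C},
    sum_of_star_series V /\ exists2 r : R, 0 < r & exists K1 : R,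
    forall z, l1norm z < r -> forall j, (j <= nth 0%N (ns k) 0)%N -> forall D,
    cmod (\sum_(0 <= d < D) (d`!)%:R^-1 *
        (\sum_(sigma <- block_words (ns k) d) Gpoly (ns k) (Gam_at g a k) sigma
           * \prod_(t <- sigma) yblock t z)`_j - (V z)`_j) <= K1 * 2^-1 ^+ D.
  apply: star_representation (Gam_le k).
  - exact: jr_ns_sorted.
  - exact: jr_ns_gt0.
  - by case.
  - move=> sigma w t; exact: (Gam_at_out hf hg hfg rho0 ball_D hol_f hol_g).
  - exact: c00.
pose V k := sval (cid (rep k)).
have V_series k : sum_of_star_series (V k) by have [] := svalP (cid (rep k)).
have V_rate k : exists rK : R * R, 0 < rK.1 /\ forall y, l1norm y < rK.1 ->
    forall j, (j <= nth 0%N (ns k) 0)%N -> forall d,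
    cmod (\sum_(0 <= i < d) (i`!)%:R^-1 * (level_poly g a y k i)`_j
      - (V k (submxcol (A *m y) k))`_j) <= rK.2 * 2^-1 ^+ d.
  have [_ [r r0 [K1 hK1]]] := svalP (cid (rep k)).
  have [Kb Kb0 hKb] := block_coord_small k.
  exists (r / Kb, K1); rewrite /= divr_gt0 //; split=> // y.
  rewrite ltr_pdivlMr // mulrC => hy j hj d.
  exact: (hK1 _ (le_lt_trans (hKb y) hy)).
have [rK hrK] := choice V_rate.
have V0 k : 0 <= (rK k).2.
  have [r0 h] := hrK k; have := h 0; rewrite {1}/l1norm big1 => [/(_ r0)|i _]; last by rewrite mxE cmod0.
  by move=> /(_ 0%N (leq0n _) 0%N); rewrite expr0 mulr1; apply: le_trans; apply: cmod_ge0.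
exists V, (shift_constant f g J a); split => //.
pose r0 := Num.min (rho / 64) (1 + \sum_k (rK k).1^-1)^-1.
have s0 : 0 < 1 + \sum_k (rK k).1^-1.
  by rewrite ltr_pwDl // sumr_ge0 // => k _; rewrite invr_ge0 ltW //; case: (hrK k).
apply/nbhs_l1norm; exists r0; first by rewrite lt_min divr_gt0 //= invr_gt0.
move=> x; rewrite lt_min => /andP[hx1 hx2].
pose y := x - a; rewrite -/y in hx1 hx2 *.
have xE : x = a + y by rewrite /y addrC subrK.
have hy k : l1norm y < (rK k).1.
  apply: lt_le_trans hx2 _; have [r10 _] := hrK k.
  rewrite -[leRHS]invrK lef_pV2 ?posrE ?invr_gt0 // (bigD1 k) //= addrCA lerDl.
  by rewrite addr_ge0 // sumr_ge0 // => i _; rewrite invr_ge0 ltW //; case: (hrK i).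
have hx64 : 64 * l1norm y < rho by move: hx1; rewrite ltr_pdivlMr // mulrC.
pose T k d := \sum_(0 <= i < d) (i`!)%:R^-1 * (level_poly g a y k i)`_(nth 0%N (ns k) 0).
pose S k d := \sum_(0 <= i < d) (i`!)%:R^-1 * sub_coef ns k (level_poly g a y k i).
pose z k := submxcol (A *m y) k.
have T_rate k d : cmod (T k d - top_coef (ns k) (V k (z k))) <= (rK k).2 * 2^-1 ^+ d.
  have [_ h] := hrK k; exact: (h y (hy k) _ (leqnn _) d).
have S_rate k d : cmod (S k d - subtop_coef (ns k) (V k (z k))) <= (rK k).2 * 2^-1 ^+ d.
  have [_ h] := hrK k; rewrite /S /sub_coef /head_index /subtop_coef.
  have := h y (hy k); case: (nth 0%N (ns k) 0) => [|N] hN; last exact: (hN N (leqnSn N) d).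
  rewrite subr0 big1 => [|i _]; last by rewrite mulr0.
  by rewrite cmod0 mulr_ge0 ?V0 // exprn_ge0 // invr_ge0.
have sumT (c : 'I_p -> C) d := sum_dist_le c (fun k => T_rate k d).
have sumS (c : 'I_p -> C) d := sum_dist_le c (fun k => S_rate k d).
split.
  apply: (@eq_of_rate _ _ _ (Mg + \sum_k cmod (1 : C) * (rK k).2)) => d.
  have t1 := taylor_rate (@l1normD R n) (@l1normZ R n) hol_g rho0 hx64 d.
  have t2 := sumT (fun=> 1) d.+1; rewrite -xE in t1.
  have e1 : \sum_(i < d.+1) iter_dirder (nseq i y) g a / (i`!)%:R = \sum_k 1 * T k d.+1.
    under [RHS]eq_bigr do rewrite mul1r; rewrite exchange_big big_mkord.
    apply: eq_bigr => i _; rewrite -mulr_sumr mulrC; congr (_ * _).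
    exact: (taylor_g_level n_gt0 hf hg hfg J rho0 ball_D hol_f hol_g).
  rewrite e1 in t1.
  rewrite (eq_bigr (fun k => 1 * top_coef (ns k) (V k (z k)))) => [|k _]; last by rewrite mul1r.
  by rewrite mulrDl; apply: le_trans (cmod_triangle (\sum_k 1 * T k d.+1) _ _) (lerD t1 t2).
apply: (@eq_of_rate _ _ _ (Mf + (\sum_k cmod (lam k) * (rK k).2
    + \sum_k cmod (1 : C) * (rK k).2))) => d.
have t1 := taylor_rate (@l1normD R n) (@l1normZ R n) hol_f rho0 hx64 d.
have t2 := sumT lam d.+1; have t3 := sumS (fun=> 1) d.+1; rewrite -xE in t1.
have e1 : \sum_(i < d.+1) iter_dirder (nseq i y) f a / (i`!)%:R =
    \sum_k lam k * T k d.+1 + \sum_k 1 * S k d.+1 + shift_constant f g J a.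
  rewrite (eq_bigr (fun i : 'I_d.+1 => (\sum_k lam k * ((i`!)%:R^-1 * (level_poly g a y k i)`_(nth 0%N (ns k) 0))
     + \sum_k 1 * ((i`!)%:R^-1 * sub_coef ns k (level_poly g a y k i)))
     + (if val i is 0%N then shift_constant f g J a else 0))); last first.
    move=> i _; rewrite (taylor_f_level hf hg hfg J rho0 ball_D hol_f hol_g).
    rewrite mulrDl; congr (_ + _); last first.
      by case: i => -[|m] hm /=; rewrite ?mul0r ?fact0 ?divr1.
    rewrite big_split mulrDl /= !mulr_suml; congr (_ + _); apply: eq_bigr => k _.
      by rewrite -mulrA [X in _ * X]mulrC.
    by rewrite mul1r mulrC.
  rewrite big_split big_split /=; congr (_ + _ + _).
  - rewrite exchange_big; apply: eq_bigr => k _.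
    by rewrite -mulr_sumr /T big_mkord.
  - rewrite exchange_big; apply: eq_bigr => k _.
    by rewrite -mulr_sumr /S big_mkord.
  - by rewrite big_ord_recl /= big1 ?addr0.
rewrite e1 in t1; rewrite big_split /=.
rewrite [X in _ + X + _](eq_bigr (fun k => 1 * subtop_coef (ns k) (V k (z k)))) => [|k _]; last by rewrite mul1r.
rewrite !mulrDl.
apply: le_trans (cmod_triangle (\sum_k lam k * T k d.+1 + \sum_k 1 * S k d.+1
   + shift_constant f g J a) _ _) (lerD t1 _).
rewrite opprD addrACA subrr addr0 opprD addrACA.
exact: le_trans (cmodD _ _) (lerD t2 t3).
Qed.

End Final.

Theorem theorem9 (R : realType) (n : nat) (hn : (0 < n)%N)
    (M : 'M[Cplx R]_n) (D : set 'cV[Cplx R]_n)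
    (hDo : open D) (hDc : convex_set D)
    (f g : 'cV[Cplx R]_n -> Cplx R)
    (hf : holomorphic_on D f) (hg : holomorphic_on D g)
    (hfg : is_solution M D f g) :
  star_analytic M D f g.
Proof.
split; first exact: jordan_reduction_exists.
by move=> J; apply: star_analytic_at_reduction.
Qed.
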